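(* Let $m>1$, let $N\geq4$ be an integer, and let $\sigma_c=\frac{2(N-1)(m-1)}{3m+1}$. Consider, for $\sigma>0$, the differential equation $$(f^m)''(\xi)+\frac{N-1}{\xi}(f^m)'(\xi)-\frac{1}{m-1}f(\xi)+\xi^{\sigma}f^m(\xi)=0,\qquad \xi\ge 0 .$$ Then for every $\sigma\in(0,\sigma_c)$ there exists a good profile with interface for this equation, and for every $\sigma\in[\sigma_c,2(N-3)]$ there exists no good profile with interface for this equation.
   Context: The equation is the one satisfied by the profiles $f\ge 0$ of separate variable solutions $u(x,t)=(T-t)^{-1/(m-1)}f(|x|)$ of $\partial_t u=\Delta u^m+|x|^\sigma u^m$ in $\mathbb{R}^N$. A nonnegative solution $f$ of the differential equation is a \emph{good profile} if it satisfies one of the following: (P1) $f(0)=a>0$ and $f'(0)=0$; (P2) $f(0)=0$ and $(f^m)'(0)=0$; (P3) there exists $\xi_0\in(0,\infty)$ such that $f(\xi_0)=0$, $(f^m)'(\xi_0)=0$ and $f(\xi)>0$ in a right-neighborhood of $\xi_0$. A good profile $f$ is a \emph{good profile with interface} at $\eta\in(0,\infty)$ if $f(\eta)=0$, $(f^m)'(\eta)=0$ and $f(\xi)>0$ in a left-neighborhood of $\eta$. Convention: a profile with interface is positive on the whole open interval between its starting point ($0$ in cases (P1), (P2); $\xi_0$ in case (P3)) and the interface point $\eta$. *)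

(* Defs.v *)
From Stdlib Require Import Reals.
From Coquelicot Require Import Coquelicot.

Open Scope R_scope.

(* Real power of a nonnegative base, with [0 ^ p = 0] (used only for [p > 0]);
   the library's [Rpower 0 p] equals 1. *)
Definition rpow (x p : R) : R := if Rlt_dec 0 x then Rpower x p else 0.

(* One-sided derivative: profiles live on [0, +oo), so derivatives at the
   origin must not see the values of [f] at negative arguments. *)
Definition is_right_derive (g : R -> R) (x l : R) : Prop :=
  filterlim (fun y => (g y - g x) / (y - x)) (at_right x) (locally l).

Definition fpow (m : R) (f : R -> R) : R -> R := fun xi => rpow (f xi) m.

(* Nonnegative solutions on [0, +oo). The equation is singular at 0, so it is
   imposed for [xi > 0], with continuity up to the origin; the values of [f] at
   negative arguments are irrelevant. *)
Definition nonneg_solution (N : nat) (m sigma : R) (f : R -> R) : Prop :=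
  (forall xi, 0 <= xi -> 0 <= f xi) /\
  filterlim f (at_right 0) (locally (f 0)) /\
  forall xi, 0 < xi ->
    ex_derive (fpow m f) xi /\
    ex_derive (Derive (fpow m f)) xi /\
    Derive (Derive (fpow m f)) xi
      + (INR N - 1) / xi * Derive (fpow m f) xi
      - 1 / (m - 1) * f xi
      + rpow xi sigma * fpow m f xi = 0.

Definition P1 (f : R -> R) : Prop :=
  0 < f 0 /\ is_right_derive f 0 0.

Definition P2 (m : R) (f : R -> R) : Prop :=
  f 0 = 0 /\ is_right_derive (fpow m f) 0 0.

Definition P3 (m : R) (f : R -> R) (xi0 : R) : Prop :=
  0 < xi0 /\ f xi0 = 0 /\ is_derive (fpow m f) xi0 0 /\
  at_right xi0 (fun xi => 0 < f xi).

Definition starts_at (m : R) (f : R -> R) (xi0 : R) : Prop :=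
  (xi0 = 0 /\ (P1 f \/ P2 m f)) \/ P3 m f xi0.

Definition good_profile (N : nat) (m sigma : R) (f : R -> R) : Prop :=
  nonneg_solution N m sigma f /\ exists xi0, starts_at m f xi0.

Definition interface_at (m : R) (f : R -> R) (eta : R) : Prop :=
  0 < eta /\ f eta = 0 /\ is_derive (fpow m f) eta 0 /\
  at_left eta (fun xi => 0 < f xi).

(* The last conjunct is the convention that a profile with interface is
   positive all the way from its starting point to the interface. *)
Definition good_profile_with_interface
    (N : nat) (m sigma : R) (f : R -> R) (eta : R) : Prop :=
  good_profile N m sigma f /\
  interface_at m f eta /\
  exists xi0, starts_at m f xi0 /\ xi0 < eta /\
    forall xi, xi0 < xi < eta -> 0 < f xi.

Definition sigma_c (N : nat) (m : R) : R :=
  2 * (INR N - 1) * (m - 1) / (3 * m + 1).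

(* Main.v *)
Require Import Defs.
From Stdlib Require Import ZArith Reals Lra Lia Classical ClassicalEpsilon.
From Coquelicot Require Import Coquelicot.
From mathcomp Require filter.
From Corelib Require Import ssreflect.

Open Scope R_scope.

(* With [g = f^m], [q = 1/m], [d = N - 1], [c = 1/(m-1)] and radius [r] the equation reads
   [g'' + d/r g' = c g^q - r^sigma g].  Multiplying it by [r^alpha g' + beta r^(alpha-1) g]
   with [alpha = 2d(q+1)/(q+3)], [beta = alpha/(q+1)] gives a Pohozaev functional [F] with
   [F' = - r^(alpha-1) g^2 ((sigma_c - sigma)/2 r^sigma - kappa (alpha-2)/r^2)], [kappa > 0],
   [alpha > 2].

   If [sigma >= sigma_c] then [F] is strictly increasing, while it tends to 0 at both ends
   of the positivity interval of a profile with interface: there is none.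

   If [sigma < sigma_c] then [F] decreases at large radii.  At a zero of [g] one has
   [F = r^alpha g'^2/2 >= 0], while [F < 0] at a small local minimum, so solutions lifting
   off from a small value far out stay positive; large solutions starting from the origin
   follow the linear equation and cross 0.  By the intermediate value theorem for the
   minimum of the solution on a long interval, some solution in between touches 0, and
   letting the lift-off value tend to 0 yields a nonnegative good profile with a zero.
   At its first zero either [g' = 0], i.e. this is an interface, or the end of the
   interval has been reached; in the second case [F > 0] all along, and solutions with
   positive [F] at large radii vanish within a bounded length.

   The nonlinearity is not Lipschitz at 0, so solutions are produced as limits of Euler
   schemes, which depend continuously on the parameters, along an ultrafilter; no
   uniqueness is needed. *)

(** * Limits along a free ultrafilter, real powers *)

(** Without uniqueness the minimum of the solution is not a function of the shooting parameter. The
    intermediate value theorem is therefore applied to the minimum over the grid points of an Euler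
    scheme, continuous in the parameter at each fixed step, and only then does the step tend to 0.
    An ultrafilter gives limits at all points of the interval at once, with no extraction of
    subsequences.

    Non-uniqueness also threatens the limit of vanishing lift-off value: the zero function solves
    the limit problem. A power-law lower barrier, uniform in the lift-off radius and value, keeps
    the limit positive next to its start and its zero away from there.

    Initial values growing to infinity are replaced by the value 1 with the coefficient of [g^q]
    decreasing to 0, since [g -> A g] multiplies that coefficient by [A^(1-q)]. The parameters then
    fill a compact interval that ends at a linear equation, whose solution oscillates.

    The assumption [N >= 4] enters as [alpha > 2]: it fixes the sign of the [1/r^2] term in [F'] and
    makes [F] vanish at the origin. *)

Lemma free_ultrafilter :
  exists U : (nat -> Prop) -> Prop, ProperFilter U /\
    (forall P, U P \/ U (fun n => ~ P n)) /\
    (forall P, eventually P -> U P).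
Proof.
  destruct (@filter.ultraFilterLemma nat eventually) as [G [[HG Hm] Hsub]].
  { split; [|split].
    - intros [n Hn]; exact (Hn n (le_n n)).
    - exact filter_true.
    - exact (@filter_and _ eventually _).
    - intros P Q HPQ HP; exact (filter_imp P Q HPQ HP). }
  exists G.
  assert (HF : Filter G).
  { constructor.
    - exact (@filter.filterT _ _ (@filter.filter_filter _ _ HG)).
    - exact (@filter.filterI _ _ (@filter.filter_filter _ _ HG)).
    - exact (@filter.filterS _ _ (@filter.filter_filter _ _ HG)). }
  split; [|split].
  - constructor; [|exact HF].
    intros P HP; apply NNPP; intros Hne.
    apply (@filter.filter_not_empty _ _ HG).
    apply (filter_imp P); [|exact HP].
    intros x Hx; exact (Hne (ex_intro _ x Hx)).
  - intros P.
    exact (@filter.in_ultra_setVsetC nat G P (filter.Build_UltraFilter HG Hm)).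
  - exact Hsub.
Qed.

Section Ultralimit.

Context {U : (nat -> Prop) -> Prop} {HU : ProperFilter U}.
Hypothesis Hultra : forall P, U P \/ U (fun n => ~ P n).

(** Total in [x], so that limit functions can be written down pointwise with no choice; the value is
    meaningful only if [x] is bounded for [U]-almost every index. *)
Definition ulim (x : nat -> R) : R := real (Lub_Rbar (fun y => U (fun n => y <= x n))).

Lemma ulim_correct (x : nat -> R) (B : R) :
  U (fun n => Rabs (x n) <= B) -> filterlim x U (locally (ulim x)).
Proof.
  intros HB.
  set (E := fun y => U (fun n => y <= x n)).
  assert (HbB : forall y, E y -> y <= B).
  { intros y Hy.
    destruct (filter_ex _ (filter_and _ _ Hy HB)) as [n [H1 H2]].
    apply Rabs_le_between in H2; lra. }
  assert (HmB : E (- B)).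
  { apply: filter_imp HB => n Hn; apply Rabs_le_between in Hn; lra. }
  assert (Hl := Lub_Rbar_correct E); fold E in Hl.
  unfold ulim; fold E.
  destruct (Lub_Rbar E) as [l| |]; simpl.
  - apply filterlim_locally => eps.
    assert (H1 : U (fun n => l - eps < x n)).
    { destruct (classic (exists y, E y /\ l - eps < y)) as [[y [Hy Hly]]|Hn].
      - apply: filter_imp Hy => n Hn; lra.
      - exfalso. assert (H := proj2 Hl (Finite (l - eps))).
        simpl in H. assert (l <= l - eps).
        { apply H. intros y Hy; simpl. apply Rnot_lt_le => Hlt. apply Hn; exists y; auto. }
        destruct eps as [e He]; simpl in *; lra. }
    (* The ultrafilter alternative enters here: if [x n < l + eps] fails on a set of [U], then
       [l + eps] belongs to [E], above its supremum. *)
    assert (H2 : U (fun n => x n < l + eps)).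
    { destruct (Hultra (fun n => x n < l + eps)) as [H|H]; [exact H|exfalso].
      assert (HE : E (l + eps)) by (apply: filter_imp H => n Hn; lra).
      assert (H3 := proj1 Hl _ HE); simpl in H3.
      destruct eps as [e He]; simpl in *; lra. }
    apply: filter_imp (filter_and _ _ H1 H2) => n [Hn1 Hn2].
    change (Rabs (x n - l) < eps). apply Rabs_lt_between; lra.
  - exfalso. assert (H := proj2 Hl (Finite B)). apply H.
    intros y Hy; exact (HbB y Hy).
  - exfalso. exact (proj1 Hl _ HmB).
Qed.

End Ultralimit.

Lemma lim_eps {T} (U : (T -> Prop) -> Prop) {HU : Filter U} (x : T -> R) (l : R) :
  filterlim x U (locally l) <-> forall eps, 0 < eps -> U (fun n => Rabs (x n - l) < eps).
Proof.
  split.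
  - intros H eps He.
    exact (proj1 (filterlim_locally x l) H (mkposreal _ He)).
  - intros H. apply filterlim_locally => eps. exact (H eps (cond_pos eps)).
Qed.

Lemma lim_ge {T} (F : (T -> Prop) -> Prop) {HF : ProperFilter F} (x : T -> R) (l a : R) :
  filterlim x F (locally l) -> F (fun n => a <= x n) -> a <= l.
Proof.
  intros Hx Ha; apply Rnot_lt_le => Hlt.
  assert (Hp : 0 < a - l) by lra.
  destruct (filter_ex _ (filter_and _ _ Ha (proj1 (lim_eps F x l) Hx _ Hp))) as [n [H1 H2]].
  apply Rabs_lt_between in H2; lra.
Qed.

Lemma lim_le {T} (F : (T -> Prop) -> Prop) {HF : ProperFilter F} (x : T -> R) (l b : R) :
  filterlim x F (locally l) -> F (fun n => x n <= b) -> l <= b.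
Proof.
  intros Hx Hb; apply Rnot_lt_le => Hlt.
  assert (Hp : 0 < l - b) by lra.
  destruct (filter_ex _ (filter_and _ _ Hb (proj1 (lim_eps F x l) Hx _ Hp))) as [n [H1 H2]].
  apply Rabs_lt_between in H2; lra.
Qed.

Lemma rpow_pos x p : 0 < x -> rpow x p = Rpower x p.
Proof. intros H; unfold rpow; destruct (Rlt_dec 0 x); [easy|contradiction]. Qed.

Lemma rpow_npos x p : x <= 0 -> rpow x p = 0.
Proof. intros H; unfold rpow; destruct (Rlt_dec 0 x); [lra|easy]. Qed.

Lemma Rpower_gt0 x p : 0 < Rpower x p.
Proof. apply exp_pos. Qed.

Lemma rpow_ge0 x p : 0 <= rpow x p.
Proof. unfold rpow; destruct (Rlt_dec 0 x); [apply Rlt_le, exp_pos|lra]. Qed.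

Lemma rpow_le x y p : 0 < p -> x <= y -> rpow x p <= rpow y p.
Proof.
  intros Hp Hxy. destruct (Rlt_dec 0 x) as [H|H].
  - rewrite !rpow_pos; try lra. apply Rle_Rpower_l; lra.
  - rewrite (rpow_npos x); [apply rpow_ge0|lra].
Qed.

Lemma Rpower_lt_of_lt_root x p eps :
  0 < p -> 0 < eps -> 0 < x < Rpower eps (/ p) -> Rpower x p < eps.
Proof.
  intros Hp He [Hx Hlt].
  replace eps with (Rpower (Rpower eps (/ p)) p).
  - apply Rlt_Rpower_l; lra.
  - rewrite Rpower_mult Rinv_l; [apply Rpower_1; lra|lra].
Qed.

Lemma is_derive_Rpower_base (p x : R) :
  0 < x -> is_derive (fun y => Rpower y p) x (p * Rpower x p / x).
Proof.
  intros Hx. unfold Rpower. auto_derive; [exact Hx|]. field; lra.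
Qed.

Lemma continuous_rpow (p x : R) : 0 < p -> continuous (fun y => rpow y p) x.
Proof.
  intros Hp. destruct (Rtotal_order x 0) as [Hx|[->|Hx]].
  - apply (continuous_ext_loc _ (fun _ => 0)); [|apply continuous_const].
    exists (mkposreal (- x) ltac:(lra)); intros y Hy.
    change (Rabs (y - x) < - x) in Hy. apply Rabs_lt_between in Hy.
    rewrite rpow_npos; lra.
  - apply lim_eps; [typeclasses eauto|intros eps He].
    exists (mkposreal _ (Rpower_gt0 eps (/ p))); intros y Hy.
    change (Rabs (y - 0) < Rpower eps (/ p)) in Hy. apply Rabs_lt_between in Hy.
    rewrite (rpow_npos 0); [|lra]. rewrite Rminus_0_r Rabs_pos_eq; [|apply rpow_ge0].
    destruct (Rlt_dec 0 y) as [H|H].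
    + rewrite rpow_pos //. apply Rpower_lt_of_lt_root; lra.
    + rewrite rpow_npos; lra.
  - apply (continuous_ext_loc _ (fun y => Rpower y p)).
    + exists (mkposreal x Hx); intros y Hy.
      change (Rabs (y - x) < x) in Hy. apply Rabs_lt_between in Hy.
      rewrite rpow_pos; lra.
    + apply (ex_derive_continuous (fun y => Rpower y p)).
      eexists; apply is_derive_Rpower_base; exact Hx.
Qed.

(** * Compactness of approximate solutions *)

Section LimitArithmetic.

Context {T : Type} {F : (T -> Prop) -> Prop} {HF : Filter F}.
Implicit Types (x y : T -> R) (a b : R).

Lemma lim_plus x y a b : filterlim x F (locally a) -> filterlim y F (locally b) ->
  filterlim (fun n => x n + y n) F (locally (a + b)).
Proof.
  intros Hx Hy. exact (filterlim_comp_2 (G := locally a) (H := locally b) _ _ Rplus Hx Hy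
    (@filterlim_plus R_AbsRing R_NormedModule a b)).
Qed.

Lemma lim_mult x y a b : filterlim x F (locally a) -> filterlim y F (locally b) ->
  filterlim (fun n => x n * y n) F (locally (a * b)).
Proof.
  intros Hx Hy. exact (filterlim_comp_2 (G := locally a) (H := locally b) _ _ Rmult Hx Hy
    (@filterlim_mult R_AbsRing a b)).
Qed.

Lemma lim_comp (f : R -> R) x a : continuous f a -> filterlim x F (locally a) ->
  filterlim (fun n => f (x n)) F (locally (f a)).
Proof. intros Hf Hx; exact (filterlim_comp _ _ _ x f _ _ _ Hx Hf). Qed.

Lemma lim_opp x a : filterlim x F (locally a) -> filterlim (fun n => - x n) F (locally (- a)).
Proof. apply: lim_comp; apply (continuous_opp (fun y : R => y)), continuous_id. Qed.

Lemma lim_minus x y a b : filterlim x F (locally a) -> filterlim y F (locally b) ->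
  filterlim (fun n => x n - y n) F (locally (a - b)).
Proof. intros Hx Hy; apply lim_plus; [exact Hx|apply lim_opp, Hy]. Qed.

Lemma lim_div x y a b : b <> 0 -> filterlim x F (locally a) -> filterlim y F (locally b) ->
  filterlim (fun n => x n / y n) F (locally (a / b)).
Proof.
  intros Hb Hx Hy; apply lim_mult; [exact Hx|].
  apply (lim_comp Rinv); [|exact Hy]. apply continuous_Rinv, Hb.
Qed.

Lemma lim_const a : filterlim (fun _ : T => a) F (locally a).
Proof. apply filterlim_const. Qed.

Lemma lim_squeeze x y a :
  F (fun n => Rabs (x n - a) <= y n) -> filterlim y F (locally 0) ->
  filterlim x F (locally a).
Proof.
  intros Hxy Hy. apply lim_eps; [exact HF|intros eps He].
  generalize (proj1 (lim_eps F y 0) Hy eps He) => Hy'.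
  apply: filter_imp (filter_and _ _ Hxy Hy') => n [H1 H2].
  rewrite Rminus_0_r in H2. apply Rabs_lt_between in H2. lra.
Qed.

End LimitArithmetic.

(** Since [rpow] vanishes at nonpositive arguments, this is continuous in [y] on the whole line, and
    approximate solutions may become negative, which is what the shooting detects. *)
Definition reaction (q sg c r y : R) : R := c * rpow y q - rpow r sg * y.

Definition acceleration (q sg d c r y w : R) : R := reaction q sg c r y - d / r * w.

(* The mean value inequality, up to an error [e], for a primitive [u] of [v]. *)
Definition mean_value_bound (e T : R) (u v : R -> R) : Prop :=
  forall s t m, 0 < s -> s <= t -> t < T ->
    ((forall z, s <= z <= t -> m <= v z) ->
       m * (t - s) - e * (1 + Rabs m) <= u t - u s) /\
    ((forall z, s <= z <= t -> v z <= m) ->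
       u t - u s <= m * (t - s) + e * (1 + Rabs m)).

(** The initial conditions in quantitative form: at [s = 0] they read [g 0 = a] and [p 0 = 0]. The
    bound [B * s] also keeps the friction [d / (r0 + s) * p s] below [d * B], uniformly down to
    [r0 = 0]. *)
Definition growth_bounds (a T B : R) (g p : R -> R) : Prop :=
  forall s, 0 <= s < T ->
    Rabs (g s) <= B /\ Rabs (p s) <= B * s /\ Rabs (g s - a) <= B * s ^ 2.

(* The independent variable is shifted: [g] at [s] is the profile at radius [r0 + s]. *)
Definition approx_solution (q sg d c r0 a T B e : R) (g p : R -> R) : Prop :=
  growth_bounds a T B g p /\ mean_value_bound e T g p /\
  mean_value_bound e T p (fun s => acceleration q sg d c (r0 + s) (g s) (p s)).

Definition exact_solution (q sg d c r0 a T B : R) (g p : R -> R) : Prop :=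
  growth_bounds a T B g p /\
  forall s, 0 < s < T ->
    is_derive g s (p s) /\
    is_derive p s (acceleration q sg d c (r0 + s) (g s) (p s)).

Lemma mean_value_bound_lipschitz e T u v C :
  0 <= e -> 0 <= C -> mean_value_bound e T u v ->
  (forall s, 0 < s < T -> Rabs (v s) <= C) ->
  forall s t, 0 < s < T -> 0 < t < T ->
    Rabs (u t - u s) <= C * Rabs (t - s) + e * (1 + C).
Proof.
  intros He HC Hm Hv.
  assert (Hle : forall s t, 0 < s -> s <= t -> t < T ->
    Rabs (u t - u s) <= C * (t - s) + e * (1 + C)).
  { intros s t H0 Hst Ht.
    assert (Hv' : forall z, s <= z <= t -> - C <= v z <= C).
    { intros z Hz. apply Rabs_le_between, Hv; lra. }
    destruct (Hm s t (- C) H0 Hst Ht) as [H1 _].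
    destruct (Hm s t C H0 Hst Ht) as [_ H2].
    specialize (H1 (fun z Hz => proj1 (Hv' z Hz))).
    specialize (H2 (fun z Hz => proj2 (Hv' z Hz))).
    rewrite Rabs_Ropp in H1. rewrite (Rabs_pos_eq C HC) in H1; rewrite (Rabs_pos_eq C HC) in H2.
    clear Hm Hv Hv'. apply Rabs_le_between; split; lra. }
  intros s t Hs Ht. destruct (Rle_dec s t) as [H|H].
  - rewrite (Rabs_pos_eq (t - s)); [|lra]. apply Hle; lra.
  - rewrite (Rabs_minus_sym t) Rabs_minus_sym (Rabs_pos_eq (s - t)); [|lra].
    apply Hle; lra.
Qed.

Section Compactness.

Context {U : (nat -> Prop) -> Prop} {HU : ProperFilter U}.
Hypothesis Hultra : forall P, U P \/ U (fun n => ~ P n).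

(** Convergence along this filter is continuous convergence of a sequence of functions at [s]. In
    filter form it lets the limit arithmetic above treat the acceleration term by term. *)
Definition near_uniformly (T s : R) (P : nat * R -> Prop) : Prop :=
  exists eta, 0 < eta /\
    U (fun n => forall z, Rabs (z - s) < eta -> 0 < z < T -> P (n, z)).

Global Instance near_uniformly_filter T s : Filter (near_uniformly T s).
Proof.
  constructor.
  - exists 1; split; [lra|]. apply filter_forall; auto.
  - intros P Q [e1 [H1 HP]] [e2 [H2 HQ]]. exists (Rmin e1 e2).
    split; [apply Rmin_glb_lt; auto|].
    apply: filter_imp (filter_and _ _ HP HQ) => n [A B] z Hz Hz'.
    split; [apply A|apply B]; try easy.
    + apply: Rlt_le_trans Hz _; apply Rmin_l.
    + apply: Rlt_le_trans Hz _; apply Rmin_r.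
  - intros P Q HPQ [e1 [H1 HP]]. exists e1; split; [easy|].
    apply: filter_imp HP => n A z Hz Hz'; auto.
Qed.

Lemma near_uniformly_fst (x : nat -> R) (l T s : R) :
  filterlim x U (locally l) ->
  filterlim (fun nz => x (fst nz)) (near_uniformly T s) (locally l).
Proof.
  intros Hx. apply lim_eps; [typeclasses eauto|intros eps He].
  exists 1; split; [lra|].
  generalize (proj1 (lim_eps U x l) Hx eps He).
  apply filter_imp; auto.
Qed.

Lemma near_uniformly_snd (T s : R) : filterlim snd (near_uniformly T s) (locally s).
Proof.
  apply lim_eps; [typeclasses eauto|intros eps He].
  exists eps; split; [lra|]. apply filter_forall; auto.
Qed.

(** The equicontinuity argument of Arzela-Ascoli: a common Lipschitz constant, up to an error
    tending to 0, spreads convergence at the point [s] to its neighbourhood. *)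
Lemma near_uniformly_lipschitz (u : nat -> R -> R) (l C T s : R) (e : nat -> R) :
  0 < s < T -> 0 <= C -> filterlim e U (locally 0) ->
  U (fun n => forall s t, 0 < s < T -> 0 < t < T ->
       Rabs (u n t - u n s) <= C * Rabs (t - s) + e n * (1 + C)) ->
  filterlim (fun n => u n s) U (locally l) ->
  filterlim (fun nz => u (fst nz) (snd nz)) (near_uniformly T s) (locally l).
Proof.
  intros Hs HC He Hlip Hu.
  apply (lim_squeeze _ (fun nz => C * Rabs (snd nz - s) + e (fst nz) * (1 + C)
     + Rabs (u (fst nz) s - l))).
  - exists 1; split; [lra|].
    apply: filter_imp Hlip => n Hn z _ Hz. simpl.
    specialize (Hn s z Hs Hz).
    replace (u n z - l) with ((u n z - u n s) + (u n s - l)) by ring.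
    apply: Rle_trans (Rabs_triang _ _) _. lra.
  - replace 0 with (C * Rabs (s - s) + 0 * (1 + C) + Rabs (l - l)).
    2:{ rewrite !Rminus_diag Rabs_R0; ring. }
    apply lim_plus; [apply lim_plus|].
    + apply lim_mult; [apply lim_const|].
      apply (lim_comp Rabs); [apply continuous_Rabs|].
      apply lim_minus; [apply near_uniformly_snd|apply lim_const].
    + apply lim_mult; [apply (near_uniformly_fst e), He|apply lim_const].
    + apply (lim_comp Rabs); [apply continuous_Rabs|].
      apply lim_minus; [apply (near_uniformly_fst (fun n => u n s)), Hu|apply lim_const].
Qed.

(** Near [s] the functions [v n] lie within [eps / 2] of [l], so the mean value inequality frames
    the increments of [u n]; the frame passes to the limit and bounds the difference quotients of
    [u']. *)
Lemma is_derive_limit (u v : nat -> R -> R) (u' : R -> R) (e : nat -> R) (T s l : R) :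
  0 < s < T -> filterlim e U (locally 0) ->
  U (fun n => mean_value_bound (e n) T (u n) (v n)) ->
  (forall t, 0 < t < T -> filterlim (fun n => u n t) U (locally (u' t))) ->
  filterlim (fun nz => v (fst nz) (snd nz)) (near_uniformly T s) (locally l) ->
  is_derive u' s l.
Proof.
  intros Hs He Hm Hu Hv. apply is_derive_Reals. intros eps Heps.
  assert (He2 : 0 < eps / 2) by lra.
  destruct (proj1 (lim_eps _ _ _) Hv _ He2) as [eta [Heta HU1]].
  assert (Hd : 0 < Rmin eta (Rmin s (T - s))).
  { repeat apply Rmin_glb_lt; lra. }
  exists (mkposreal _ Hd). intros h Hh0 Hh. simpl in Hh.
  assert (Hh1 : Rabs h < eta) by (apply: Rlt_le_trans Hh _; apply Rmin_l).
  assert (Hh2 : Rabs h < s).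
  { apply: Rlt_le_trans Hh _. apply: Rle_trans (Rmin_r _ _) _; apply Rmin_l. }
  assert (Hh3 : Rabs h < T - s).
  { apply: Rlt_le_trans Hh _. apply: Rle_trans (Rmin_r _ _) _; apply Rmin_r. }
  apply Rabs_lt_between in Hh2. apply Rabs_lt_between in Hh3.
  set (m1 := l - eps / 2). set (m2 := l + eps / 2).
  (* An ordered pair with [s] at either end serves both signs of [h]. *)
  assert (Hbnd : forall s1 s2, s1 <= s2 -> (s1 = s \/ s2 = s) -> Rabs (s2 - s1) < eta ->
     0 < s1 -> s2 < T ->
     m1 * (s2 - s1) <= u' s2 - u' s1 <= m2 * (s2 - s1)).
  { intros s1 s2 H12 Hor Hd12 Hp HT.
    rewrite Rabs_pos_eq in Hd12; [|lra].
    assert (HL : filterlim (fun n => u n s2 - u n s1 + e n * (1 + Rabs m1)) U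
       (locally (u' s2 - u' s1 + 0 * (1 + Rabs m1)))).
    { apply lim_plus; [apply lim_minus; apply Hu; lra|].
      apply lim_mult; [exact He|apply lim_const]. }
    assert (HL2 : filterlim (fun n => u n s2 - u n s1 - e n * (1 + Rabs m2)) U
       (locally (u' s2 - u' s1 - 0 * (1 + Rabs m2)))).
    { apply lim_minus; [apply lim_minus; apply Hu; lra|].
      apply lim_mult; [exact He|apply lim_const]. }
    assert (HB : U (fun n =>
      m1 * (s2 - s1) <= u n s2 - u n s1 + e n * (1 + Rabs m1) /\
      u n s2 - u n s1 - e n * (1 + Rabs m2) <= m2 * (s2 - s1))).
    { apply: filter_imp (filter_and _ _ Hm HU1) => n [Hn1 Hn2].
      assert (Hz : forall z, s1 <= z <= s2 -> m1 <= v n z <= m2).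
      { intros z Hz. assert (Hn := Hn2 z). simpl in Hn.
        assert (Rabs (v n z - l) < eps / 2).
        { apply Hn; [apply Rabs_lt_between|]; destruct Hor; lra. }
        apply Rabs_lt_between in H; unfold m1, m2; lra. }
      destruct (Hn1 s1 s2 m1 Hp H12 HT) as [A1 _].
      destruct (Hn1 s1 s2 m2 Hp H12 HT) as [_ A2].
      specialize (A1 (fun z Hz' => proj1 (Hz z Hz'))).
      specialize (A2 (fun z Hz' => proj2 (Hz z Hz'))). lra. }
    split.
    - assert (Hge : m1 * (s2 - s1) <= u' s2 - u' s1 + 0 * (1 + Rabs m1)); [|lra].
      apply (lim_ge U _ _ _ HL). apply: filter_imp HB => n [H _]; exact H.
    - assert (Hge : u' s2 - u' s1 - 0 * (1 + Rabs m2) <= m2 * (s2 - s1)); [|lra].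
      apply (lim_le U _ _ _ HL2). apply: filter_imp HB => n [_ H]; exact H. }
  assert (Hq : m1 <= (u' (s + h) - u' s) / h <= m2).
  { destruct (Rle_dec 0 h) as [Hp|Hp].
    - destruct (Hbnd s (s + h)) as [A1 A2]; try lra.
      { replace (s + h - s) with h by ring; lra. }
      replace (s + h - s) with h in A1, A2 by ring.
      assert (0 < h) by lra. split.
      + apply Rle_div_r; lra.
      + apply Rle_div_l; lra.
    - destruct (Hbnd (s + h) s) as [A1 A2]; try lra.
      { replace (s - (s + h)) with (- h) by ring; rewrite Rabs_Ropp; lra. }
      replace (s - (s + h)) with (- h) in A1, A2 by ring.
      assert (0 < - h) by lra.
      replace ((u' (s + h) - u' s) / h) with ((u' s - u' (s + h)) / (- h)) by (field; lra).
      split.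
      + apply Rle_div_r; lra.
      + apply Rle_div_l; lra. }
  unfold m1, m2 in Hq. apply Rabs_lt_between; lra.
Qed.


(** The last clause lets the evaluation point move with [n]: this is how zeros found on the grid, or
    zeros of the [n]-th solution, become a zero of the limit. *)
Lemma approx_solution_limit (q sg d T B : R) (c r0 a e : nat -> R) (c' r0' a' : R)
    (g p : nat -> R -> R) :
  0 < q -> 0 < sg -> 0 <= d -> 0 < T -> 0 <= B -> 0 <= r0' ->
  filterlim c U (locally c') -> filterlim r0 U (locally r0') ->
  filterlim a U (locally a') -> filterlim e U (locally 0) ->
  U (fun n => 0 <= r0 n /\ 0 <= e n /\
       approx_solution q sg d (c n) (r0 n) (a n) T B (e n) (g n) (p n)) ->
  exists g' p', exact_solution q sg d c' r0' a' T B g' p' /\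
    forall (s : nat -> R) (s' : R), 0 <= s' < T -> U (fun n => 0 <= s n < T) ->
      filterlim s U (locally s') ->
      filterlim (fun n => g n (s n)) U (locally (g' s')).
Proof.
  intros Hq Hsg Hd HT HB Hr0' Hc Hr0 Ha He Happ.
  set (g' := fun s => @ulim U (fun n => g n s)).
  set (p' := fun s => @ulim U (fun n => p n s)).
  assert (Hgl : forall s, 0 <= s < T -> filterlim (fun n => g n s) U (locally (g' s))).
  { intros s Hs. apply (ulim_correct Hultra _ B).
    apply: filter_imp Happ => n [_ [_ [Hb _]]]. apply Hb, Hs. }
  assert (Hpl : forall s, 0 <= s < T -> filterlim (fun n => p n s) U (locally (p' s))).
  { intros s Hs. apply (ulim_correct Hultra _ (B * s)).
    apply: filter_imp Happ => n [_ [_ [Hb _]]]. apply Hb, Hs. }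
  set (c1 := Rabs c' + 1). set (r1 := r0' + 1 + T).
  (* A bound for the acceleration; the last term comes from [d / (r0 + s) * (B * s) <= d * B]. *)
  set (C2 := c1 * rpow B q + rpow r1 sg * B + d * B).
  assert (Hc1 : U (fun n => Rabs (c n) <= c1)).
  { generalize (proj1 (lim_eps U c c') Hc 1 Rlt_0_1); apply filter_imp => n Hn.
    replace (c n) with (c' + (c n - c')) by ring.
    apply: Rle_trans (Rabs_triang _ _) _. unfold c1; lra. }
  assert (Hr1 : U (fun n => r0 n <= r0' + 1)).
  { generalize (proj1 (lim_eps U r0 r0') Hr0 1 Rlt_0_1); apply filter_imp => n Hn.
    apply Rabs_lt_between in Hn; lra. }
  assert (Hc1p : 0 <= c1) by (unfold c1; generalize (Rabs_pos c'); lra).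
  assert (HC2 : 0 <= C2).
  { unfold C2. generalize (rpow_ge0 B q) (rpow_ge0 r1 sg) => H1 H2.
    assert (0 <= c1 * rpow B q) by nra. assert (0 <= rpow r1 sg * B) by nra. nra. }
  assert (Hplip : U (fun n => forall s t, 0 < s < T -> 0 < t < T ->
     Rabs (p n t - p n s) <= C2 * Rabs (t - s) + e n * (1 + C2))).
  { apply: filter_imp (filter_and _ _ Happ (filter_and _ _ Hc1 Hr1))
      => n [[Hr [Hen [Hb [_ Hm]]]] [Hcn Hrn]].
    apply (mean_value_bound_lipschitz _ _ _ _ _ Hen HC2 Hm).
    intros s Hs. destruct (Hb s) as [Hb1 [Hb2 _]]; [lra|].
    unfold acceleration, reaction, C2.
    assert (A1 : Rabs (c n * rpow (g n s) q) <= c1 * rpow B q).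
    { rewrite Rabs_mult (Rabs_pos_eq (rpow _ _)); [|apply rpow_ge0].
      apply Rmult_le_compat; try easy; [apply Rabs_pos|apply rpow_ge0|].
      apply rpow_le; [easy|]. apply Rabs_le_between in Hb1; lra. }
    assert (A2 : Rabs (rpow (r0 n + s) sg * g n s) <= rpow r1 sg * B).
    { rewrite Rabs_mult (Rabs_pos_eq (rpow _ _)); [|apply rpow_ge0].
      apply Rmult_le_compat; try easy; [apply rpow_ge0|apply Rabs_pos|].
      apply rpow_le; [easy|]. unfold r1; lra. }
    assert (A3 : Rabs (d / (r0 n + s) * p n s) <= d * B).
    { rewrite Rabs_mult (Rabs_pos_eq (d / _)); [|apply Rdiv_le_0_compat; lra].
      apply (Rle_trans _ (d / (r0 n + s) * (B * (r0 n + s)))).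
      - apply Rmult_le_compat_l; [apply Rdiv_le_0_compat; lra|]. nra.
      - right; field; lra. }
    apply Rabs_le_between in A1. apply Rabs_le_between in A2. apply Rabs_le_between in A3.
    apply Rabs_le_between; lra. }
  assert (HBT : 0 <= B * T) by nra.
  assert (Hglip : U (fun n => forall s t, 0 < s < T -> 0 < t < T ->
     Rabs (g n t - g n s) <= (B * T) * Rabs (t - s) + e n * (1 + B * T))).
  { apply: filter_imp Happ => n [Hr [Hen [Hb [Hm _]]]].
    apply (mean_value_bound_lipschitz _ _ _ _ _ Hen HBT Hm).
    intros s Hs. destruct (Hb s) as [_ [Hb2 _]]; [lra|]. nra. }
  assert (Hgu : forall s, 0 < s < T ->
    filterlim (fun nz => g (fst nz) (snd nz)) (near_uniformly T s) (locally (g' s))).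
  { intros s Hs. apply (near_uniformly_lipschitz g _ (B * T) T s e); try easy.
    apply Hgl; lra. }
  assert (Hpu : forall s, 0 < s < T ->
    filterlim (fun nz => p (fst nz) (snd nz)) (near_uniformly T s) (locally (p' s))).
  { intros s Hs. apply (near_uniformly_lipschitz p _ C2 T s e); try easy.
    apply Hpl; lra. }
  assert (Hbounds : growth_bounds a' T B g' p').
  { intros s Hs. split; [|split].
    - apply (lim_le U (fun n => Rabs (g n s))).
      + apply (lim_comp Rabs); [apply continuous_Rabs|apply Hgl, Hs].
      + apply: filter_imp Happ => n [_ [_ [Hb _]]]. apply Hb, Hs.
    - apply (lim_le U (fun n => Rabs (p n s))).
      + apply (lim_comp Rabs); [apply continuous_Rabs|apply Hpl, Hs].
      + apply: filter_imp Happ => n [_ [_ [Hb _]]]. apply Hb, Hs.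
    - apply (lim_le U (fun n => Rabs (g n s - a n))).
      + apply (lim_comp Rabs); [apply continuous_Rabs|].
        apply lim_minus; [apply Hgl, Hs|exact Ha].
      + apply: filter_imp Happ => n [_ [_ [Hb _]]]. apply Hb, Hs. }
  exists g', p'. split; [split; [exact Hbounds|]|].
  - intros s Hs. split.
    + apply (is_derive_limit g p g' e T); try easy.
      * apply: filter_imp Happ => n [_ [_ [_ [Hm _]]]]. exact Hm.
      * intros t Ht; apply Hgl; lra.
      * apply Hpu, Hs.
    + apply (is_derive_limit p
        (fun n s => acceleration q sg d (c n) (r0 n + s) (g n s) (p n s)) p' e T); try easy.
      * apply: filter_imp Happ => n [_ [_ [_ [_ Hm]]]]. exact Hm.
      * intros t Ht; apply Hpl; lra.
      * unfold acceleration, reaction.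
        assert (Hrl : filterlim (fun nz : nat * R => r0 (fst nz) + snd nz)
          (near_uniformly T s) (locally (r0' + s))).
        { apply lim_plus; [apply (near_uniformly_fst r0), Hr0|apply near_uniformly_snd]. }
        apply lim_minus; [apply lim_minus; apply lim_mult|apply lim_mult].
        -- apply (near_uniformly_fst c), Hc.
        -- apply (lim_comp (fun y => rpow y q)); [apply continuous_rpow, Hq|apply Hgu, Hs].
        -- apply (lim_comp (fun y => rpow y sg)); [apply continuous_rpow, Hsg|exact Hrl].
        -- apply Hgu, Hs.
        -- apply lim_div; [lra|apply lim_const|exact Hrl].
        -- apply Hpu, Hs.
  (* [near_uniformly] controls positive points only; at the start the quadratic bound on [g - a]
     takes over. *)
  - intros s s' Hs' Hsn Hs. destruct (Req_dec s' 0) as [->|Hs0].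
    + assert (Hg0 : g' 0 = a').
      { destruct (Hbounds 0) as [_ [_ H0]]; [lra|].
        replace (B * 0 ^ 2) with 0 in H0 by ring.
        apply Rabs_le_between in H0; lra. }
      rewrite Hg0.
      apply (lim_squeeze _ (fun n => B * (s n * s n) + Rabs (a n - a'))).
      * apply: filter_imp (filter_and _ _ Happ Hsn) => n [[_ [_ [Hb _]]] Hn].
        destruct (Hb (s n) Hn) as [_ [_ H0]].
        replace (g n (s n) - a') with ((g n (s n) - a n) + (a n - a')) by ring.
        apply: Rle_trans (Rabs_triang _ _) _. simpl in H0. lra.
      * replace 0 with (B * (0 * 0) + Rabs (a' - a')).
        2:{ rewrite Rminus_diag Rabs_R0; ring. }
        apply lim_plus.
        -- apply lim_mult; [apply lim_const|apply lim_mult; exact Hs].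
        -- apply (lim_comp Rabs); [apply continuous_Rabs|].
           apply lim_minus; [exact Ha|apply lim_const].
    + assert (Hs1 : 0 < s' < T) by lra.
      apply lim_eps; [typeclasses eauto|intros eps Heps].
      destruct (proj1 (lim_eps _ _ _) (Hgu s' Hs1) eps Heps) as [eta [Heta HUe]].
      assert (Hd' : 0 < Rmin eta s') by (apply Rmin_glb_lt; lra).
      apply: filter_imp (filter_and _ _ Hsn (filter_and _ _ HUe
        (proj1 (lim_eps _ _ _) Hs _ Hd'))) => n [H1 [H2 H3]].
      apply H2.
      * apply: Rlt_le_trans H3 _; apply Rmin_l.
      * assert (Rabs (s n - s') < s') by (apply: Rlt_le_trans H3 _; apply Rmin_r).
        apply Rabs_lt_between in H; lra.
Qed.

End Compactness.

Lemma mean_value_bound_of_derive T u v :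
  (forall s, 0 < s < T -> is_derive u s (v s)) -> mean_value_bound 0 T u v.
Proof.
  intros Hd s t m Hs Hst Ht.
  destruct (MVT_gen u s t v) as [x [Hx Heq]].
  - intros x Hx. rewrite Rmin_left // Rmax_right // in Hx. apply Hd; lra.
  - intros x Hx. rewrite Rmin_left // Rmax_right // in Hx.
    apply continuity_pt_filterlim. apply (ex_derive_continuous u).
    eexists; apply Hd; lra.
  - rewrite Rmin_left // Rmax_right // in Hx. rewrite Heq.
    split; intros H; specialize (H x Hx); nra.
Qed.

(** With error 0, so that the same compactness lemma serves again when the lift-off value tends to
    0. *)
Lemma exact_solution_approx q sg d c r0 a T B g p :
  exact_solution q sg d c r0 a T B g p -> approx_solution q sg d c r0 a T B 0 g p.
Proof.
  intros [Hb Hd]. split; [exact Hb|split].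
  - apply mean_value_bound_of_derive; intros s Hs; apply Hd, Hs.
  - apply mean_value_bound_of_derive; intros s Hs; apply Hd, Hs.
Qed.

(** * The Euler scheme *)

Definition grid_index (h s : R) : nat := Z.to_nat (Int_part (s / h)).

Lemma grid_index_spec h s : 0 < h -> 0 <= s ->
  INR (grid_index h s) * h <= s < (INR (grid_index h s) + 1) * h.
Proof.
  intros Hh Hs. destruct (base_Int_part (s / h)) as [H1 H2].
  assert (H0 : 0 <= s / h) by (apply Rdiv_le_0_compat; lra).
  assert (Hz : (0 <= Int_part (s / h))%Z).
  { assert (-1 < Int_part (s / h))%Z; [|lia]. apply lt_IZR; lra. }
  unfold grid_index. rewrite INR_IZR_INZ Z2Nat.id //.
  split.
  - apply Rle_div_r; lra.
  - apply Rlt_div_l; lra.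
Qed.

Lemma grid_index_unique h s j : 0 < h -> 0 <= s ->
  INR j * h <= s < (INR j + 1) * h -> grid_index h s = j.
Proof.
  intros Hh Hs Hj. generalize (grid_index_spec h s Hh Hs).
  set (i := grid_index h s). intros Hi.
  assert (H1 : INR i < INR (S j)) by (rewrite S_INR; nra).
  assert (H2 : INR j < INR (S i)) by (rewrite S_INR; nra).
  apply INR_lt in H1. apply INR_lt in H2. lia.
Qed.

(** Telescoping: [h] times the number of grid steps between [s] and [t] differs from [t - s] by at
    most [h], which costs the error [h * (1 + Rabs m)]. *)
Lemma mean_value_bound_step (h T : R) (x y : nat -> R) (v : R -> R) :
  0 < h -> (forall i, x (S i) - x i = h * y i) ->
  (forall s t i, 0 < s -> s <= t -> (grid_index h s <= i < grid_index h t)%nat ->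
     exists z, s <= z <= t /\ v z = y i) ->
  mean_value_bound h T (fun s => x (grid_index h s)) v.
Proof.
  intros Hh Hx Hv s t m Hs Hst _.
  destruct (grid_index_spec h s) as [Hs1 Hs2]; try lra.
  destruct (grid_index_spec h t) as [Ht1 Ht2]; try lra.
  set (i := grid_index h s) in *. set (j := grid_index h t) in *.
  assert (Hij : (i <= j)%nat).
  { assert (INR i < INR (S j)) by (rewrite S_INR; nra). apply INR_lt in H; lia. }
  assert (Hn : Rabs (h * INR (j - i) - (t - s)) <= h).
  { rewrite minus_INR //. apply Rabs_le_between; split; nra. }
  assert (Hmn : Rabs (m * (h * INR (j - i)) - m * (t - s)) <= h * (1 + Rabs m)).
  { rewrite -Rmult_minus_distr_l Rabs_mult. generalize (Rabs_pos m). nra. }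
  apply Rabs_le_between in Hmn.
  split; intros Hm.
  - assert (Hsum : forall k, (i + k <= j)%nat -> m * (h * INR k) <= x (i + k)%nat - x i).
    { induction k as [|k IH]; intros Hk.
      - rewrite Nat.add_0_r /=. lra.
      - destruct (Hv s t (i + k)%nat Hs Hst) as [z [Hz Hvz]]; [fold i j; lia|].
        specialize (Hm z Hz). rewrite Hvz in Hm. specialize (IH ltac:(lia)).
        rewrite Nat.add_succ_r S_INR. specialize (Hx (i + k)%nat). nra. }
    specialize (Hsum (j - i)%nat ltac:(lia)).
    replace (i + (j - i))%nat with j in Hsum by lia. lra.
  - assert (Hsum : forall k, (i + k <= j)%nat -> x (i + k)%nat - x i <= m * (h * INR k)).
    { induction k as [|k IH]; intros Hk.
      - rewrite Nat.add_0_r /=. lra.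
      - destruct (Hv s t (i + k)%nat Hs Hst) as [z [Hz Hvz]]; [fold i j; lia|].
        specialize (Hm z Hz). rewrite Hvz in Hm. specialize (IH ltac:(lia)).
        rewrite Nat.add_succ_r S_INR. specialize (Hx (i + k)%nat). nra. }
    specialize (Hsum (j - i)%nat ltac:(lia)).
    replace (i + (j - i))%nat with j in Hsum by lia. lra.
Qed.

Section EulerScheme.

Variables (q sg d : R).

(* Semi-implicit: the friction term is taken at the new point, so that the
   increments of the velocity are exactly [h * acceleration] there. *)
Fixpoint euler (h c r0 a : R) (j : nat) : R * R :=
  match j with
  | O => (a, 0)
  | S i =>
    let (y, w) := euler h c r0 a i in
    let r := r0 + INR (S i) * h in
    (y + h * w, (w + h * reaction q sg c r (y + h * w)) * (r / (r + h * d)))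
  end.

Lemma euler_fst_S h c r0 a j :
  fst (euler h c r0 a (S j)) = fst (euler h c r0 a j) + h * snd (euler h c r0 a j).
Proof. cbn [euler]. by destruct (euler h c r0 a j). Qed.

Lemma euler_snd_S h c r0 a j :
  snd (euler h c r0 a (S j)) =
    (snd (euler h c r0 a j) +
       h * reaction q sg c (r0 + INR (S j) * h) (fst (euler h c r0 a (S j)))) *
    ((r0 + INR (S j) * h) / (r0 + INR (S j) * h + h * d)).
Proof. rewrite euler_fst_S. cbn [euler]. by destruct (euler h c r0 a j). Qed.

Hypotheses (Hq : 0 < q < 1) (Hsg : 0 < sg) (Hd : 0 <= d).

(** Because [q < 1] the nonlinearity grows at most linearly; this excludes blow-up on any prescribed
    length. *)
Lemma rpow_le_affine y : rpow y q <= 1 + Rabs y.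
Proof.
  destruct (Rle_dec y 1) as [H|H].
  - apply (Rle_trans _ (rpow 1 q)); [apply rpow_le; lra|].
    rewrite rpow_pos; [|lra]. unfold Rpower. rewrite ln_1 Rmult_0_r exp_0.
    generalize (Rabs_pos y); lra.
  - rewrite rpow_pos; [|lra]. rewrite Rabs_pos_eq; [|lra].
    apply (Rle_trans _ (Rpower y 1)); [apply Rle_Rpower; lra|].
    rewrite Rpower_1; lra.
Qed.

Definition growth_rate (c r : R) : R := c + rpow r sg.

Lemma reaction_le c c1 r r1 y : 0 <= c <= c1 -> 0 <= r <= r1 ->
  Rabs (reaction q sg c r y) <= growth_rate c1 r1 * (1 + Rabs y).
Proof.
  intros Hc Hr. unfold reaction, growth_rate.
  assert (A1 : Rabs (c * rpow y q) <= c1 * (1 + Rabs y)).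
  { rewrite Rabs_mult (Rabs_pos_eq c); [|lra]. rewrite (Rabs_pos_eq (rpow _ _)); [|apply rpow_ge0].
    apply Rmult_le_compat; try apply rpow_ge0; try lra. apply rpow_le_affine. }
  assert (A2 : Rabs (rpow r sg * y) <= rpow r1 sg * (1 + Rabs y)).
  { rewrite Rabs_mult (Rabs_pos_eq (rpow _ _)); [|apply rpow_ge0].
    apply Rmult_le_compat; try apply rpow_ge0; try apply Rabs_pos; try lra.
    apply rpow_le; lra. }
  apply Rabs_le_between in A1. apply Rabs_le_between in A2.
  apply Rabs_le_between; lra.
Qed.

(** A Gronwall bound that involves only upper bounds for the data, so that one constant serves every
    step size and the whole path of shooting parameters. *)
Definition euler_bound (c1 r1 a1 T : R) : R :=
  (1 + growth_rate c1 r1) *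
    (1 + exp ((1 + 2 * growth_rate c1 r1) * T) * (1 + a1)).

Section Bounds.

Variables (h c r0 a c1 r1 a1 T : R).
Hypotheses (Hh : 0 < h <= 1) (Hc : 0 <= c <= c1) (Hr0 : 0 <= r0)
  (Hr1 : r0 + T <= r1) (Ha : Rabs a <= a1) (HT : 0 < T).

Let gj j := fst (euler h c r0 a j).
Let pj j := snd (euler h c r0 a j).
Let C0 := growth_rate c1 r1.
Let lam := 1 + 2 * C0.

Lemma growth_rate_ge0 : 0 <= C0.
Proof. unfold C0, growth_rate. generalize (rpow_ge0 r1 sg). lra. Qed.

Lemma grid_radius_pos j : 0 < r0 + INR (S j) * h.
Proof. generalize (lt_0_INR (S j) ltac:(lia)). nra. Qed.

(** The factor [r / (r + h * d)] lies in [[0, 1]]: implicit friction only damps, even when [r] is as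
    small as [h]. *)
Lemma euler_snd_le j : INR (S j) * h <= T ->
  Rabs (pj (S j)) <= Rabs (pj j) + h * (C0 * (1 + Rabs (gj (S j)))).
Proof.
  intros Hj. unfold pj at 1. rewrite euler_snd_S. fold (gj (S j)) (pj j).
  set (r := r0 + INR (S j) * h).
  assert (Hr : 0 < r) by apply grid_radius_pos.
  assert (Hf : 0 <= r / (r + h * d) <= 1).
  { assert (0 <= h * d) by nra. split.
    - apply Rdiv_le_0_compat; lra.
    - apply Rle_div_l; lra. }
  rewrite Rabs_mult (Rabs_pos_eq (r / _)); [|lra].
  assert (Hreac := reaction_le c c1 r r1 (gj (S j)) Hc). fold C0 in Hreac.
  specialize (Hreac ltac:(unfold r in *; lra)).
  apply (Rle_trans _ (Rabs (pj j + h * reaction q sg c r (gj (S j))))).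
  - generalize (Rabs_pos (pj j + h * reaction q sg c r (gj (S j)))). nra.
  - apply: Rle_trans (Rabs_triang _ _) _. apply Rplus_le_compat_l.
    rewrite Rabs_mult (Rabs_pos_eq h); [|lra]. apply Rmult_le_compat_l; lra.
Qed.

(** Discrete Gronwall inequality: one step multiplies the left side by at most
    [1 + lam * h <= exp (lam * h)], where [h <= 1] absorbs the second-order term. *)
Lemma euler_growth j : INR j * h <= T ->
  1 + Rabs (gj j) + Rabs (pj j) <= exp (lam * (INR j * h)) * (1 + a1).
Proof.
  generalize growth_rate_ge0 => HC0.
  induction j as [|j IH]; intros Hj.
  - unfold gj, pj; simpl. rewrite Rmult_0_l Rmult_0_r exp_0 Rabs_R0. lra.
  - assert (Hle := euler_snd_le j Hj).
    rewrite S_INR in Hj.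
    specialize (IH ltac:(lra)).
    assert (Hg : Rabs (gj (S j)) <= Rabs (gj j) + h * Rabs (pj j)).
    { unfold gj at 1; rewrite euler_fst_S; fold (gj j) (pj j).
      apply: Rle_trans (Rabs_triang _ _) _.
      rewrite Rabs_mult (Rabs_pos_eq h); lra. }
    set (Gj := Rabs (gj j)) in *. set (Pj := Rabs (pj j)) in *.
    assert (HGj : 0 <= Gj) by apply Rabs_pos.
    assert (HPj : 0 <= Pj) by apply Rabs_pos.
    assert (Hexp : 1 + lam * h <= exp (lam * h)) by apply exp_ineq1_le.
    rewrite S_INR.
    replace (lam * ((INR j + 1) * h)) with (lam * (INR j * h) + lam * h) by ring.
    rewrite exp_plus.
    apply (Rle_trans _ ((1 + Gj + Pj) * (1 + lam * h))).
    + assert (h * (C0 * (1 + Rabs (gj (S j)))) <= h * (C0 * (1 + Gj + Pj))).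
      { apply Rmult_le_compat_l; [lra|]. apply Rmult_le_compat_l; [lra|]. nra. }
      unfold lam.
      assert (0 <= h * (C0 * (1 + Gj + Pj))) by (repeat apply Rmult_le_pos; lra).
      assert (0 <= h * Gj) by nra. nra.
    + assert (0 < exp (lam * (INR j * h))) by apply exp_pos.
      assert (0 <= lam * h) by (unfold lam; nra).
      replace (exp (lam * (INR j * h)) * exp (lam * h) * (1 + a1))
        with (exp (lam * (INR j * h)) * (1 + a1) * exp (lam * h)) by ring.
      apply Rmult_le_compat; lra.
Qed.

Let G := exp (lam * T) * (1 + a1).

Lemma euler_fst_le j : INR j * h <= T -> Rabs (gj j) <= G.
Proof.
  intros Hj. generalize growth_rate_ge0 => HC0.
  assert (H := euler_growth j Hj).
  apply (Rle_trans _ (exp (lam * (INR j * h)) * (1 + a1))).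
  - generalize (Rabs_pos (pj j)); lra.
  - apply Rmult_le_compat_r; [generalize (Rabs_pos a); lra|].
    destruct (Rle_lt_or_eq_dec _ _ Hj) as [H1| ->]; [|lra].
    apply Rlt_le, exp_increasing. unfold lam; nra.
Qed.

Lemma euler_snd_linear j : INR j * h <= T -> Rabs (pj j) <= C0 * (1 + G) * (INR j * h).
Proof.
  generalize growth_rate_ge0 => HC0.
  induction j as [|j IH]; intros Hj.
  - unfold pj; simpl. rewrite Rabs_R0. lra.
  - assert (Hle := euler_snd_le j Hj). assert (HG := euler_fst_le (S j) Hj).
    rewrite S_INR in Hj |- *. specialize (IH ltac:(lra)).
    assert (h * (C0 * (1 + Rabs (gj (S j)))) <= h * (C0 * (1 + G))); [|nra].
    apply Rmult_le_compat_l; [lra|]. apply Rmult_le_compat_l; lra.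
Qed.

Lemma euler_fst_quadratic j : INR j * h <= T ->
  Rabs (gj j - a) <= C0 * (1 + G) * (INR j * h) ^ 2.
Proof.
  generalize growth_rate_ge0 => HC0.
  assert (HG : 0 <= G).
  { unfold G. generalize (exp_pos (lam * T)) (Rabs_pos a). nra. }
  induction j as [|j IH]; intros Hj.
  - unfold gj; simpl. rewrite Rminus_diag Rabs_R0. lra.
  - rewrite S_INR in Hj |- *. specialize (IH ltac:(lra)).
    assert (Hp := euler_snd_linear j ltac:(lra)).
    unfold gj; rewrite euler_fst_S; fold (gj j) (pj j).
    replace (gj j + h * pj j - a) with (gj j - a + h * pj j) by ring.
    apply: Rle_trans (Rabs_triang _ _) _. rewrite Rabs_mult (Rabs_pos_eq h); [|lra].
    set (M := C0 * (1 + G)) in *. assert (0 <= M) by (unfold M; nra).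
    assert (0 <= INR j) by apply pos_INR.
    apply (Rle_trans _ (M * (INR j * h) ^ 2 + h * (M * (INR j * h)))); [nra|].
    assert (0 <= M * (h * h)) by (apply Rmult_le_pos; nra).
    assert (0 <= M * (h * h) * INR j) by (apply Rmult_le_pos; nra).
    nra.
Qed.

Lemma euler_approx_solution :
  approx_solution q sg d c r0 a T (euler_bound c1 r1 a1 T) h
    (fun s => gj (grid_index h s)) (fun s => pj (grid_index h s)).
Proof.
  generalize growth_rate_ge0 => HC0.
  assert (HG : 0 <= G).
  { unfold G. generalize (exp_pos (lam * T)) (Rabs_pos a). nra. }
  assert (HB : euler_bound c1 r1 a1 T = (1 + C0) * (1 + G)) by easy.
  split; [|split].
  - intros s Hs. destruct (grid_index_spec h s) as [Hs1 _]; try lra.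
    set (i := grid_index h s) in *. rewrite HB.
    assert (Hi : 0 <= INR i * h) by (generalize (pos_INR i); nra).
    assert (H1 := euler_fst_le i ltac:(lra)).
    assert (H2 := euler_snd_linear i ltac:(lra)).
    assert (H3 := euler_fst_quadratic i ltac:(lra)).
    assert (HM : 0 <= C0 * (1 + G) <= (1 + C0) * (1 + G)) by nra.
    split; [nra|split].
    + apply: Rle_trans H2 _. apply Rmult_le_compat; lra.
    + apply: Rle_trans H3 _. apply Rmult_le_compat; try lra.
      * apply pow_le; lra.
      * apply pow_incr; lra.
  - apply (mean_value_bound_step h T gj pj); [lra| |].
    + intros i. unfold gj; rewrite euler_fst_S. unfold pj; ring.
    + intros s t i Hs Hst Hi.
      destruct (grid_index_spec h s) as [Hs1 Hs2]; try lra.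
      destruct (grid_index_spec h t) as [Ht1 Ht2]; try lra.
      assert (Hlt : INR i + 1 <= INR (grid_index h t)).
      { rewrite -S_INR. apply le_INR; lia. }
      assert (Hge : INR (grid_index h s) <= INR i) by (apply le_INR; lia).
      (* Step [i] may be the one containing [s], and then its left end lies before [s]. *)
      exists (Rmax s (INR i * h)).
      assert (Hiu : INR i * h <= t) by nra.
      split; [split; [apply Rmax_l|apply Rmax_lub; lra]|].
      f_equal. apply grid_index_unique; [lra| |].
      * apply: Rle_trans (Rmax_l _ _); lra.
      * split; [apply Rmax_r|apply Rmax_lub_lt; nra].
  - set (Q := fun s => acceleration q sg d c (r0 + s)
      (gj (grid_index h s)) (pj (grid_index h s))).
    apply (mean_value_bound_step h T pj (fun i => Q (INR (S i) * h))); [lra| |].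
    + intros i. unfold Q.
      rewrite (grid_index_unique h (INR (S i) * h) (S i)); [|lra| |].
      * unfold acceleration.
        assert (Hr : 0 < r0 + INR (S i) * h) by apply grid_radius_pos.
        assert (0 <= h * d) by nra.
        unfold pj; rewrite euler_snd_S. fold (gj (S i)) (pj i).
        field; lra.
      * generalize (pos_INR (S i)); nra.
      * nra.
    (* The velocity increment of step [i] is governed by the acceleration at its right end, which
       lies beyond [s] even if [s] is in step [i]. *)
    + intros s t i Hs Hst Hi. exists (INR (S i) * h). split; [|easy].
      destruct (grid_index_spec h s) as [Hs1 Hs2]; try lra.
      destruct (grid_index_spec h t) as [Ht1 Ht2]; try lra.
      assert (Hlt : INR (S i) <= INR (grid_index h t)) by (apply le_INR; lia).
      assert (Hge : INR (grid_index h s) + 1 <= INR (S i)).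
      { rewrite -S_INR. apply le_INR; lia. }
      nra.
Qed.

End Bounds.

(** At fixed [h] and [j] the iterate is a finite composition of continuous operations. This is the
    continuous dependence that shooting needs and that the differential equation does not offer. *)
Lemma euler_continuous (h : R) (c r0 a : R -> R) j :
  0 < h -> (forall t, 0 <= r0 t) ->
  (forall t, continuous c t) -> (forall t, continuous r0 t) ->
  (forall t, continuous a t) ->
  forall t, continuous (fun t => fst (euler h (c t) (r0 t) (a t) j)) t /\
    continuous (fun t => snd (euler h (c t) (r0 t) (a t) j)) t.
Proof.
  intros Hh Hr0 Hc Hr Ha. induction j as [|j IH]; intros t.
  - split; [apply Ha|apply continuous_const].
  - destruct (IH t) as [IH1 IH2].
    assert (H1 : continuous (fun t => fst (euler h (c t) (r0 t) (a t) (S j))) t).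
    { apply (continuous_ext (fun t => fst (euler h (c t) (r0 t) (a t) j)
         + h * snd (euler h (c t) (r0 t) (a t) j))).
      - intros x; rewrite euler_fst_S //.
      - apply lim_plus; [exact IH1|apply lim_mult; [apply lim_const|exact IH2]]. }
    split; [exact H1|].
    eapply continuous_ext; [intros x; symmetry; apply euler_snd_S|].
    assert (Hrl : filterlim (fun x => r0 x + INR (S j) * h) (locally t)
      (locally (r0 t + INR (S j) * h))).
    { apply lim_plus; [apply Hr|apply lim_const]. }
    assert (Hpos : 0 < INR (S j)) by (apply lt_0_INR; lia).
    apply lim_mult; [apply lim_plus; [exact IH2|]|].
    + apply lim_mult; [apply lim_const|]. unfold reaction.
      apply lim_minus; apply lim_mult.
      * apply Hc.
      * apply (lim_comp (fun y => rpow y q)); [apply continuous_rpow; lra|exact H1].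
      * apply (lim_comp (fun y => rpow y sg)); [apply continuous_rpow; lra|exact Hrl].
      * exact H1.
    + specialize (Hr0 t). apply lim_div; [|exact Hrl|].
      * assert (0 <= h * d) by nra. nra.
      * apply lim_plus; [exact Hrl|apply lim_const].
Qed.

End EulerScheme.

(** * Monotonicity and oscillation *)

Lemma is_derive_continuous (f : R -> R) x l : is_derive f x l -> continuous f x.
Proof. intros H; apply (ex_derive_continuous f); eexists; exact H. Qed.

Lemma is_derive_continuity_pt (f : R -> R) x l : is_derive f x l -> continuity_pt f x.
Proof. intros H; apply continuity_pt_filterlim, (is_derive_continuous _ _ _ H). Qed.

Lemma derive_between (f f' : R -> R) x y : x < y ->
  (forall z, x <= z <= y -> is_derive f z (f' z)) ->
  exists z, x <= z <= y /\ f y - f x = f' z * (y - x).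
Proof.
  intros Hxy Hd. destruct (MVT_gen f x y f') as [z [Hz Heq]].
  - intros z; rewrite Rmin_left ?Rmax_right; try lra; intros Hz; apply Hd; lra.
  - intros z; rewrite Rmin_left ?Rmax_right; try lra; intros Hz.
    apply (is_derive_continuity_pt _ _ (f' z)), Hd; lra.
  - rewrite Rmin_left ?Rmax_right in Hz; try lra. by exists z.
Qed.

Lemma nonincreasing_of_derive (f f' : R -> R) u v :
  (forall x, u < x < v -> is_derive f x (f' x) /\ f' x <= 0) ->
  forall x y, u < x -> x <= y -> y < v -> f y <= f x.
Proof.
  intros Hd x y Hx Hxy Hy. destruct (Req_dec x y) as [->|Hne]; [lra|].
  destruct (derive_between f f' x y) as [z [Hz Heq]]; [lra|intros z Hz; apply Hd; lra|].
  destruct (Hd z) as [_ H]; [lra|]. nra.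
Qed.

Lemma nonincreasing_le_right_limit (f : R -> R) u v l :
  (forall x y, u < x -> x <= y -> y < v -> f y <= f x) ->
  filterlim f (at_right u) (locally l) -> forall x, u < x < v -> f x <= l.
Proof.
  intros Hf Hl x Hx. apply (lim_ge (at_right u) f); [exact Hl|].
  assert (Hd : 0 < x - u) by lra.
  exists (mkposreal _ Hd). intros y Hy Huy. change (Rabs (y - u) < x - u) in Hy.
  apply Rabs_lt_between in Hy. apply Hf; lra.
Qed.

Lemma nonincreasing_ge_left_limit (f : R -> R) u v l :
  (forall x y, u < x -> x <= y -> y < v -> f y <= f x) ->
  filterlim f (at_left v) (locally l) -> forall x, u < x < v -> l <= f x.
Proof.
  intros Hf Hl x Hx. apply (lim_le (at_left v) f); [exact Hl|].
  assert (Hd : 0 < v - x) by lra.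
  exists (mkposreal _ Hd). intros y Hy Huy. change (Rabs (y - v) < v - x) in Hy.
  apply Rabs_lt_between in Hy. apply Hf; lra.
Qed.

Lemma derive_neg_lower_right (f : R -> R) x y l :
  x < y -> is_derive f x l -> l < 0 -> exists z, x < z < y /\ f z < f x.
Proof.
  intros Hxy Hd Hl. apply is_derive_Reals in Hd.
  destruct (Hd (- l)) as [[delta Hdelta] H]; [lra|]. simpl in H.
  set (h := Rmin (delta / 2) ((y - x) / 2)).
  assert (Hh : 0 < h) by (apply Rmin_glb_lt; lra).
  assert (Hh1 : h <= delta / 2) by apply Rmin_l.
  assert (Hh2 : h <= (y - x) / 2) by apply Rmin_r.
  specialize (H h ltac:(lra)). rewrite (Rabs_pos_eq h) in H; [|lra].
  specialize (H ltac:(lra)). apply Rabs_lt_between in H.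
  exists (x + h). split; [lra|].
  assert (Hq : (f (x + h) - f x) / h < 0) by lra.
  apply Rlt_div_l in Hq; lra.
Qed.

Lemma derive_pos_lower_left (f : R -> R) x y l :
  x < y -> is_derive f y l -> 0 < l -> exists z, x < z < y /\ f z < f y.
Proof.
  intros Hxy Hd Hl.
  destruct (derive_neg_lower_right (fun t => f (- t)) (- y) (- x) (- l)) as [z [Hz Hfz]].
  - lra.
  - replace (- l) with ((- 1) * l) by ring.
    apply (is_derive_comp f (fun t => - t)).
    + rewrite Ropp_involutive; exact Hd.
    + auto_derive; [easy|ring].
  - lra.
  - exists (- z). rewrite Ropp_involutive in Hfz. split; lra.
Qed.

Lemma interior_min (f f' : R -> R) x y :
  x < y -> (forall z, x <= z <= y -> is_derive f z (f' z)) ->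
  (exists z, x <= z <= y /\ f z < f x) -> (exists z, x <= z <= y /\ f z < f y) ->
  exists u, x < u < y /\ f' u = 0 /\ forall z, x <= z <= y -> f u <= f z.
Proof.
  intros Hxy Hd [zx [Hzx Hfx]] [zy [Hzy Hfy]].
  destruct (continuity_ab_min f x y) as [u [Hu1 Hu2]]; [lra| |].
  { intros z Hz; apply (is_derive_continuity_pt _ _ _ (Hd z Hz)). }
  assert (Hux : u <> x) by (intros ->; specialize (Hu1 zx Hzx); lra).
  assert (Huy : u <> y) by (intros ->; specialize (Hu1 zy Hzy); lra).
  exists u. split; [lra|split; [|exact Hu1]].
  destruct (Rtotal_order (f' u) 0) as [H|[H|H]]; [|exact H|]; exfalso.
  - destruct (derive_neg_lower_right f u y (f' u)) as [z [Hz Hfz]];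
      [lra|apply Hd; lra|exact H|].
    specialize (Hu1 z ltac:(lra)); lra.
  - destruct (derive_pos_lower_left f x u (f' u)) as [z [Hz Hfz]];
      [lra|apply Hd; lra|exact H|].
    specialize (Hu1 z ltac:(lra)); lra.
Qed.

Lemma first_zero (f : R -> R) a b :
  a <= b -> (forall x, a <= x <= b -> continuous f x) -> 0 < f a -> f b <= 0 ->
  exists z, a < z <= b /\ f z = 0 /\ forall x, a <= x < z -> 0 < f x.
Proof.
  intros Hab Hf Ha Hb.
  set (E := fun x => a <= x <= b /\ forall y, a <= y <= x -> 0 < f y).
  destruct (completeness E) as [z [Hz1 Hz2]].
  { exists b; intros x [Hx _]; lra. }
  { exists a; split; [lra|]. intros y Hy; replace y with a by lra; exact Ha. }
  assert (Haz : a <= z).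
  { apply Hz1; split; [lra|]. intros y Hy; replace y with a by lra; exact Ha. }
  assert (Hzb : z <= b) by (apply Hz2; intros x [Hx _]; lra).
  assert (Hpos : forall x, a <= x < z -> 0 < f x).
  { intros x Hx. apply NNPP; intros Hn.
    assert (z <= x); [|lra]. apply Hz2. intros y [Hy1 Hy2].
    apply Rnot_lt_le; intros Hlt. apply Hn, Hy2; lra. }
  assert (Hloc : forall x, a <= x <= b -> forall eps, 0 < eps -> exists eta, 0 < eta /\
    forall y, Rabs (y - x) < eta -> Rabs (f y - f x) < eps).
  { intros x Hx eps He.
    destruct (proj1 (lim_eps (locally x) f (f x)) (Hf x Hx) eps He) as [eta Heta].
    exists eta; split; [apply cond_pos|exact Heta]. }
  assert (Hfz : f z = 0).
  { destruct (Rtotal_order (f z) 0) as [H|[H|H]]; [exfalso|exact H|exfalso].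
    - destruct (Hloc z ltac:(lra) (- f z) ltac:(lra)) as [eta [Heta Hy]].
      destruct (Req_dec a z) as [Haz'|Haz']; [rewrite -Haz' in H; lra|].
      set (y := Rmax a (z - eta / 2)).
      assert (Hy1 : a <= y) by apply Rmax_l.
      assert (Hy2 : z - eta / 2 <= y) by apply Rmax_r.
      assert (Hy3 : y < z) by (apply Rmax_lub_lt; lra).
      specialize (Hy y). specialize (Hpos y ltac:(lra)).
      assert (Habs : Rabs (y - z) < eta) by (apply Rabs_lt_between; lra).
      specialize (Hy Habs). apply Rabs_lt_between in Hy; lra.
    - destruct (Hloc z ltac:(lra) (f z) ltac:(lra)) as [eta [Heta Hy]].
      assert (Hzb' : z <> b) by (intros ->; lra).
      set (y := Rmin b (z + eta / 2)).
      assert (Hy1 : y <= b) by apply Rmin_l.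
      assert (Hy2 : y <= z + eta / 2) by apply Rmin_r.
      assert (Hy3 : z < y) by (apply Rmin_glb_lt; lra).
      assert (y <= z); [|lra]. apply Hz1. split; [lra|].
      intros x Hx. destruct (Rlt_dec x z); [apply Hpos; lra|].
      assert (Habs : Rabs (x - z) < eta) by (apply Rabs_lt_between; lra).
      specialize (Hy x Habs). apply Rabs_lt_between in Hy; lra. }
  exists z. split; [|split; [exact Hfz|exact Hpos]].
  split; [|exact Hzb]. destruct (Req_dec a z) as [Haz'|]; [|lra].
  rewrite -Haz' in Hfz; lra.
Qed.

(* Riccati: [v = p / y] satisfies [v' <= - (1 + v ^ 2) / 2], so [atan v + r / 2]
   is nonincreasing while [atan v] stays in an interval of length [PI]. *)
Lemma oscillation (d sg k R1 R2 : R) (y p p' : R -> R) :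
  0 < R1 ->
  (forall r, R1 < r < R2 -> 0 < y r /\ is_derive y r (p r) /\ is_derive p r (p' r) /\
     p' r + d / r * p r <= - k * rpow r sg * y r /\
     1 / 2 + d ^ 2 / (2 * r ^ 2) <= k * rpow r sg) ->
  R2 - R1 <= 8.
Proof.
  intros HR1 H. apply Rnot_lt_le; intros Hlt.
  assert (Hm := nonincreasing_of_derive (fun r => atan (p r / y r) + r / 2)
    (fun r => (p' r / y r - (p r / y r) ^ 2) / (1 + (p r / y r) ^ 2) + 1 / 2) R1 R2).
  (* Over a length 8 the arctangent has to fall by at least 4, but its range is shorter than
     [PI <= 4]. The margin [e] keeps both ends inside the open interval. *)
  set (e := (R2 - R1 - 8) / 2) in *.
  assert (He : 0 < e) by (unfold e; lra).
  assert (Hd : atan (p (R1 + e + 8) / y (R1 + e + 8)) + (R1 + e + 8) / 2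
    <= atan (p (R1 + e) / y (R1 + e)) + (R1 + e) / 2).
  { apply Hm; [|lra|lra|unfold e; lra]. intros r Hr.
    destruct (H r Hr) as [Hy [Hdy [Hdp [Hode Hk]]]]. split.
    - assert (Ey : ex_derive y r) by (eexists; exact Hdy).
      assert (Ep : ex_derive p r) by (eexists; exact Hdp).
      auto_derive.
      + repeat split; try easy. lra.
      + rewrite (is_derive_unique _ _ _ Hdy) (is_derive_unique _ _ _ Hdp).
        assert (0 < 1 + (p r / y r) ^ 2) by nra.
        assert (0 < y r * y r + p r * p r) by nra.
        field. split; [|lra]. simpl; nra.
    - set (v := p r / y r).
      assert (Hv : p r = v * y r) by (unfold v; field; lra).
      assert (Hp' : p' r / y r <= - (d / r) * v - k * rpow r sg).
      { apply Rle_div_l; [lra|]. rewrite Hv in Hode. lra. }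
      (* The square bounds [- (d / r) * v] by [v ^ 2 / 2 + (d / r) ^ 2 / 2], so that half of
         [- v ^ 2] survives. *)
      assert (Hsq : 0 <= (v + d / r) ^ 2) by apply pow2_ge_0.
      assert (Hd2 : d ^ 2 / (2 * r ^ 2) = (d / r) ^ 2 / 2) by (field; lra).
      assert (Hnum : p' r / y r - v ^ 2 <= - (1 + v ^ 2) / 2).
      { rewrite Hd2 in Hk. simpl in Hsq, Hk |- *. lra. }
      assert (Hpos : 0 < 1 + v ^ 2) by nra.
      assert (Hq : (p' r / y r - v ^ 2) / (1 + v ^ 2) <= - (1 / 2)).
      { apply Rle_div_l; lra. }
      lra. }
  assert (B1 := atan_bound (p (R1 + e + 8) / y (R1 + e + 8))).
  assert (B2 := atan_bound (p (R1 + e) / y (R1 + e))).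
  assert (B3 := PI_4). lra.
Qed.

(** * The Pohozaev functional *)

Section Pohozaev.

Variables (q sg d c : R).
Hypotheses (Hq : 0 < q < 1) (Hsg : 0 < sg) (Hd : 3 <= d) (Hc : 0 < c).

(* [pohozaev_exponent] is the value of [alpha] for which multiplying the equation by
   [r^alpha g' + beta r^(alpha-1) g] makes the terms in [g'^2] and in [g^(q+1)] disappear. *)
Definition pohozaev_exponent : R := 2 * d * (q + 1) / (q + 3).
Definition pohozaev_beta : R := 2 * d / (q + 3).
Definition pohozaev_kappa : R := pohozaev_beta * (d + 1 - pohozaev_exponent) / 2.
(** This is [2 * pohozaev_beta - pohozaev_exponent], the value of [sg] at which the [r^sg g^2] term
    of [F'] changes sign. *)
Definition critical_sigma : R := 2 * d * (1 - q) / (q + 3).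

Definition pohozaev_density (r y w : R) : R :=
  w ^ 2 / 2 - c / (q + 1) * (y * rpow y q) + rpow r sg * y ^ 2 / 2
  + pohozaev_beta * y * w / r + pohozaev_kappa * y ^ 2 / r ^ 2.

Definition pohozaev (r y w : R) : R :=
  Rpower r pohozaev_exponent * pohozaev_density r y w.

Definition pohozaev_rate (r : R) : R :=
  (critical_sigma - sg) / 2 * rpow r sg
  + pohozaev_kappa * (2 - pohozaev_exponent) / r ^ 2.

Lemma pohozaev_beta_pos : 0 < pohozaev_beta.
Proof. unfold pohozaev_beta. apply Rdiv_lt_0_compat; lra. Qed.

Lemma pohozaev_kappa_pos : 0 < pohozaev_kappa.
Proof.
  unfold pohozaev_kappa. apply Rdiv_lt_0_compat; [|lra].
  apply Rmult_lt_0_compat; [apply pohozaev_beta_pos|].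
  unfold pohozaev_exponent.
  replace (d + 1 - 2 * d * (q + 1) / (q + 3)) with ((d * (1 - q) + q + 3) / (q + 3))
    by (field; lra).
  apply Rdiv_lt_0_compat; nra.
Qed.

(** Equivalent to [q + 3 < d * (q + 1)], which follows from [3 <= d]; for [d = 2] it would force
    [q > 1]. *)
Lemma pohozaev_exponent_gt2 : 2 < pohozaev_exponent.
Proof. unfold pohozaev_exponent. apply Rlt_div_r; nra. Qed.

(** The [g'^2] terms cancel by [alpha / 2 + beta = d], the [g^(q+1)] terms by
    [alpha = beta (q + 1)], and the [g g'] terms by the choice of [kappa]; only multiples of [g^2]
    remain. *)
Lemma is_derive_pohozaev (g p : R -> R) r : 0 < r -> 0 < g r ->
  is_derive g r (p r) -> is_derive p r (acceleration q sg d c r (g r) (p r)) ->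
  is_derive (fun r => pohozaev r (g r) (p r)) r
    (- (Rpower r pohozaev_exponent / r * g r ^ 2 * pohozaev_rate r)).
Proof.
  intros Hr Hg Hdg Hdp.
  assert (Eg : ex_derive g r) by (eexists; exact Hdg).
  assert (Ep : ex_derive p r) by (eexists; exact Hdp).
  set (al := pohozaev_exponent). set (be := pohozaev_beta). set (ka := pohozaev_kappa).
  (* The powers are rewritten as exponentials of logarithms for [auto_derive]; this is legitimate
     near [r], where the radius and [g] stay positive. *)
  apply (is_derive_ext_loc (fun r => exp (al * ln r) * (p r ^ 2 / 2
    - c / (q + 1) * (g r * exp (q * ln (g r))) + exp (sg * ln r) * g r ^ 2 / 2
    + be * g r * p r / r + ka * g r ^ 2 / r ^ 2))).
  - assert (Hcg := is_derive_continuous _ _ _ Hdg).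
    generalize (proj1 (lim_eps (locally r) g (g r)) Hcg (g r) Hg).
    assert (Hr' : locally r (fun x => 0 < x)) by (apply (open_gt 0 r); exact Hr).
    intros Hg'. apply: filter_imp (filter_and _ _ Hr' Hg') => x [Hx1 Hx2].
    apply Rabs_lt_between in Hx2.
    unfold pohozaev, pohozaev_density. rewrite !rpow_pos //; lra.
  - auto_derive.
    + repeat split; try easy; nra.
    + rewrite (is_derive_unique _ _ _ Hdg) (is_derive_unique _ _ _ Hdp).
      unfold acceleration, reaction, pohozaev_rate, al, be, ka, pohozaev_kappa,
        pohozaev_beta, critical_sigma, pohozaev_exponent.
      rewrite !rpow_pos //. unfold Rpower.
      set (A := exp (2 * d * (q + 1) / (q + 3) * ln r)).
      set (S := exp (sg * ln r)). set (G := exp (q * ln (g r))).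
      field. lra.
Qed.

Lemma lim_pohozaev_density {T} (F : (T -> Prop) -> Prop) {HF : Filter F} (r y w : T -> R)
    (r' y' w' : R) : 0 < r' ->
  filterlim r F (locally r') -> filterlim y F (locally y') -> filterlim w F (locally w') ->
  filterlim (fun n => pohozaev_density (r n) (y n) (w n)) F
    (locally (pohozaev_density r' y' w')).
Proof.
  intros Hr' Hr Hy Hw. unfold pohozaev_density.
  assert (Hsq : forall (x : T -> R) x', filterlim x F (locally x') ->
    filterlim (fun n => x n ^ 2) F (locally (x' ^ 2))).
  { intros x x' Hx. simpl. repeat apply lim_mult; try exact Hx; apply lim_const. }
  repeat apply lim_plus.
  - apply lim_div; [lra|apply Hsq, Hw|apply lim_const].
  - apply lim_opp. apply lim_mult; [apply lim_const|apply lim_mult; [exact Hy|]].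
    apply (lim_comp (fun x => rpow x q)); [apply continuous_rpow; lra|exact Hy].
  - apply lim_div; [lra| |apply lim_const]. apply lim_mult; [|apply Hsq, Hy].
    apply (lim_comp (fun x => rpow x sg)); [apply continuous_rpow; lra|exact Hr].
  - apply lim_div; [lra| |exact Hr].
    apply lim_mult; [apply lim_mult; [apply lim_const|exact Hy]|exact Hw].
  - apply lim_div; [apply pow_nonzero; lra| |apply Hsq, Hr].
    apply lim_mult; [apply lim_const|apply Hsq, Hy].
Qed.

Lemma lim_pohozaev {T} (F : (T -> Prop) -> Prop) {HF : Filter F} (r y w : T -> R)
    (r' y' w' : R) : 0 < r' ->
  filterlim r F (locally r') -> filterlim y F (locally y') -> filterlim w F (locally w') ->
  filterlim (fun n => pohozaev (r n) (y n) (w n)) F (locally (pohozaev r' y' w')).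
Proof.
  intros Hr' Hr Hy Hw. apply lim_mult; [|by apply lim_pohozaev_density].
  apply (lim_comp (fun x => Rpower x pohozaev_exponent)); [|exact Hr].
  apply (is_derive_continuous _ _ _ (is_derive_Rpower_base _ _ Hr')).
Qed.

Lemma pohozaev_at_zero r w : pohozaev r 0 w = Rpower r pohozaev_exponent * (w ^ 2 / 2).
Proof. unfold pohozaev, pohozaev_density. f_equal. unfold Rdiv. ring. Qed.

Lemma pohozaev_ge0_at_zero r w : 0 <= pohozaev r 0 w.
Proof.
  rewrite pohozaev_at_zero. apply Rmult_le_pos; [apply Rlt_le, Rpower_gt0|].
  generalize (pow2_ge_0 w); lra.
Qed.

(** * Bounded extent of solutions of positive energy at large radii *)

Definition ode_on (g p : R -> R) (u v : R) : Prop :=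
  forall r, u < r < v ->
    is_derive g r (p r) /\ is_derive p r (acceleration q sg d c r (g r) (p r)).

(** The midpoint of [c] and [2 c / (q + 1)], which are the values of [r^sg y^(1-q)] where the
    reaction and the potential part of the density vanish. Above it the equation oscillates; below
    it positive energy forces a definite slope. *)
Definition ratio_threshold : R := c * (q + 3) / (2 * (q + 1)).
Definition slope_bound : R := sqrt (c * (1 - q) / (8 * (q + 1))).
Definition slope_rate : R := (1 - q) / 2 * slope_bound.

(** From the third condition on, these serve in turn [oscillation], [slope_large],
    [psi_derive_sign], the decrease of the Pohozaev energy, and its negativity for a small value at
    rest. *)
Definition far (r : R) : Prop :=
  1 <= r /\ 1 <= rpow r sg /\
  1 / 2 + d ^ 2 / 2 <= (1 - q) / (q + 3) * rpow r sg /\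
  (pohozaev_beta * sqrt ratio_threshold * slope_bound
     + pohozaev_kappa * ratio_threshold) / r < slope_bound ^ 2 / 2 /\
  sg * sqrt ratio_threshold / (2 * r) < slope_rate /\
  0 < pohozaev_rate r /\
  pohozaev_kappa < rpow r sg * ((1 - q) / (2 * (q + 1))).

Lemma slope_bound_pos : 0 < slope_bound.
Proof. apply sqrt_lt_R0, Rdiv_lt_0_compat; nra. Qed.

Lemma slope_rate_pos : 0 < slope_rate.
Proof. unfold slope_rate. generalize slope_bound_pos. nra. Qed.

Lemma ratio_threshold_pos : 0 < ratio_threshold.
Proof. apply Rdiv_lt_0_compat; nra. Qed.

Lemma eventually_far : sg < critical_sigma -> exists X, 1 <= X /\ forall r, X <= r -> far r.
Proof.
  intros Hcrit.
  generalize slope_bound_pos slope_rate_pos ratio_threshold_pos pohozaev_kappa_pos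
    pohozaev_exponent_gt2 pohozaev_beta_pos.
  intros Hu0 Hk3 Hth Hka Hal Hbe.
  assert (Hsth := sqrt_pos ratio_threshold).
  set (l1 := (1 / 2 + d ^ 2 / 2) / ((1 - q) / (q + 3))).
  set (n2 := pohozaev_beta * sqrt ratio_threshold * slope_bound
     + pohozaev_kappa * ratio_threshold).
  set (l2 := n2 / (slope_bound ^ 2 / 2)).
  set (l3 := sg * sqrt ratio_threshold / (2 * slope_rate)).
  set (l4 := pohozaev_kappa * (pohozaev_exponent - 2) / ((critical_sigma - sg) / 2)).
  set (l5 := pohozaev_kappa / ((1 - q) / (2 * (q + 1)))).
  assert (Hn2 : 0 <= n2).
  { unfold n2. assert (0 <= pohozaev_beta * sqrt ratio_threshold) by nra. nra. }
  assert (Hk1 : 0 < (1 - q) / (q + 3)) by (apply Rdiv_lt_0_compat; lra).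
  assert (Hk5 : 0 < (1 - q) / (2 * (q + 1))) by (apply Rdiv_lt_0_compat; lra).
  assert (H1 : 0 <= l1) by (apply Rdiv_le_0_compat; [nra|exact Hk1]).
  assert (H2 : 0 <= l2) by (apply Rdiv_le_0_compat; [exact Hn2|nra]).
  assert (H3 : 0 <= l3) by (apply Rdiv_le_0_compat; [apply Rmult_le_pos|]; lra).
  assert (H4 : 0 <= l4) by (apply Rdiv_le_0_compat; [apply Rmult_le_pos|]; lra).
  assert (H5 : 0 <= l5) by (apply Rdiv_le_0_compat; lra).
  set (L := 1 + l1 + l2 + l3 + l4 + l5).
  (* Conditions in [1 / r] need [L <= r], those in [r^sg] need [L <= r^sg]. *)
  exists (Rmax L (Rpower L (/ sg))).
  split; [apply: Rle_trans (Rmax_l _ _); unfold L; lra|].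
  intros r Hr.
  assert (Hr1 : L <= r) by (apply: Rle_trans (Rmax_l _ _) Hr).
  assert (Hrs : L <= rpow r sg).
  { rewrite rpow_pos; [|unfold L in Hr1; lra].
    replace L with (Rpower (Rpower L (/ sg)) sg).
    - apply Rle_Rpower_l; [lra|]. split; [apply Rpower_gt0|].
      apply: Rle_trans (Rmax_r _ _) Hr.
    - rewrite Rpower_mult Rinv_l; [apply Rpower_1; unfold L; lra|lra]. }
  set (rs := rpow r sg) in *.
  assert (Hr0 : 1 <= r) by (unfold L in Hr1; lra).
  unfold far; fold rs n2.
  split; [exact Hr0|]. split; [unfold L in Hrs; lra|]. split; [|split; [|split; [|split]]].
  - assert (Hl : l1 <= rs) by (unfold L in Hrs; lra).
    unfold l1 in Hl. apply Rle_div_l in Hl; lra.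
  - assert (Hl : l2 < r) by (unfold L in Hr1; lra).
    unfold l2 in Hl. apply Rlt_div_l in Hl; [|nra]. apply Rlt_div_l; lra.
  - assert (Hl : l3 < r) by (unfold L in Hr1; lra).
    unfold l3 in Hl. apply Rlt_div_l in Hl; [|lra]. apply Rlt_div_l; lra.
  - assert (Hl : l4 < rs) by (unfold L in Hrs; lra).
    unfold l4 in Hl. apply Rlt_div_l in Hl; [|lra].
    unfold pohozaev_rate. fold rs.
    assert (Hr2 : pohozaev_kappa * (pohozaev_exponent - 2) / r ^ 2
      <= pohozaev_kappa * (pohozaev_exponent - 2)).
    { apply Rle_div_l; [nra|].
      rewrite -{1}(Rmult_1_r (_ * _)). apply Rmult_le_compat_l; nra. }
    replace (pohozaev_kappa * (2 - pohozaev_exponent) / r ^ 2)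
      with (- (pohozaev_kappa * (pohozaev_exponent - 2) / r ^ 2)) by (field; lra).
    lra.
  - assert (Hl : l5 < rs) by (unfold L in Hrs; lra).
    unfold l5 in Hl. apply Rlt_div_l in Hl; lra.
Qed.

(* In terms of [u = w / y^((q+1)/2)] and [h = y^((1-q)/2)] the density is [y^(q+1)] times
   [u^2/2 - c/(q+1) + r^sg h^2/2 + beta h u/r + kappa h^2/r^2]. *)
Definition slope (y w : R) : R := w / Rpower y ((q + 1) / 2).
Definition height (y : R) : R := Rpower y ((1 - q) / 2).
(** Its square is [r^sg y^(1-q)], the quantity compared with [ratio_threshold]. *)
Definition scaled_height (r y : R) : R := Rpower r (sg / 2) * height y.

Lemma height_slope_factor y : 0 < y -> Rpower y ((q + 1) / 2) * height y = y.
Proof.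
  intros Hy. unfold height. rewrite -Rpower_plus.
  replace ((q + 1) / 2 + (1 - q) / 2) with 1 by field. by apply Rpower_1.
Qed.

Lemma scaled_height_sq r y : 0 < r -> scaled_height r y ^ 2 = rpow r sg * height y ^ 2.
Proof.
  intros Hr. unfold scaled_height. rewrite Rpow_mult_distr. f_equal.
  rewrite rpow_pos // /= Rmult_1_r -Rpower_plus. f_equal; field.
Qed.

Lemma height_le r y : far r -> scaled_height r y <= sqrt ratio_threshold ->
  rpow r sg * height y ^ 2 <= ratio_threshold /\ height y <= sqrt ratio_threshold /\
  height y ^ 2 <= ratio_threshold.
Proof.
  intros [Hr [Hrs _]] Hs.
  assert (Hh : 0 < height y) by apply Rpower_gt0.
  assert (Hp := Rpower_gt0 r (sg / 2)).
  assert (Hsp : 0 < scaled_height r y) by (apply Rmult_lt_0_compat; easy).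
  assert (Hth := ratio_threshold_pos).
  assert (H1 : rpow r sg * height y ^ 2 <= ratio_threshold).
  { rewrite -scaled_height_sq; [|lra].
    rewrite -(pow2_sqrt ratio_threshold); [|lra]. apply pow_incr; lra. }
  assert (H2 : height y ^ 2 <= ratio_threshold) by nra.
  split; [exact H1|split; [|exact H2]].
  rewrite -(sqrt_pow2 (height y)); [|lra]. by apply sqrt_le_1_alt.
Qed.

(** Below the threshold the potential part of the scaled density is at most [- 2 * slope_bound ^ 2].
    A slope within [slope_bound] and the terms in [1 / r] each contribute at most
    [slope_bound ^ 2 / 2], which leaves the density negative. *)
Lemma slope_large r y w : far r -> 0 < y -> 0 < pohozaev r y w ->
  scaled_height r y <= sqrt ratio_threshold -> slope_bound < Rabs (slope y w).
Proof.
  intros Hfar Hy Hpoh Hs. destruct (height_le r y Hfar Hs) as [H1 [H2 H3]].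
  destruct Hfar as [Hr [Hrs [_ [H4 _]]]].
  assert (Hh : 0 < height y) by apply Rpower_gt0.
  assert (Hden : 0 < pohozaev_density r y w).
  { unfold pohozaev in Hpoh. assert (Hp := Rpower_gt0 r pohozaev_exponent).
    apply Rnot_le_lt; intros Hn. nra. }
  set (Y := Rpower y ((q + 1) / 2)).
  assert (HY : 0 < Y) by apply Rpower_gt0.
  assert (HyY : y = Y * height y) by (symmetry; apply height_slope_factor, Hy).
  assert (HYq : y * rpow y q = Y ^ 2).
  { rewrite rpow_pos // /Y -{1}(Rpower_1 y) // -Rpower_plus /= Rmult_1_r -Rpower_plus.
    f_equal; field. }
  set (u := slope y w). assert (Hw : w = u * Y) by (unfold u, slope; fold Y; field; lra).
  apply Rnot_le_lt; intros Hu.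
  assert (Hu0 := slope_bound_pos).
  assert (Hsb : slope_bound ^ 2 = c * (1 - q) / (8 * (q + 1))).
  { unfold slope_bound. rewrite pow2_sqrt //. apply Rdiv_le_0_compat; nra. }
  set (h := height y) in *. set (th := ratio_threshold) in *.
  assert (Hbr : 0 < u ^ 2 / 2 - c / (q + 1) + rpow r sg * h ^ 2 / 2
    + pohozaev_beta * h * u / r + pohozaev_kappa * h ^ 2 / r ^ 2).
  { assert (HYY : 0 < Y ^ 2) by nra.
    replace (pohozaev_density r y w) with (Y ^ 2 * (u ^ 2 / 2 - c / (q + 1)
      + rpow r sg * h ^ 2 / 2 + pohozaev_beta * h * u / r + pohozaev_kappa * h ^ 2 / r ^ 2))
      in Hden.
    - apply Rnot_le_lt; intros Hn. nra.
    - unfold pohozaev_density. rewrite HYq Hw. rewrite HyY. field. lra. }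
  assert (Hbe := pohozaev_beta_pos). assert (Hka := pohozaev_kappa_pos).
  assert (Hu2 : u ^ 2 <= slope_bound ^ 2).
  { rewrite -(pow2_abs u). apply pow_incr. split; [apply Rabs_pos|exact Hu]. }
  assert (A1 : pohozaev_beta * h * u / r <= pohozaev_beta * sqrt th * slope_bound / r).
  { apply Rmult_le_compat_r; [apply Rlt_le, Rinv_0_lt_compat; lra|].
    apply (Rle_trans _ (pohozaev_beta * h * slope_bound)).
    - apply Rmult_le_compat_l; [nra|]. generalize (Rle_abs u); lra.
    - apply Rmult_le_compat_r; [lra|]. apply Rmult_le_compat_l; lra. }
  assert (A2 : pohozaev_kappa * h ^ 2 / r ^ 2 <= pohozaev_kappa * th / r).
  { apply Rle_div_l; [nra|].
    replace (pohozaev_kappa * th / r * r ^ 2) with (pohozaev_kappa * th * r) by (field; lra).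
    assert (0 < th) by apply ratio_threshold_pos.
    assert (pohozaev_kappa * h ^ 2 <= pohozaev_kappa * th) by nra.
    assert (0 < pohozaev_kappa * th) by nra. nra. }
  assert (A3 : c / (q + 1) - th / 2 = 2 * slope_bound ^ 2).
  { rewrite Hsb. unfold th, ratio_threshold. field; lra. }
  replace ((pohozaev_beta * sqrt th * slope_bound + pohozaev_kappa * th) / r) with
    (pohozaev_beta * sqrt th * slope_bound / r + pohozaev_kappa * th / r) in H4
    by (field; lra).
  assert (0 < slope_bound ^ 2) by nra. lra.
Qed.


(** The power [(1 - q) / 2] is the one for which the derivative depends on the slope alone, so a
    slope bounded away from 0 exhausts the height within a finite length. *)
Lemma is_derive_height (g : R -> R) r w : 0 < g r -> is_derive g r w ->
  is_derive (fun r => height (g r)) r ((1 - q) / 2 * slope (g r) w).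
Proof.
  intros Hg Hd'.
  assert (Heq : (1 - q) / 2 * slope (g r) w = w * ((1 - q) / 2 * height (g r) / g r)).
  { unfold slope. rewrite -{3}(height_slope_factor (g r) Hg).
    assert (0 < height (g r)) by apply Rpower_gt0.
    assert (Hpow := Rpower_gt0 (g r) ((q + 1) / 2)). field. lra. }
  rewrite Heq. apply (is_derive_comp (fun y => Rpower y ((1 - q) / 2)) g); [|exact Hd'].
  by apply is_derive_Rpower_base.
Qed.

Lemma is_derive_scaled_height (g : R -> R) r w : 0 < r -> 0 < g r -> is_derive g r w ->
  is_derive (fun r => scaled_height r (g r)) r
    (Rpower r (sg / 2) * (sg / (2 * r) * height (g r) + (1 - q) / 2 * slope (g r) w)).
Proof.
  intros Hr Hg Hd'.
  assert (H1 := is_derive_Rpower_base (sg / 2) r Hr).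
  assert (H2 := is_derive_height g r w Hg Hd').
  replace (Rpower r (sg / 2) * (sg / (2 * r) * height (g r) + (1 - q) / 2 * slope (g r) w))
    with ((sg / 2 * Rpower r (sg / 2) / r) * height (g r)
      + Rpower r (sg / 2) * ((1 - q) / 2 * slope (g r) w)) by (field; lra).
  exact (is_derive_mult (fun x => Rpower x (sg / 2)) _ _ _ _ H1 H2 Rmult_comm).
Qed.

Section Extent.

Variables (g p : R -> R) (u R1 z : R).
Hypotheses (Hu : u < R1) (Hfar : forall r, R1 <= r -> far r) (Hode : ode_on g p u z)
  (Hpos : forall r, R1 <= r < z -> 0 < g r /\ 0 < pohozaev r (g r) (p r)).

Let psi r := scaled_height r (g r).
Let psi' r := Rpower r (sg / 2) *
  (sg / (2 * r) * height (g r) + (1 - q) / 2 * slope (g r) (p r)).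
Let sl r := slope (g r) (p r).

Lemma radius_ge1 r : R1 <= r -> 1 <= r.
Proof. intros Hr; apply (Hfar r Hr). Qed.

Lemma psi_derive r : R1 <= r < z -> is_derive psi r (psi' r).
Proof.
  intros Hr. assert (H1 := radius_ge1 r ltac:(lra)).
  apply is_derive_scaled_height; [lra|apply Hpos, Hr|]. apply Hode; lra.
Qed.

(** The growth of [r^(sg/2)] contributes less than [slope_rate], so below the threshold the slope
    alone decides the sign of [psi']. *)
Lemma psi_derive_sign r : R1 <= r < z -> psi r <= sqrt ratio_threshold ->
  slope_bound < Rabs (sl r) /\ (0 < sl r -> 0 < psi' r) /\ (sl r < 0 -> psi' r < 0).
Proof.
  intros Hr Hpsi. destruct (Hpos r Hr) as [Hg Hpoh].
  assert (Hf := Hfar r ltac:(lra)).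
  assert (Hsl := slope_large r (g r) (p r) Hf Hg Hpoh Hpsi).
  destruct (height_le r (g r) Hf Hpsi) as [_ [Hh _]].
  destruct Hf as [Hr1 [_ [_ [_ [H5 _]]]]].
  assert (Hh0 : 0 < height (g r)) by apply Rpower_gt0.
  assert (Hp := Rpower_gt0 r (sg / 2)).
  assert (Hsmall : 0 < sg / (2 * r) * height (g r) < slope_rate).
  { assert (0 < sg / (2 * r)) by (apply Rdiv_lt_0_compat; lra). split; [nra|].
    apply: Rle_lt_trans H5.
    replace (sg * sqrt ratio_threshold / (2 * r)) with (sg / (2 * r) * sqrt ratio_threshold)
      by (field; lra). nra. }
  fold (sl r) in Hsl. split; [exact Hsl|]. unfold psi'; fold (sl r).
  unfold slope_rate in Hsmall. split; intros Hs.
  - apply Rmult_lt_0_compat; [exact Hp|]. nra.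
  - rewrite Rabs_left // in Hsl.
    assert (sg / (2 * r) * height (g r) + (1 - q) / 2 * sl r < 0) by nra. nra.
Qed.

(** An interior minimum would be a critical point of [psi] below the threshold, where [psi'] cannot
    vanish. *)
Lemma psi_no_interior_min x y : R1 <= x -> x < y -> y < z ->
  (exists t, x <= t <= y /\ psi t < psi x) -> (exists t, x <= t <= y /\ psi t < psi y) ->
  Rmin (psi x) (psi y) <= sqrt ratio_threshold -> False.
Proof.
  intros Hx Hxy Hy H1 H2 Hmin.
  destruct (interior_min psi psi' x y) as [t [Ht [H0 Hle]]]; try easy.
  { intros t Ht; apply psi_derive; lra. }
  assert (Hpt : psi t <= sqrt ratio_threshold).
  { apply: Rle_trans Hmin. apply Rmin_glb; apply Hle; lra. }
  destruct (psi_derive_sign t ltac:(lra) Hpt) as [A [B C]].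
  assert (Hb := slope_bound_pos).
  destruct (Rtotal_order (sl t) 0) as [H|[H|H]].
  - specialize (C H); lra.
  - rewrite H Rabs_R0 in A; lra.
  - specialize (B H); lra.
Qed.

(** Once decreasing below the threshold, [psi] keeps decreasing, as turning back would create an
    interior minimum. The height, at most [sqrt ratio_threshold], then falls at a rate of at least
    [slope_rate] and must stay positive up to [z]. *)
Lemma extent_after r : R1 <= r < z -> psi r <= sqrt ratio_threshold -> sl r < 0 ->
  z - r <= sqrt ratio_threshold / slope_rate + 1.
Proof.
  intros Hr Hpsi Hsl.
  assert (Hrate := slope_rate_pos).
  destruct (psi_derive_sign r Hr Hpsi) as [_ [_ Hneg]]. specialize (Hneg Hsl).
  assert (Hlow : forall s, r < s < z -> exists t, r <= t <= s /\ psi t < psi r).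
  { intros s Hs. destruct (derive_neg_lower_right psi r s (psi' r)) as [t [Ht Hpt]];
      [lra|apply psi_derive, Hr|exact Hneg|]. exists t; split; [lra|exact Hpt]. }
  assert (Hdec : forall s, r <= s < z -> psi s <= psi r).
  { intros s Hs. apply Rnot_lt_le; intros Hlt.
    destruct (Req_dec r s) as [->|Hne]; [lra|].
    destruct (Hlow s ltac:(lra)) as [t [Ht Hpt]].
    apply (psi_no_interior_min r s); try lra; [by exists t| |].
    - exists t; split; [exact Ht|lra].
    - apply: Rle_trans (Rmin_l _ _) Hpsi. }
  assert (Hslope : forall s, r <= s < z -> sl s <= - slope_bound).
  { intros s Hs. assert (Hd1 := Hdec s Hs).
    destruct (psi_derive_sign s ltac:(lra) ltac:(lra)) as [A [B _]].
    destruct (Rle_dec (sl s) 0) as [Hn|Hn].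
    - rewrite Rabs_left1 // in A; lra.
    - exfalso. destruct (Req_dec r s) as [->|Hne]; [lra|].
      specialize (B ltac:(lra)).
      apply (psi_no_interior_min r s); try lra; [apply Hlow; lra| |].
      + destruct (derive_pos_lower_left psi r s (psi' s)) as [t [Ht Hpt]];
          [lra|apply psi_derive; lra|exact B|]. exists t; split; [lra|exact Hpt].
      + apply: Rle_trans (Rmin_l _ _) Hpsi. }
  apply Rnot_lt_le; intros Hlong.
  set (s := r + (sqrt ratio_threshold / slope_rate + 1)).
  assert (Hq0 : 0 <= sqrt ratio_threshold / slope_rate)
    by (apply Rdiv_le_0_compat; [apply sqrt_pos|lra]).
  destruct (derive_between (fun r => height (g r)) (fun r => (1 - q) / 2 * sl r) r s)
    as [t [Ht Heq]].
  { unfold s; lra. }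
  { intros t Ht. unfold s in Ht. apply is_derive_height; [apply Hpos; lra|apply Hode; lra]. }
  unfold s in Ht. specialize (Hslope t ltac:(lra)).
  destruct (height_le r (g r) (Hfar r ltac:(lra)) Hpsi) as [_ [Hh _]].
  assert (Hhs : 0 < height (g s)) by apply Rpower_gt0.
  replace (s - r) with (sqrt ratio_threshold / slope_rate + 1) in Heq by (unfold s; ring).
  assert ((1 - q) / 2 * sl t <= - slope_rate) by (unfold slope_rate; nra).
  assert (slope_rate * (sqrt ratio_threshold / slope_rate) = sqrt ratio_threshold)
    by (field; lra).
  nra.
Qed.

(** The mirror image of [extent_after], following the solution backwards to [R1]. *)
Lemma extent_before r : R1 <= r < z -> psi r <= sqrt ratio_threshold -> 0 < sl r ->
  r - R1 <= sqrt ratio_threshold / slope_rate + 1.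
Proof.
  intros Hr Hpsi Hsl.
  assert (Hrate := slope_rate_pos).
  destruct (psi_derive_sign r Hr Hpsi) as [_ [Hneg _]]. specialize (Hneg Hsl).
  assert (Hlow : forall s, R1 <= s < r -> exists t, s <= t <= r /\ psi t < psi r).
  { intros s Hs. destruct (derive_pos_lower_left psi s r (psi' r)) as [t [Ht Hpt]];
      [lra|apply psi_derive, Hr|exact Hneg|]. exists t; split; [lra|exact Hpt]. }
  assert (Hdec : forall s, R1 <= s <= r -> psi s <= psi r).
  { intros s Hs. apply Rnot_lt_le; intros Hlt.
    destruct (Req_dec r s) as [->|Hne]; [lra|].
    destruct (Hlow s ltac:(lra)) as [t [Ht Hpt]].
    apply (psi_no_interior_min s r); try lra; [|by exists t|].
    - exists t; split; [exact Ht|lra].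
    - apply: Rle_trans (Rmin_r _ _) Hpsi. }
  assert (Hslope : forall s, R1 <= s <= r -> slope_bound <= sl s).
  { intros s Hs. assert (Hd1 := Hdec s Hs).
    destruct (psi_derive_sign s ltac:(lra) ltac:(lra)) as [A [_ B]].
    destruct (Rle_dec 0 (sl s)) as [Hn|Hn].
    - rewrite Rabs_pos_eq // in A; lra.
    - exfalso. destruct (Req_dec r s) as [->|Hne]; [lra|].
      specialize (B ltac:(lra)).
      apply (psi_no_interior_min s r); try lra; [|apply Hlow; lra|].
      + destruct (derive_neg_lower_right psi s r (psi' s)) as [t [Ht Hpt]];
          [lra|apply psi_derive; lra|exact B|]. exists t; split; [lra|exact Hpt].
      + apply: Rle_trans (Rmin_r _ _) Hpsi. }
  apply Rnot_lt_le; intros Hlong.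
  set (s := r - (sqrt ratio_threshold / slope_rate + 1)).
  assert (Hq0 : 0 <= sqrt ratio_threshold / slope_rate)
    by (apply Rdiv_le_0_compat; [apply sqrt_pos|lra]).
  destruct (derive_between (fun r => height (g r)) (fun r => (1 - q) / 2 * sl r) s r)
    as [t [Ht Heq]].
  { unfold s; lra. }
  { intros t Ht. unfold s in Ht. apply is_derive_height; [apply Hpos; lra|apply Hode; lra]. }
  unfold s in Ht. specialize (Hslope t ltac:(lra)).
  destruct (height_le r (g r) (Hfar r ltac:(lra)) Hpsi) as [_ [Hh _]].
  assert (Hhs : 0 < height (g s)) by apply Rpower_gt0.
  replace (r - s) with (sqrt ratio_threshold / slope_rate + 1) in Heq by (unfold s; ring).
  assert (slope_rate <= (1 - q) / 2 * sl t) by (unfold slope_rate; nra).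
  assert (slope_rate * (sqrt ratio_threshold / slope_rate) = sqrt ratio_threshold)
    by (field; lra).
  nra.
Qed.

(** A window of length 9, longer than the 8 that [oscillation] allows, with the length
    [sqrt ratio_threshold / slope_rate + 1] of the two preceding lemmas on either side. *)
Definition max_extent : R := 2 * (sqrt ratio_threshold / slope_rate) + 11.

(** If [psi] comes down to the threshold inside the window, the sign of the slope there bounds the
    extent after or before that point; otherwise the whole window is oscillatory. *)
Lemma positive_energy_extent : z <= R1 + max_extent.
Proof.
  apply Rnot_lt_le; intros Hlong. unfold max_extent in Hlong.
  set (C := sqrt ratio_threshold / slope_rate) in *.
  assert (HC : 0 <= C) by (apply Rdiv_le_0_compat; [apply sqrt_pos|apply slope_rate_pos]).
  assert (HR := radius_ge1 R1 ltac:(lra)).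
  destruct (classic (exists r, R1 + C + 1 < r < R1 + C + 10 /\ psi r <= sqrt ratio_threshold))
    as [[r [Hr Hpsi]]|Hno].
  - destruct (psi_derive_sign r ltac:(lra) Hpsi) as [A _].
    assert (Hb := slope_bound_pos).
    destruct (Rtotal_order (sl r) 0) as [H|[H|H]].
    + assert (H1 := extent_after r ltac:(lra) Hpsi H). fold C in H1; lra.
    + rewrite H Rabs_R0 in A; lra.
    + assert (H1 := extent_before r ltac:(lra) Hpsi H). fold C in H1; lra.
  - assert (Ho : R1 + C + 10 - (R1 + C + 1) <= 8); [|lra].
    apply (oscillation d sg ((1 - q) / (q + 3)) _ _ g p
      (fun r => acceleration q sg d c r (g r) (p r))); [lra|].
    intros r Hr. destruct (Hpos r ltac:(lra)) as [Hg _].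
    destruct (Hode r ltac:(lra)) as [Hdg Hdp].
    destruct (Hfar r ltac:(lra)) as [Hr1 [Hrs [H3 _]]].
    split; [exact Hg|split; [exact Hdg|split; [exact Hdp|split]]].
    + assert (Hbig : sqrt ratio_threshold < psi r).
      { apply Rnot_le_lt; intros Hn; apply Hno; exists r; split; [lra|exact Hn]. }
      assert (Hsq : ratio_threshold < rpow r sg * height (g r) ^ 2).
      { rewrite -scaled_height_sq; [|lra]. fold (psi r).
        rewrite -(pow2_sqrt ratio_threshold); [|apply Rlt_le, ratio_threshold_pos].
        generalize (sqrt_pos ratio_threshold). nra. }
      assert (Hgq : rpow (g r) q * height (g r) ^ 2 = g r).
      { rewrite rpow_pos // /height /= Rmult_1_r -!Rpower_plus.
        rewrite -{2}(Rpower_1 (g r)) //. f_equal; field. }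
      unfold acceleration, reaction.
      assert (Hgqp : 0 < rpow (g r) q) by (rewrite rpow_pos //; apply Rpower_gt0).
      assert (Hcmp : ratio_threshold * rpow (g r) q <= rpow r sg * g r).
      { rewrite -{2}Hgq. nra. }
      (* Above the threshold the absorption uses up at most the fraction [2 (q + 1) / (q + 3)] of
         [r^sg g] and leaves [(1 - q) / (q + 3)]. *)
      assert (Hcq : c * rpow (g r) q <= 2 * (q + 1) / (q + 3) * (rpow r sg * g r)).
      { replace (c * rpow (g r) q)
          with (2 * (q + 1) / (q + 3) * (ratio_threshold * rpow (g r) q))
          by (unfold ratio_threshold; field; lra).
        apply Rmult_le_compat_l; [apply Rdiv_le_0_compat; lra|exact Hcmp]. }
      replace (- ((1 - q) / (q + 3)) * rpow r sg * g r) with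
        (2 * (q + 1) / (q + 3) * (rpow r sg * g r) - rpow r sg * g r) by (field; lra).
      lra.
    + apply: Rle_trans H3. apply Rplus_le_compat_l.
      apply Rle_div_l; [nra|].
      replace (d ^ 2 / 2 * (2 * r ^ 2)) with (d ^ 2 * r ^ 2) by field.
      rewrite -{1}(Rmult_1_r (d ^ 2)). apply Rmult_le_compat_l; nra.
Qed.

End Extent.

End Pohozaev.

(** * Behaviour of exact solutions *)

Lemma at_right_interval u v : u < v -> at_right u (fun x => u < x < v).
Proof.
  intros H. exists (mkposreal (v - u) ltac:(lra)). intros y Hy Huy.
  change (Rabs (y - u) < v - u) in Hy. apply Rabs_lt_between in Hy. lra.
Qed.

Lemma at_left_interval u v : u < v -> at_left v (fun x => u < x < v).
Proof.
  intros H. exists (mkposreal (v - u) ltac:(lra)). intros y Hy Huy.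
  change (Rabs (y - v) < v - u) in Hy. apply Rabs_lt_between in Hy. lra.
Qed.

Lemma filterlim_at_right_id u : filterlim (fun x : R => x) (at_right u) (locally u).
Proof. intros P HP. unfold filtermap. apply: filter_imp HP; auto. Qed.

Lemma filterlim_at_left_id u : filterlim (fun x : R => x) (at_left u) (locally u).
Proof. intros P HP. unfold filtermap. apply: filter_imp HP; auto. Qed.

Lemma continuous_at_right (f : R -> R) x : continuous f x ->
  filterlim f (at_right x) (locally (f x)).
Proof. intros H; apply (lim_comp f); [exact H|apply filterlim_at_right_id]. Qed.

Lemma continuous_at_left (f : R -> R) x : continuous f x ->
  filterlim f (at_left x) (locally (f x)).
Proof. intros H; apply (lim_comp f); [exact H|apply filterlim_at_left_id]. Qed.

Section ExactSolution.

Variables (q sg d c r0 a T B : R) (g p : R -> R).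
Hypotheses (HT : 0 < T) (Hsol : exact_solution q sg d c r0 a T B g p).

Lemma exact_solution_at_0 : g 0 = a.
Proof.
  destruct (proj1 Hsol 0 ltac:(lra)) as [_ [_ H]].
  replace (B * 0 ^ 2) with 0 in H by ring. apply Rabs_le_between in H; lra.
Qed.

Lemma exact_solution_start_lim :
  filterlim g (at_right 0) (locally a) /\ filterlim p (at_right 0) (locally 0).
Proof.
  assert (Hid := filterlim_at_right_id 0). split.
  - apply (lim_squeeze _ (fun s => B * (s * s))).
    + apply: filter_imp (at_right_interval 0 T HT) => s Hs.
      destruct (proj1 Hsol s ltac:(lra)) as [_ [_ H]]. simpl in H. lra.
    + replace 0 with (B * (0 * 0)) at 2 by ring.
      apply lim_mult; [apply lim_const|apply lim_mult; exact Hid].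
  - apply (lim_squeeze _ (fun s => B * s)).
    + apply: filter_imp (at_right_interval 0 T HT) => s Hs.
      destruct (proj1 Hsol s ltac:(lra)) as [_ [H _]]. by rewrite Rminus_0_r.
    + replace 0 with (B * 0) at 2 by ring. apply lim_mult; [apply lim_const|exact Hid].
Qed.

Lemma exact_solution_pos_near_start : 0 < a -> exists e, 0 < e < T /\
  forall s, 0 < s <= e -> 0 < g s.
Proof.
  intros Ha. destruct exact_solution_start_lim as [Hg _].
  assert (Ha2 : 0 < a) by exact Ha.
  destruct (filter_and _ _ (at_right_interval 0 T HT)
    (proj1 (lim_eps (at_right 0) g a) Hg a Ha2)) as [eta Heta].
  exists (Rmin (eta / 2) (T / 2)).
  assert (H1 := Rmin_l (eta / 2) (T / 2)). assert (H2 := Rmin_r (eta / 2) (T / 2)).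
  assert (He := cond_pos eta).
  split; [split; [apply Rmin_glb_lt; lra|lra]|].
  intros s Hs. destruct (Heta s) as [_ H].
  - change (Rabs (s - 0) < eta). rewrite Rminus_0_r Rabs_pos_eq; lra.
  - lra.
  - apply Rabs_lt_between in H; lra.
Qed.

Lemma exact_solution_continuous s : 0 < s < T -> continuous g s /\ continuous p s.
Proof.
  intros Hs. destruct (proj2 Hsol s Hs) as [H1 H2].
  split; eapply is_derive_continuous; eassumption.
Qed.

Lemma exact_solution_first_zero e s :
  (forall x, 0 < x <= e -> 0 < g x) -> 0 < e -> 0 < s < T -> g s <= 0 ->
  exists z, e < z <= s /\ g z = 0 /\ forall x, 0 < x < z -> 0 < g x.
Proof.
  intros He He0 Hs Hgs.
  assert (Hes : e < s) by (apply Rnot_le_lt; intros H; specialize (He s ltac:(lra)); lra).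
  destruct (first_zero g e s) as [z [Hz [Hgz Hpos]]]; try lra.
  - intros x Hx. apply exact_solution_continuous; lra.
  - apply He; lra.
  - exists z. split; [exact Hz|split; [exact Hgz|]]. intros x Hx.
    destruct (Rle_dec x e); [apply He; lra|apply Hpos; lra].
Qed.

Lemma exact_solution_ode_on :
  ode_on q sg d c (fun r => g (r - r0)) (fun r => p (r - r0)) r0 (r0 + T).
Proof.
  intros r Hr. destruct (proj2 Hsol (r - r0) ltac:(lra)) as [H1 H2].
  replace (r0 + (r - r0)) with r in H2 by ring.
  assert (Hsh : is_derive (fun r => r - r0) r 1) by (auto_derive; [easy|ring]).
  split.
  - replace (p (r - r0)) with (1 * p (r - r0)) by ring.
    exact (is_derive_comp g (fun r => r - r0) r _ _ H1 Hsh).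
  - rewrite -(Rmult_1_l (acceleration _ _ _ _ _ _ _)).
    exact (is_derive_comp p (fun r => r - r0) r _ _ H2 Hsh).
Qed.

End ExactSolution.

(** The absorption is homogeneous of degree [q] and all other terms are linear; this carries a
    solution found for a smaller coefficient back to the given one. *)
Lemma exact_solution_scale q sg d c r0 a T B g p A : 0 < A ->
  exact_solution q sg d c r0 a T B g p ->
  exact_solution q sg d (c * Rpower A (1 - q)) r0 (A * a) T (A * B)
    (fun s => A * g s) (fun s => A * p s).
Proof.
  intros HA [Hb Hd]. split.
  - intros s Hs. destruct (Hb s Hs) as [H1 [H2 H3]].
    replace (A * g s - A * a) with (A * (g s - a)) by ring.
    rewrite !Rabs_mult !(Rabs_pos_eq A); try lra.
    rewrite !Rmult_assoc. repeat split; apply Rmult_le_compat_l; lra.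
  - intros s Hs. destruct (Hd s Hs) as [H1 H2]. split.
    + exact (is_derive_scal g s A _ H1).
    + replace (acceleration q sg d (c * Rpower A (1 - q)) (r0 + s) (A * g s) (A * p s))
        with (A * acceleration q sg d c (r0 + s) (g s) (p s)).
      * exact (is_derive_scal p s A _ H2).
      * unfold acceleration, reaction.
        assert (Hr : rpow (A * g s) q = Rpower A q * rpow (g s) q).
        { destruct (Rlt_dec 0 (g s)) as [Hg|Hg].
          - rewrite !rpow_pos; [|easy|nra]. by rewrite Rpower_mult_distr.
          - rewrite !rpow_npos; [ring|lra|nra]. }
        rewrite Hr.
        replace (c * Rpower A (1 - q) * (Rpower A q * rpow (g s) q))
          with (c * (Rpower A (1 - q) * Rpower A q) * rpow (g s) q) by ring.
        rewrite -Rpower_plus. replace (1 - q + q) with 1 by ring.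
        rewrite Rpower_1 //. unfold Rdiv. ring.
Qed.

(* A solution starting from rest far out, below the equilibrium [c y^q = r^sg y], has
   negative Pohozaev energy, which decreases, while it is nonnegative at a zero. *)
Lemma exact_solution_pos_of_far q sg d c X dl T B g p :
  0 < q < 1 -> 0 < sg -> 3 <= d -> 0 < c -> 0 < T -> 0 < dl ->
  (forall r, X <= r -> far q sg d c r) ->
  rpow X sg * dl <= c * rpow dl q ->
  exact_solution q sg d c X dl T B g p -> forall s, 0 < s < T -> 0 < g s.
Proof.
  intros Hq Hsg Hd Hc HT Hdl Hfar Heq Hsol s Hs. apply Rnot_le_lt; intros Hgs.
  destruct (exact_solution_pos_near_start _ _ _ _ _ _ _ _ _ _ HT Hsol Hdl) as [e [He Hpe]].
  destruct (exact_solution_first_zero _ _ _ _ _ _ _ _ _ _ Hsol e s Hpe)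
    as [z [Hz [Hgz Hpos]]]; try lra.
  set (G := fun r => g (r - X)). set (P := fun r => p (r - X)).
  assert (Hode := exact_solution_ode_on _ _ _ _ _ _ _ _ _ _ Hsol). fold G P in Hode.
  set (F := fun r => pohozaev q sg d c r (G r) (P r)).
  assert (HX : 1 <= X) by (apply (Hfar X); lra).
  assert (Hdec : forall x y, X < x -> x <= y -> y < X + z -> F y <= F x).
  { apply (nonincreasing_of_derive F (fun r => - (Rpower r (pohozaev_exponent q d) / r
      * G r ^ 2 * pohozaev_rate q sg d r))).
    intros r Hr. destruct (Hode r ltac:(lra)) as [H1 H2]. split.
    - apply is_derive_pohozaev; try easy; try lra. apply Hpos; lra.
    - destruct (Hfar r ltac:(lra)) as [_ [_ [_ [_ [_ [Hrate _]]]]]].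
      assert (0 <= Rpower r (pohozaev_exponent q d) / r * G r ^ 2).
      { apply Rmult_le_pos; [|apply pow2_ge_0].
        apply Rdiv_le_0_compat; [apply Rlt_le, Rpower_gt0|lra]. }
      nra. }
  destruct (exact_solution_start_lim _ _ _ _ _ _ _ _ _ _ HT Hsol) as [Hg0 Hp0].
  assert (Hsh : filterlim (fun r => r - X) (at_right X) (at_right 0)).
  { intros Q [eta HQ]. exists eta. intros y Hy Hxy. apply HQ; [|lra].
    change (Rabs (y - X - 0) < eta). change (Rabs (y - X) < eta) in Hy.
    by rewrite Rminus_0_r. }
  assert (HF0 : filterlim F (at_right X) (locally (pohozaev q sg d c X dl 0))).
  { apply lim_pohozaev; try lra; try typeclasses eauto.
    - apply filterlim_at_right_id.
    - exact (filterlim_comp _ _ _ _ _ _ _ _ Hsh Hg0).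
    - exact (filterlim_comp _ _ _ _ _ _ _ _ Hsh Hp0). }
  destruct (exact_solution_continuous _ _ _ _ _ _ _ _ _ _ Hsol z ltac:(lra)) as [Cg Cp].
  assert (HFz : filterlim F (at_left (X + z)) (locally (pohozaev q sg d c (X + z) 0 (p z)))).
  { apply lim_pohozaev; try lra; try typeclasses eauto.
    - apply filterlim_at_left_id.
    - rewrite -Hgz. apply (lim_comp g); [exact Cg|].
      replace z with (X + z - X) at 2 by ring.
      apply lim_minus; [apply filterlim_at_left_id|apply lim_const].
    - apply (lim_comp p); [exact Cp|].
      replace z with (X + z - X) at 2 by ring.
      apply lim_minus; [apply filterlim_at_left_id|apply lim_const]. }
  assert (H1 := nonincreasing_le_right_limit F _ _ _ Hdec HF0 (X + z / 2) ltac:(lra)).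
  assert (H2 := nonincreasing_ge_left_limit F _ _ _ Hdec HFz (X + z / 2) ltac:(lra)).
  assert (H3 := pohozaev_ge0_at_zero q sg d c (X + z) (p z)).
  assert (H4 : pohozaev q sg d c X dl 0 < 0); [|lra].
  destruct (Hfar X ltac:(lra)) as [_ [_ [_ [_ [_ [_ Hk]]]]]].
  unfold pohozaev. assert (Hp := Rpower_gt0 X (pohozaev_exponent q d)).
  assert (Hden : pohozaev_density q sg d c X dl 0 < 0); [|nra].
  unfold pohozaev_density.
  set (ka := pohozaev_kappa q d) in *. set (rs := rpow X sg) in *.
  assert (Hka : 0 < ka) by (apply pohozaev_kappa_pos; assumption).
  assert (A1 : rs * dl ^ 2 / (q + 1) <= c / (q + 1) * (dl * rpow dl q)).
  { replace (rs * dl ^ 2 / (q + 1)) with (/ (q + 1) * dl * (rs * dl)) by (field; lra).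
    replace (c / (q + 1) * (dl * rpow dl q)) with (/ (q + 1) * dl * (c * rpow dl q))
      by (field; lra).
    apply Rmult_le_compat_l; [|exact Heq].
    apply Rmult_le_pos; [apply Rlt_le, Rinv_0_lt_compat; lra|lra]. }
  assert (A2 : ka * dl ^ 2 / X ^ 2 <= ka * dl ^ 2).
  { apply Rle_div_l; [nra|]. rewrite -{1}(Rmult_1_r (ka * dl ^ 2)).
    apply Rmult_le_compat_l; nra. }
  (* The potential part is negative because [1 / 2 < 1 / (q + 1)]; by the last condition of [far]
     this gap outweighs [kappa]. *)
  assert (A3 : rs * dl ^ 2 / 2 - rs * dl ^ 2 / (q + 1)
    = - (rs * ((1 - q) / (2 * (q + 1)))) * dl ^ 2) by (field; lra).
  assert (A4 : ka * dl ^ 2 < rs * ((1 - q) / (2 * (q + 1))) * dl ^ 2).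
  { apply Rmult_lt_compat_r; [nra|exact Hk]. }
  replace (0 ^ 2 / 2) with 0 by field.
  replace (pohozaev_beta q d * dl * 0 / X) with 0 by (field; lra).
  lra.
Qed.

(** * Integrating factor, linear limit equation and lower barrier *)

Lemma lim_weighted_velocity (d r0 : R) (f : R -> R) : 0 < d -> 0 <= r0 ->
  filterlim f (at_right 0) (locally 0) ->
  filterlim (fun s => Rpower (r0 + s) d * f s) (at_right 0) (locally 0).
Proof.
  intros Hd Hr0 Hf.
  (* [r0 = 0] is allowed, and at radius 0 it is [rpow], not [Rpower], that is continuous. *)
  apply (filterlim_ext_loc (fun s => rpow (r0 + s) d * f s)).
  - apply: filter_imp (at_right_interval 0 1 Rlt_0_1) => s Hs. rewrite rpow_pos //; lra.
  - replace 0 with (rpow (r0 + 0) d * 0) at 2 by ring.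
    apply lim_mult; [|exact Hf].
    apply (lim_comp (fun x => rpow x d)); [apply continuous_rpow, Hd|].
    apply lim_plus; [apply lim_const|apply filterlim_at_right_id].
Qed.

(** The integrating factor [r^d] removes the friction. *)
Lemma is_derive_weighted (d r0 : R) (f : R -> R) s l : 0 < r0 + s -> is_derive f s l ->
  is_derive (fun s => Rpower (r0 + s) d * f s) s
    (Rpower (r0 + s) d * (l + d / (r0 + s) * f s)).
Proof.
  intros Hs Hf.
  assert (H1 : is_derive (fun s => Rpower (r0 + s) d) s (d * Rpower (r0 + s) d / (r0 + s))).
  { rewrite -(Rmult_1_l (_ / _)).
    apply (is_derive_comp (fun x => Rpower x d) (fun s => r0 + s)).
    - by apply is_derive_Rpower_base.
    - auto_derive; [easy|ring]. }
  replace (Rpower (r0 + s) d * (l + d / (r0 + s) * f s)) with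
    (d * Rpower (r0 + s) d / (r0 + s) * f s + Rpower (r0 + s) d * l) by (field; lra).
  exact (is_derive_mult (fun s => Rpower (r0 + s) d) f s _ _ H1 Hf Rmult_comm).
Qed.

(** As long as [g >= 0], the weighted velocity decreases from 0, so [p < 0] and [g] cannot even
    touch 0 without becoming negative. A positive [g] over a length 9 beyond [X] then contradicts
    [oscillation]. *)
Lemma linear_solution_negative q sg d X T' T B g p :
  0 < d -> 1 <= X -> X + 9 <= T' -> T' < T ->
  (forall r, X <= r -> 1 / 2 + d ^ 2 / (2 * r ^ 2) <= rpow r sg) ->
  exact_solution q sg d 0 0 1 T B g p -> exists s, 0 < s < T' /\ g s < 0.
Proof.
  intros Hd HX HT' HT Hosc Hsol. apply NNPP; intros Hno.
  assert (Hge : forall s, 0 < s < T' -> 0 <= g s).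
  { intros s Hs. apply Rnot_lt_le; intros H; apply Hno; by exists s. }
  destruct (exact_solution_pos_near_start q sg d 0 0 1 T B g p) as [e [He Hpe]];
    [lra|exact Hsol|lra|].
  assert (Hacc : forall s, 0 < s -> acceleration q sg d 0 (0 + s) (g s) (p s)
     + d / (0 + s) * p s = - (rpow s sg * g s)).
  { intros s Hs. unfold acceleration, reaction. rewrite Rplus_0_l. ring. }
  set (h := fun s => Rpower (0 + s) d * p s).
  assert (Hh : forall s, 0 < s < T' -> is_derive h s (Rpower s d * - (rpow s sg * g s))).
  { intros s Hs. rewrite -(Hacc s); [|lra].
    replace (Rpower s d) with (Rpower (0 + s) d) by (f_equal; ring).
    apply is_derive_weighted; [lra|apply Hsol; lra]. }
  assert (Hdec : forall x y, 0 < x -> x <= y -> y < T' -> h y <= h x).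
  { apply (nonincreasing_of_derive h (fun s => Rpower s d * - (rpow s sg * g s))).
    intros s Hs. split; [by apply Hh|].
    specialize (Hge s Hs). generalize (Rpower_gt0 s d) (rpow_ge0 s sg).
    intros A1 A2. assert (0 <= rpow s sg * g s) by nra. nra. }
  assert (Hh0 : filterlim h (at_right 0) (locally 0)).
  { apply lim_weighted_velocity; [exact Hd|lra|].
    eapply exact_solution_start_lim; [|exact Hsol]; lra. }
  assert (Hle := nonincreasing_le_right_limit h _ _ _ Hdec Hh0).
  set (e1 := Rmin e 1). assert (He1 : e1 <= e) by apply Rmin_l.
  assert (He2 : e1 <= 1) by apply Rmin_r.
  assert (He0 : 0 < e1) by (apply Rmin_glb_lt; lra).
  assert (Hneg : h e1 < 0).
  { destruct (derive_between h (fun s => Rpower s d * - (rpow s sg * g s)) (e1 / 2) e1)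
      as [x [Hx Hxe]]; [lra|intros x Hx; apply Hh; lra|].
    specialize (Hle (e1 / 2) ltac:(lra)). specialize (Hpe x ltac:(lra)).
    assert (A1 := Rpower_gt0 x d).
    assert (A2 : 0 < rpow x sg) by (rewrite rpow_pos; [apply Rpower_gt0|lra]).
    assert (0 < rpow x sg * g x) by nra.
    assert (0 < Rpower x d * (rpow x sg * g x)) by nra. nra. }
  assert (Hpneg : forall s, e1 <= s < T' -> p s < 0).
  { intros s Hs. specialize (Hdec e1 s ltac:(lra) ltac:(lra) ltac:(lra)).
    unfold h in Hdec at 1. generalize (Rpower_gt0 (0 + s) d). intros A.
    apply Rnot_le_lt; intros Hp. nra. }
  assert (Hpos : forall s, 0 < s < T' -> 0 < g s).
  { intros s Hs. destruct (Rle_dec s e) as [Hse|Hse]; [apply Hpe; lra|].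
    destruct (Rle_lt_or_eq_dec 0 (g s) (Hge s Hs)) as [H|H]; [exact H|exfalso].
    destruct (derive_neg_lower_right g s T' (p s)) as [t [Ht Hgt]];
      [lra|apply Hsol; lra|apply Hpneg; lra|].
    specialize (Hge t ltac:(lra)). lra. }
  assert (Ho : X + 9 - X <= 8); [|lra].
  apply (oscillation d sg 1 _ _ g p (fun s => acceleration q sg d 0 (0 + s) (g s) (p s)));
    [lra|]. intros r Hr.
  destruct (proj2 Hsol r ltac:(lra)) as [H1 H2].
  split; [apply Hpos; lra|split; [exact H1|split; [exact H2|split]]].
  - specialize (Hacc r ltac:(lra)). rewrite (Rplus_0_l r) in Hacc |- *. lra.
  - rewrite Rmult_1_l. apply Hosc; lra.
Qed.

Lemma Rpower_root_mult x y : 0 < x -> y <> 0 -> Rpower (Rpower x (/ y)) y = x.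
Proof. intros Hx Hy. rewrite Rpower_mult Rinv_l // Rpower_1 //. Qed.

Lemma power_dominates_linear q R0 c0 : q < 1 -> 0 < R0 -> 0 < c0 ->
  exists y0, 0 < y0 /\ forall y, 0 < y <= y0 -> R0 * y <= c0 * rpow y q.
Proof.
  intros Hq HR Hc. exists (Rpower (c0 / R0) (/ (1 - q))). split; [apply Rpower_gt0|].
  intros y Hy. rewrite rpow_pos; [|lra].
  assert (H1 : Rpower y (1 - q) <= c0 / R0).
  { rewrite -(Rpower_root_mult (c0 / R0) (1 - q)); [|apply Rdiv_lt_0_compat; lra|lra].
    apply Rle_Rpower_l; [lra|exact Hy]. }
  apply Rle_div_r in H1; [|lra].
  assert (H2 : y = Rpower y (1 - q) * Rpower y q).
  { rewrite -Rpower_plus. replace (1 - q + q) with 1 by ring. rewrite Rpower_1; lra. }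
  rewrite {1}H2. assert (H3 := Rpower_gt0 y q). nra.
Qed.

(* Comparison with the subsolution [k s^(2/(1-q))] of [g'' + d/r g' = c/2 g^q]. *)
Lemma lower_barrier q sg d c X T B :
  0 < q < 1 -> 0 < sg -> 0 < d -> 0 < c -> 0 <= X -> 0 < T -> 0 <= B ->
  exists g0 tau k, 0 < g0 /\ 0 < tau < T /\ 0 < k /\
    forall r0 a g p, 0 <= r0 <= X -> 0 < a <= g0 ->
      exact_solution q sg d c r0 a T B g p ->
      forall s, 0 < s <= tau -> k * Rpower s (2 / (1 - q)) <= g s.
Proof.
  intros Hq Hsg Hd Hc HX HT HB.
  set (kk := 2 / (1 - q)).
  assert (Hkk : 2 < kk) by (apply Rlt_div_r; lra).
  assert (Hkq : kk * q = kk - 2) by (unfold kk; field; lra).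
  set (RX := rpow (X + 1) sg).
  assert (HR : 0 < RX) by (unfold RX; rewrite rpow_pos; [apply Rpower_gt0|lra]).
  destruct (power_dominates_linear q RX (c / 2)) as [g1 [Hg1 Hsmall]]; try lra.
  (* The amplitude for which [w = kp * s^kk] satisfies [w'' + d / s * w' = c / 2 * w^q] exactly. The
     other half of [c] absorbs [r^sg y] for [y <= g1]. *)
  set (kp := Rpower (c / (2 * (kk * (kk - 1 + d)))) (/ (1 - q))).
  assert (Hkp : 0 < kp) by apply Rpower_gt0.
  assert (Hkpq : kp * (kk * (kk - 1 + d)) = c / 2 * Rpower kp q).
  { assert (H1 : Rpower kp (1 - q) = c / (2 * (kk * (kk - 1 + d)))).
    { apply Rpower_root_mult; [|lra]. apply Rdiv_lt_0_compat; [lra|]. nra. }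
    assert (H2 : kp = Rpower kp (1 - q) * Rpower kp q).
    { rewrite -Rpower_plus. replace (1 - q + q) with 1 by ring. rewrite Rpower_1; lra. }
    rewrite {1}H2 H1. field. split; lra. }
  (* On this length [B * s ^ 2 <= g1 / 2]; with a start value of at most [g1 / 2] this keeps [g]
     below [g1]. *)
  set (tau := Rmin (Rmin 1 (T / 2)) (g1 / (2 * (B + 1)))).
  assert (Ht1 : tau <= 1) by (apply: Rle_trans (Rmin_l _ _) _; apply Rmin_l).
  assert (Ht2 : tau <= T / 2) by (apply: Rle_trans (Rmin_l _ _) _; apply Rmin_r).
  assert (Ht3 : tau * (2 * (B + 1)) <= g1) by (apply Rle_div_r; [lra|apply Rmin_r]).
  assert (Ht0 : 0 < tau).
  { repeat apply Rmin_glb_lt; try lra. apply Rdiv_lt_0_compat; lra. }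
  exists (g1 / 2), tau, kp. split; [lra|split; [lra|split; [exact Hkp|]]].
  intros r0 a g p Hr0 Ha Hsol s1 Hs1. apply Rnot_lt_le; intros Hlt.
  assert (Hgle : forall s, 0 < s <= tau -> g s <= g1).
  { intros s Hs. destruct (proj1 Hsol s ltac:(lra)) as [_ [_ H]].
    apply Rabs_le_between in H. assert (B * s ^ 2 <= B * tau) by (apply Rmult_le_compat_l; nra).
    nra. }
  set (w := fun s => kp * Rpower s kk).
  set (w1 := fun s => kp * (kk * Rpower s (kk - 1))).
  set (w2 := fun s => kp * (kk * ((kk - 1) * Rpower s (kk - 2)))).
  assert (Hpow : forall b s, 0 < s -> Rpower s b / s = Rpower s (b - 1)).
  { intros b s Hs. unfold Rminus. rewrite Rpower_plus Rpower_Ropp Rpower_1 //. }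
  assert (Hw : forall s, 0 < s -> is_derive w s (w1 s)).
  { intros s Hs. unfold w1. rewrite -(Hpow kk s Hs).
    apply (is_derive_scal (fun s => Rpower s kk) s kp).
    replace (kk * (Rpower s kk / s)) with (kk * Rpower s kk / s) by (field; lra).
    by apply is_derive_Rpower_base. }
  assert (Hw1 : forall s, 0 < s -> is_derive w1 s (w2 s)).
  { intros s Hs. unfold w2. replace (kk - 2) with (kk - 1 - 1) by ring.
    rewrite -(Hpow (kk - 1) s Hs).
    apply (is_derive_scal (fun s => kk * Rpower s (kk - 1)) s kp).
    apply (is_derive_scal (fun s => Rpower s (kk - 1)) s kk).
    replace ((kk - 1) * (Rpower s (kk - 1) / s)) with ((kk - 1) * Rpower s (kk - 1) / s)
      by (field; lra).
    by apply is_derive_Rpower_base. }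
  destruct (exact_solution_start_lim _ _ _ _ _ _ _ _ _ _ HT Hsol) as [Hg0 Hp0].
  assert (Hpow0 : forall b, 0 < b -> filterlim (fun s => Rpower s b) (at_right 0) (locally 0)).
  { intros b Hb. apply (filterlim_ext_loc (fun s => rpow s b)).
    - apply: filter_imp (at_right_interval 0 1 Rlt_0_1) => s Hs. rewrite rpow_pos //; lra.
    - assert (H := continuous_at_right _ 0 (continuous_rpow b 0 Hb)).
      rewrite (rpow_npos 0 b) in H; [exact H|lra]. }
  assert (HD0 : filterlim (fun s => g s - w s) (at_right 0) (locally a)).
  { replace a with (a - kp * 0) by ring. apply lim_minus; [exact Hg0|].
    apply lim_mult; [apply lim_const|apply Hpow0; lra]. }
  assert (HE0 : filterlim (fun s => w1 s - p s) (at_right 0) (locally 0)).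
  { replace 0 with (kp * (kk * 0) - 0) at 2 by ring. apply lim_minus; [|exact Hp0].
    apply lim_mult; [apply lim_const|]. apply lim_mult; [apply lim_const|apply Hpow0; lra]. }
  assert (Ha0 : 0 < a) by lra.
  destruct (filter_and _ _ (at_right_interval 0 s1 (proj1 Hs1))
    (proj1 (lim_eps (at_right 0) _ a) HD0 a Ha0)) as [eta Heta].
  assert (Hnear : forall s, 0 < s < eta -> 0 < g s - w s /\ s < s1).
  { intros s Hs. destruct (Heta s) as [A1 A2].
    - change (Rabs (s - 0) < eta). rewrite Rminus_0_r Rabs_pos_eq; lra.
    - lra.
    - apply Rabs_lt_between in A2; lra. }
  assert (Hetap := cond_pos eta).
  assert (HDd : forall s, 0 < s < T -> is_derive (fun s => g s - w s) s (p s - w1 s)).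
  { intros s Hs. apply (is_derive_minus g w); [apply Hsol, Hs|apply Hw; lra]. }
  destruct (first_zero (fun s => g s - w s) (eta / 2) s1) as [z [Hz [Hz0 Hzpos]]].
  { destruct (Hnear (eta / 2)); lra. }
  { intros x Hx. eapply is_derive_continuous. apply HDd; lra. }
  { apply Hnear; lra. }
  { unfold w, kk in *; lra. }
  assert (Hpos : forall s, 0 < s < z -> 0 < g s - w s).
  { intros s Hs. destruct (Rlt_dec s (eta / 2)); [apply Hnear; lra|apply Hzpos; lra]. }
  (* Before the first crossing [z] this weighted difference is nonincreasing from 0, so [g - w]
     cannot fall below its initial limit [a > 0]: there is no crossing. *)
  set (h := fun s => Rpower (r0 + s) d * (w1 s - p s)).
  assert (Hh : forall x y, 0 < x -> x <= y -> y < z -> h y <= h x).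
  { apply (nonincreasing_of_derive h (fun s => Rpower (r0 + s) d *
      ((w2 s - acceleration q sg d c (r0 + s) (g s) (p s)) + d / (r0 + s) * (w1 s - p s)))).
    intros s Hs. split.
    - apply (is_derive_weighted d r0 (fun s => w1 s - p s)); [lra|].
      apply (is_derive_minus w1 p); [apply Hw1; lra|apply Hsol; lra].
    - assert (A0 := Rpower_gt0 (r0 + s) d).
      assert (Hws : 0 < w s) by (apply Rmult_lt_0_compat; [exact Hkp|apply Rpower_gt0]).
      specialize (Hpos s Hs). specialize (Hgle s ltac:(lra)).
      assert (A1 : c / 2 * Rpower (g s) q <= reaction q sg c (r0 + s) (g s)).
      { unfold reaction. rewrite (rpow_pos (g s)); [|lra].
        assert (A2 : rpow (r0 + s) sg * g s <= RX * g s).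
        { apply Rmult_le_compat_r; [lra|]. apply rpow_le; lra. }
        specialize (Hsmall (g s) ltac:(lra)). rewrite rpow_pos in Hsmall; lra. }
      assert (A2 : Rpower (w s) q <= Rpower (g s) q) by (apply Rle_Rpower_l; lra).
      assert (A3 : Rpower (w s) q = Rpower kp q * Rpower s (kk - 2)).
      { unfold w. rewrite -Rpower_mult_distr //; [|apply Rpower_gt0].
        by rewrite Rpower_mult Hkq. }
      assert (A4 : w2 s + d / (r0 + s) * w1 s <= kp * (kk * (kk - 1 + d)) * Rpower s (kk - 2)).
      (* As [w1 >= 0], putting [s] for [r0 + s] only enlarges the friction of the barrier, which
         makes the barrier uniform in [r0]. *)
      { assert (A5 : d / (r0 + s) * w1 s <= d / s * w1 s).
        { apply Rmult_le_compat_r.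
          - unfold w1. apply Rmult_le_pos; [lra|].
            apply Rmult_le_pos; [lra|apply Rlt_le, Rpower_gt0].
          - apply Rmult_le_compat_l; [lra|]. apply Rinv_le_contravar; lra. }
        replace (d / s * w1 s) with (d * (kp * (kk * (Rpower s (kk - 1) / s)))) in A5
          by (unfold w1; field; lra).
        rewrite Hpow in A5; [|lra]. replace (kk - 1 - 1) with (kk - 2) in A5 by ring.
        unfold w2. lra. }
      rewrite Hkpq in A4. unfold acceleration.
      assert (c / 2 * (Rpower kp q * Rpower s (kk - 2)) <= c / 2 * Rpower (g s) q).
      { rewrite -A3. apply Rmult_le_compat_l; lra. }
      assert (Hle : w2 s - (reaction q sg c (r0 + s) (g s) - d / (r0 + s) * p s)
        + d / (r0 + s) * (w1 s - p s) <= 0) by lra.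
      nra. }
  assert (Hh0 : filterlim h (at_right 0) (locally 0)).
  { apply lim_weighted_velocity; try lra. exact HE0. }
  assert (Hple : forall s, 0 < s < z -> w1 s - p s <= 0).
  { intros s Hs. assert (A := nonincreasing_le_right_limit h _ _ _ Hh Hh0 s Hs).
    unfold h in A. assert (A0 := Rpower_gt0 (r0 + s) d). apply Rnot_lt_le; intros Hn. nra. }
  assert (Hmono : forall x y, 0 < x -> x <= y -> y < z ->
    - (g y - w y) <= - (g x - w x)).
  { apply (nonincreasing_of_derive (fun s => - (g s - w s)) (fun s => - (p s - w1 s))).
    intros s Hs. split; [|specialize (Hple s Hs); lra].
    apply (is_derive_opp (fun s => g s - w s)), HDd; lra. }
  assert (Hfin : - 0 <= - a); [|lra].
  rewrite -{1}Hz0.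
  apply (lim_le (at_left z) (fun s => - (g s - w s))).
  - apply lim_opp. apply (continuous_at_left (fun s => g s - w s)).
    eapply is_derive_continuous. apply HDd; lra.
  - assert (Hz00 : 0 < z) by lra.
    apply: filter_imp (at_left_interval 0 z Hz00) => s Hs.
    apply (nonincreasing_le_right_limit (fun s => - (g s - w s)) 0 z); try assumption.
    by apply lim_opp.
Qed.

(** * Shooting *)

Lemma Rmax_abs x y : Rmax x y = (x + y + Rabs (x - y)) / 2.
Proof.
  destruct (Rle_dec x y) as [H|H].
  - rewrite Rmax_right // Rabs_left1; lra.
  - rewrite Rmax_left ?Rabs_pos_eq; lra.
Qed.

Lemma Rmin_abs x y : Rmin x y = (x + y - Rabs (x - y)) / 2.
Proof.
  destruct (Rle_dec x y) as [H|H].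
  - rewrite Rmin_left // Rabs_left1; lra.
  - rewrite Rmin_right ?Rabs_pos_eq; lra.
Qed.

Lemma lim_Rmax {T} {F : (T -> Prop) -> Prop} {HF : Filter F} (x y : T -> R) a b :
  filterlim x F (locally a) -> filterlim y F (locally b) ->
  filterlim (fun n => Rmax (x n) (y n)) F (locally (Rmax a b)).
Proof.
  intros Hx Hy. rewrite Rmax_abs.
  apply (filterlim_ext (fun n => (x n + y n + Rabs (x n - y n)) / 2)).
  { intros n; by rewrite Rmax_abs. }
  apply lim_div; [lra| |apply lim_const].
  apply lim_plus; [by apply lim_plus|].
  apply (lim_comp Rabs); [apply continuous_Rabs|by apply lim_minus].
Qed.

Lemma lim_Rmin {T} {F : (T -> Prop) -> Prop} {HF : Filter F} (x y : T -> R) a b :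
  filterlim x F (locally a) -> filterlim y F (locally b) ->
  filterlim (fun n => Rmin (x n) (y n)) F (locally (Rmin a b)).
Proof.
  intros Hx Hy. rewrite Rmin_abs.
  apply (filterlim_ext (fun n => (x n + y n - Rabs (x n - y n)) / 2)).
  { intros n; by rewrite Rmin_abs. }
  apply lim_div; [lra| |apply lim_const].
  apply lim_minus; [by apply lim_plus|].
  apply (lim_comp Rabs); [apply continuous_Rabs|by apply lim_minus].
Qed.

Fixpoint min_upto (f : nat -> R) (n : nat) : R :=
  match n with O => f O | S k => Rmin (min_upto f k) (f (S k)) end.

Lemma min_upto_le f n j : (j <= n)%nat -> min_upto f n <= f j.
Proof.
  induction n as [|n IH]; intros Hj; simpl.
  - replace j with 0%nat by lia. lra.
  - destruct (Nat.eq_dec j (S n)) as [->|Hne]; [apply Rmin_r|].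
    apply: Rle_trans (Rmin_l _ _) _. apply IH; lia.
Qed.

Lemma min_upto_attained f n : exists j, (j <= n)%nat /\ min_upto f n = f j.
Proof.
  induction n as [|n [j [Hj Heq]]]; simpl.
  - by exists 0%nat.
  - destruct (Rle_dec (min_upto f n) (f (S n))) as [H|H].
    + exists j; split; [lia|]. by rewrite Rmin_left.
    + exists (S n); split; [lia|]. rewrite Rmin_right; lra.
Qed.

Lemma min_upto_continuous (f : R -> nat -> R) n t :
  (forall j, continuous (fun t => f t j) t) -> continuous (fun t => min_upto (f t) n) t.
Proof.
  intros Hf. induction n as [|n IH]; simpl; [apply Hf|]. apply lim_Rmin; [exact IH|apply Hf].
Qed.

Lemma lim_inv_S (U : (nat -> Prop) -> Prop) {HU : ProperFilter U} (k : R) :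
  (forall P, eventually P -> U P) -> filterlim (fun n => k / INR (S n)) U (locally 0).
Proof.
  intros Hev.
  assert (H : is_lim_seq (fun n => k * / INR (S n)) (k * 0)).
  { apply (is_lim_seq_scal_l _ k 0). apply -> (is_lim_seq_incr_1 (fun n => / INR n)).
    exact (is_lim_seq_inv _ p_infty is_lim_seq_INR ltac:(easy)). }
  replace 0 with (k * 0) by ring. intros P HP. apply Hev. exact (H P HP).
Qed.

Section Shooting.

Context {U : (nat -> Prop) -> Prop} {HU : ProperFilter U}.
Hypothesis Hultra : forall P, U P \/ U (fun n => ~ P n).
Hypothesis Hfree : forall P, eventually P -> U P.

Variables (q sg d c X T' : R).
Hypotheses (Hq : 0 < q < 1) (Hsg : 0 < sg) (Hd : 3 <= d) (Hc : 0 < c) (HX : 1 <= X)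
  (HT' : 1 <= T').

(** Solutions live on [[0, T)]; the extra length makes the end [T'] of the observed interval an
    interior point. *)
Let T := T' + 1.

(* The shooting parameter [t] runs over [[-X, 2]]: for [t <= 0] the solution starts from
   the small value [dl] at radius [-t], then from the value [t] at the origin, and for
   [t] in [[1, 2]] the coefficient [c] of the absorption decreases from [c] to [0], which by
   scaling amounts to letting the initial value grow to infinity. *)
Definition start_radius (t : R) : R := Rmax 0 (- t).
Definition start_value (dl t : R) : R := Rmax dl (Rmin t 1).
Definition absorption_coef (t : R) : R := c * Rmin 1 (Rmax 0 (2 - t)).

Let B := euler_bound sg c (X + T) 1 T.

Lemma path_bounds dl t : 0 <= dl <= 1 -> - X <= t <= 2 ->
  0 <= start_radius t <= X /\ dl <= start_value dl t <= 1 /\ 0 <= absorption_coef t <= c.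
Proof.
  intros Hdl Ht. unfold start_radius, start_value, absorption_coef. repeat split.
  - apply Rmax_l.
  - apply Rmax_lub; lra.
  - apply Rmax_l.
  - apply Rmax_lub; [lra|apply Rmin_r].
  - apply Rmult_le_pos; [lra|]. apply Rmin_glb; [lra|apply Rmax_l].
  - rewrite -{2}(Rmult_1_r c). apply Rmult_le_compat_l; [lra|apply Rmin_l].
Qed.

Lemma lim_start_radius {S} {F : (S -> Prop) -> Prop} {HF : Filter F} (t : S -> R) t' :
  filterlim t F (locally t') ->
  filterlim (fun n => start_radius (t n)) F (locally (start_radius t')).
Proof. intros Ht. apply lim_Rmax; [apply lim_const|by apply lim_opp]. Qed.

Lemma lim_start_value {S} {F : (S -> Prop) -> Prop} {HF : Filter F} (dl t : S -> R) dl' t' :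
  filterlim dl F (locally dl') -> filterlim t F (locally t') ->
  filterlim (fun n => start_value (dl n) (t n)) F (locally (start_value dl' t')).
Proof.
  intros Hdl Ht. apply lim_Rmax; [exact Hdl|]. apply lim_Rmin; [exact Ht|apply lim_const].
Qed.

Lemma lim_absorption_coef {S} {F : (S -> Prop) -> Prop} {HF : Filter F} (t : S -> R) t' :
  filterlim t F (locally t') ->
  filterlim (fun n => absorption_coef (t n)) F (locally (absorption_coef t')).
Proof.
  intros Ht. apply lim_mult; [apply lim_const|]. apply lim_Rmin; [apply lim_const|].
  apply lim_Rmax; [apply lim_const|]. apply lim_minus; [apply lim_const|exact Ht].
Qed.

Lemma shooting_bound_ge0 : 0 <= B.
Proof.
  unfold B, euler_bound, growth_rate. assert (H := rpow_ge0 (X + T) sg).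
  assert (H1 := exp_pos ((1 + 2 * (c + rpow (X + T) sg)) * T)). nra.
Qed.

Section FixedStartValue.

Variable dl : R.
Hypothesis Hdl : 0 < dl <= 1.

(** The grid contains [T'] as its point number [S n]. *)
Let step (n : nat) : R := T' / INR (S n).
Let grid_value (n : nat) (t : R) (j : nat) : R :=
  fst (euler q sg d (step n) (absorption_coef t) (start_radius t) (start_value dl t) j).

Lemma step_pos n : 0 < step n.
Proof. apply Rdiv_lt_0_compat; [lra|]. apply lt_0_INR; lia. Qed.

Lemma step_lim : filterlim step U (locally 0).
Proof. by apply lim_inv_S. Qed.

Lemma step_end n : INR (S n) * step n = T'.
Proof. unfold step. field. apply not_0_INR; lia. Qed.

Lemma grid_index_step n j : grid_index (step n) (INR j * step n) = j.
Proof.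
  assert (Hs := step_pos n). assert (Hj := pos_INR j).
  apply grid_index_unique; [exact Hs|nra|lra].
Qed.

Lemma grid_point_range n j : (j <= S n)%nat -> 0 <= INR j * step n <= T'.
Proof.
  intros Hj. apply le_INR in Hj. assert (Hs := step_pos n). assert (H0 := pos_INR j).
  rewrite -(step_end n). nra.
Qed.

Lemma euler_limit (t : nat -> R) t' : filterlim t U (locally t') ->
  U (fun n => - X <= t n <= 2) -> - X <= t' <= 2 ->
  exists g p, exact_solution q sg d (absorption_coef t') (start_radius t') (start_value dl t')
      T B g p /\
    forall (s : nat -> R) (s' : R), 0 <= s' <= T' -> U (fun n => 0 <= s n <= T') ->
      filterlim s U (locally s') ->
      filterlim (fun n => grid_value n (t n) (grid_index (step n) (s n))) U (locally (g s')).
Proof.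
  intros Ht Htn Ht'.
  set (st := fun n s => euler q sg d (step n) (absorption_coef (t n)) (start_radius (t n))
    (start_value dl (t n)) (grid_index (step n) s)).
  destruct (approx_solution_limit Hultra q sg d T B (fun n => absorption_coef (t n))
    (fun n => start_radius (t n)) (fun n => start_value dl (t n)) step
    (absorption_coef t') (start_radius t') (start_value dl t')
    (fun n s => fst (st n s)) (fun n s => snd (st n s))) as [g [p [Hsol Hlim]]];
    try lra; try (unfold T; lra).
  - apply shooting_bound_ge0.
  - by apply (path_bounds dl t'); [lra|].
  - by apply lim_absorption_coef.
  - by apply lim_start_radius.
  - apply (lim_start_value (fun _ => dl)); [apply lim_const|exact Ht].
  - exact step_lim.
  - assert (Hle : U (fun n => step n <= 1)).
    { generalize (proj1 (lim_eps U step 0) step_lim 1 Rlt_0_1). apply filter_imp => n Hn.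
      apply Rabs_lt_between in Hn; lra. }
    apply: filter_imp (filter_and _ _ Hle Htn) => n [Hn Htn'].
    assert (Hs := step_pos n).
    destruct (path_bounds dl (t n)) as [Hr [Ha Hcc]]; try lra.
    split; [apply Hr|split; [lra|]].
    apply euler_approx_solution; try lra.
    rewrite Rabs_pos_eq; lra.
  - exists g, p. split; [exact Hsol|].
    intros s s' Hs' Hsn Hs. apply Hlim; [unfold T; lra| |exact Hs].
    apply: filter_imp Hsn => n Hn. unfold T; lra.
Qed.

(** For a closed condition [P]: the positions of chosen grid points satisfying [P] are bounded,
    hence converge along [U], and the limit solution satisfies [P] at their limit. *)
Lemma grid_zero_limit (P : R -> Prop) (t : nat -> R) (g : R -> R) :
  (forall (s : nat -> R) (s' : R), 0 <= s' <= T' -> U (fun n => 0 <= s n <= T') ->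
      filterlim s U (locally s') ->
      filterlim (fun n => grid_value n (t n) (grid_index (step n) (s n))) U (locally (g s'))) ->
  (forall (x : nat -> R) l, U (fun n => P (x n)) -> filterlim x U (locally l) -> P l) ->
  U (fun n => exists j, (j <= S n)%nat /\ P (grid_value n (t n) j)) ->
  exists s', 0 <= s' <= T' /\ P (g s').
Proof.
  intros Hlim HP Hex.
  assert (Hch : forall n, exists j, (exists j, (j <= S n)%nat /\ P (grid_value n (t n) j)) ->
    (j <= S n)%nat /\ P (grid_value n (t n) j)).
  { intros n. destruct (classic (exists j, (j <= S n)%nat /\ P (grid_value n (t n) j)))
      as [[j Hj]|Hn]; [by exists j|]. exists 0%nat; intros H; contradiction. }
  set (j := fun n => proj1_sig (constructive_indefinite_description _ (Hch n))).
  assert (Hj : U (fun n => (j n <= S n)%nat /\ P (grid_value n (t n) (j n)))).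
  { apply: filter_imp Hex => n Hn. unfold j.
    destruct (constructive_indefinite_description _ (Hch n)) as [k Hk]. by apply Hk. }
  set (s := fun n => INR (j n) * step n).
  assert (Hs : U (fun n => 0 <= s n <= T')).
  { apply: filter_imp Hj => n [Hn _]. by apply grid_point_range. }
  assert (Hsl : filterlim s U (locally (@ulim U s))).
  { apply (ulim_correct Hultra _ T'). apply: filter_imp Hs => n Hn. rewrite Rabs_pos_eq; lra. }
  assert (Hs' : 0 <= @ulim U s <= T').
  { split.
    - apply (lim_ge U s); [exact Hsl|]. apply: filter_imp Hs => n Hn; lra.
    - apply (lim_le U s); [exact Hsl|]. apply: filter_imp Hs => n Hn; lra. }
  exists (@ulim U s). split; [exact Hs'|].
  eapply HP; [|exact (Hlim s _ Hs' Hs Hsl)].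
  apply: filter_imp Hj => n [_ Hn]. unfold s. by rewrite grid_index_step.
Qed.

(** For each [n] the intermediate value theorem makes the grid minimum vanish at some [t n]; the
    limit along [U] is then nonnegative and touches 0. *)
Lemma shooting_fixed_start :
  (forall g p, exact_solution q sg d c X dl T B g p -> forall s, 0 < s < T -> 0 < g s) ->
  (forall g p, exact_solution q sg d 0 0 1 T B g p -> exists s, 0 < s < T' /\ g s < 0) ->
  exists t g p, - X <= t <= 2 /\
    exact_solution q sg d (absorption_coef t) (start_radius t) (start_value dl t) T B g p /\
    (forall s, 0 <= s <= T' -> 0 <= g s) /\ exists s, 0 <= s <= T' /\ g s = 0.
Proof.
  intros Hfar Hlin.
  set (m := fun n t => min_upto (grid_value n t) (S n)).
  (* Otherwise nonpositive grid values occur for [U]-almost every [n], and in the limit the solution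
     launched from radius [X] is nonpositive somewhere. *)
  assert (Hfirst : U (fun n => 0 < m n (- X))).
  { destruct (Hultra (fun n => 0 < m n (- X))) as [H|H]; [exact H|exfalso].
    destruct (euler_limit (fun _ => - X) (- X)) as [g [p [Hsol Hlim]]].
    { apply lim_const. } { apply filter_forall; intros _; lra. } { lra. }
    destruct (grid_zero_limit (fun x => x <= 0) (fun _ => - X) g Hlim) as [s [Hs Hgs]].
    - intros x l Hx Hl. by apply (lim_le U x).
    - apply: filter_imp H => n Hn. apply Rnot_lt_le in Hn.
      destruct (min_upto_attained (grid_value n (- X)) (S n)) as [j [Hj Heq]].
      exists j; split; [exact Hj|]. rewrite -Heq; exact Hn.
    - assert (E1 : absorption_coef (- X) = c).
      { unfold absorption_coef. rewrite Rmax_right ?Rmin_left; lra. }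
      assert (E2 : start_radius (- X) = X).
      { unfold start_radius. rewrite Rmax_right; lra. }
      assert (E3 : start_value dl (- X) = dl).
      { unfold start_value. rewrite Rmin_left ?Rmax_left; lra. }
      rewrite E1 E2 E3 in Hsol.
      assert (HTp : 0 < T) by (unfold T; lra).
      destruct (Req_dec s 0) as [->|Hs0].
      + rewrite (exact_solution_at_0 _ _ _ _ _ _ _ _ _ _ HTp Hsol) in Hgs. lra.
      + specialize (Hfar g p Hsol s ltac:(unfold T; lra)). lra. }
  assert (Hlast : U (fun n => m n 2 < 0)).
  { destruct (euler_limit (fun _ => 2) 2) as [g [p [Hsol Hlim]]].
    { apply lim_const. } { apply filter_forall; intros _; lra. } { lra. }
    assert (E1 : absorption_coef 2 = 0).
    { unfold absorption_coef. rewrite Rmax_left ?Rmin_right; lra. }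
    assert (E2 : start_radius 2 = 0).
    { unfold start_radius. rewrite Rmax_left; lra. }
    assert (E3 : start_value dl 2 = 1).
    { unfold start_value. rewrite Rmin_right ?Rmax_right; lra. }
    rewrite E1 E2 E3 in Hsol.
    destruct (Hlin g p Hsol) as [s [Hs Hgs]].
    assert (Hl := Hlim (fun _ => s) s ltac:(lra)
      ltac:(apply filter_forall; intros _; lra) ltac:(apply lim_const)).
    assert (Hgs' : 0 < - g s) by lra.
    generalize (proj1 (lim_eps U _ _) Hl _ Hgs'). apply filter_imp => n Hn.
    apply Rabs_lt_between in Hn. unfold m.
    destruct (grid_index_spec (step n) s (step_pos n) ltac:(lra)) as [Hi _].
    apply: Rle_lt_trans (min_upto_le _ _ (grid_index (step n) s) _) _; [|lra].
    rewrite -(step_end n) in Hs. assert (Hsp := step_pos n).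
    apply INR_le. nra. }
  assert (Hcont : forall n, Ranalysis1.continuity (m n)).
  { intros n t. apply continuity_pt_filterlim. apply min_upto_continuous. intros j.
    assert (Hid : forall t, filterlim (fun x : R => x) (locally t) (locally t))
      by (intros; apply filterlim_id).
    apply (euler_continuous q sg d Hq Hsg ltac:(lra) (step n) absorption_coef start_radius
      (start_value dl) j (step_pos n)).
    - intros x; apply Rmax_l.
    - intros x; by apply lim_absorption_coef.
    - intros x; by apply lim_start_radius.
    - intros x; apply (lim_start_value (fun _ => dl)); [apply lim_const|apply Hid]. }
  assert (Hch : forall n, exists t, - X <= t <= 2 /\
    (0 < m n (- X) /\ m n 2 < 0 -> m n t = 0)).
  { intros n. destruct (classic (0 < m n (- X) /\ m n 2 < 0)) as [[H1 H2]|Hn].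
    - destruct (IVT_gen (m n) (- X) 2 0) as [t [Ht Heq]]; [apply Hcont| |].
      + rewrite Rmin_right ?Rmax_left; lra.
      + rewrite Rmin_left ?Rmax_right in Ht; try lra. by exists t.
    - exists 0. split; [lra|]. intros H; contradiction. }
  set (t := fun n => proj1_sig (constructive_indefinite_description _ (Hch n))).
  assert (Ht : forall n, - X <= t n <= 2 /\ (0 < m n (- X) /\ m n 2 < 0 -> m n (t n) = 0)).
  { intros n. unfold t. by destruct (constructive_indefinite_description _ (Hch n)). }
  assert (Hm : U (fun n => m n (t n) = 0)).
  { apply: filter_imp (filter_and _ _ Hfirst Hlast) => n Hn. by apply Ht. }
  assert (Htl : filterlim t U (locally (@ulim U t))).
  { apply (ulim_correct Hultra _ (X + 2)). apply filter_forall. intros n.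
    destruct (Ht n) as [H _]. apply Rabs_le_between; lra. }
  assert (Ht' : - X <= @ulim U t <= 2).
  { split; [apply (lim_ge U t)|apply (lim_le U t)]; try exact Htl;
      apply filter_forall; intros n; apply Ht. }
  destruct (euler_limit t _ Htl) as [g [p [Hsol Hlim]]];
    [apply filter_forall; intros n; apply Ht|exact Ht'|].
  exists (@ulim U t), g, p. split; [exact Ht'|split; [exact Hsol|split]].
  - intros s Hs.
    apply (lim_ge U (fun n => grid_value n (t n) (grid_index (step n) s))).
    + apply (Hlim (fun _ => s)); [exact Hs|apply filter_forall; intros _; exact Hs|].
      apply lim_const.
    + apply: filter_imp Hm => n Hn. rewrite -Hn. apply min_upto_le.
      destruct (grid_index_spec (step n) s (step_pos n) ltac:(lra)) as [Hi _].
      rewrite -(step_end n) in Hs. assert (Hsp := step_pos n).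
      apply INR_le. nra.
  - apply (grid_zero_limit (fun x => x = 0) t g Hlim).
    + intros x l Hx Hl. apply Rle_antisym.
      * apply (lim_le U x); [exact Hl|]. apply: filter_imp Hx => n ->; lra.
      * apply (lim_ge U x); [exact Hl|]. apply: filter_imp Hx => n ->; lra.
    + apply: filter_imp Hm => n Hn.
      destruct (min_upto_attained (grid_value n (t n)) (S n)) as [j [Hj Heq]].
      exists j; split; [exact Hj|]. rewrite -Heq; exact Hn.
Qed.

End FixedStartValue.

(** Letting [dl] tend to 0 turns lift-off from a small positive value into lift-off from 0, as P3
    demands. What has to be proved is that the limit is not trivial. *)
Lemma shooting_limit :
  (exists dl0, 0 < dl0 <= 1 /\ forall dl, 0 < dl <= dl0 -> forall g p,
     exact_solution q sg d c X dl T B g p -> forall s, 0 < s < T -> 0 < g s) ->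
  (forall g p, exact_solution q sg d 0 0 1 T B g p -> exists s, 0 < s < T' /\ g s < 0) ->
  exists t g p, - X <= t < 2 /\
    exact_solution q sg d (absorption_coef t) (start_radius t) (start_value 0 t) T B g p /\
    (forall s, 0 <= s <= T' -> 0 <= g s) /\
    (exists e, 0 < e < T /\ forall s, 0 < s <= e -> 0 < g s) /\
    exists s, 0 < s <= T' /\ g s = 0.
Proof.
  intros [dl0 [Hdl0 Hfar]] Hlin.
  set (dl := fun n => dl0 / INR (S n)).
  assert (Hdl : forall n, 0 < dl n <= dl0).
  { intros n. assert (H1 : 1 <= INR (S n)) by (rewrite S_INR; generalize (pos_INR n); lra).
    split; [apply Rdiv_lt_0_compat; lra|]. apply Rle_div_l; nra. }
  assert (Hex : forall n, exists tgps : R * (R -> R) * (R -> R) * R,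
    let '(t, g, p, s) := tgps in
    - X <= t <= 2 /\
    exact_solution q sg d (absorption_coef t) (start_radius t) (start_value (dl n) t) T B g p /\
    (forall s, 0 <= s <= T' -> 0 <= g s) /\ 0 <= s <= T' /\ g s = 0).
  { intros n. assert (Hn := Hdl n).
    destruct (shooting_fixed_start (dl n) ltac:(lra)) as [t [g [p [H1 [H2 [H3 [s H4]]]]]]].
    - intros g p. by apply Hfar.
    - exact Hlin.
    - by exists (t, g, p, s). }
  set (D := fun n => proj1_sig (constructive_indefinite_description _ (Hex n))).
  set (t := fun n => fst (fst (fst (D n)))). set (g := fun n => snd (fst (fst (D n)))).
  set (p := fun n => snd (fst (D n))). set (s := fun n => snd (D n)).
  assert (HD : forall n, - X <= t n <= 2 /\
    exact_solution q sg d (absorption_coef (t n)) (start_radius (t n)) (start_value (dl n) (t n))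
      T B (g n) (p n) /\
    (forall x, 0 <= x <= T' -> 0 <= g n x) /\ 0 <= s n <= T' /\ g n (s n) = 0).
  { intros n. unfold t, g, p, s, D.
    destruct (constructive_indefinite_description _ (Hex n)) as [[[[t1 g1] p1] s1] H].
    exact H. }
  assert (Htl : filterlim t U (locally (@ulim U t))).
  { apply (ulim_correct Hultra _ (X + 2)). apply filter_forall. intros n.
    destruct (HD n) as [H _]. apply Rabs_le_between; lra. }
  assert (Hsl : filterlim s U (locally (@ulim U s))).
  { apply (ulim_correct Hultra _ T'). apply filter_forall. intros n.
    destruct (HD n) as [_ [_ [_ [H _]]]]. apply Rabs_le_between; lra. }
  set (t' := @ulim U t) in *. set (s' := @ulim U s) in *.
  assert (Ht' : - X <= t' <= 2).
  { split; [apply (lim_ge U t)|apply (lim_le U t)]; try exact Htl;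
      apply filter_forall; intros n; apply HD. }
  assert (Hs' : 0 <= s' <= T').
  { split; [apply (lim_ge U s)|apply (lim_le U s)]; try exact Hsl;
      apply filter_forall; intros n; apply HD. }
  assert (Hdll : filterlim dl U (locally 0)) by (by apply lim_inv_S).
  assert (HTp : 0 < T) by (unfold T; lra).
  destruct (approx_solution_limit Hultra q sg d T B (fun n => absorption_coef (t n))
    (fun n => start_radius (t n)) (fun n => start_value (dl n) (t n)) (fun _ => 0)
    (absorption_coef t') (start_radius t') (start_value 0 t') g p) as [g' [p' [Hsol Hlim]]];
    try lra.
  { apply shooting_bound_ge0. }
  { apply (path_bounds 0 t'); lra. }
  { by apply lim_absorption_coef. }
  { by apply lim_start_radius. }
  { by apply lim_start_value. }
  { apply lim_const. }
  { apply filter_forall. intros n. destruct (HD n) as [Hn [Hn2 _]].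
    split; [apply Rmax_l|split; [lra|]]. by apply exact_solution_approx. }
  assert (Hnn : forall x, 0 <= x <= T' -> 0 <= g' x).
  { intros x Hx. apply (lim_ge U (fun n => g n x)).
    - apply (Hlim (fun _ => x)); [unfold T; lra| |apply lim_const].
      apply filter_forall; intros _; unfold T; lra.
    - apply filter_forall; intros n. by apply HD. }
  assert (Hzero : g' s' = 0).
  { assert (Hl : filterlim (fun n => g n (s n)) U (locally (g' s'))).
    { apply Hlim; [unfold T; lra| |exact Hsl].
      apply filter_forall; intros n. destruct (HD n) as [_ [_ [_ [H _]]]]. unfold T; lra. }
    apply Rle_antisym.
    - apply (lim_le U _ _ _ Hl), filter_forall. intros n.
      destruct (HD n) as [_ [_ [_ [_ ->]]]]; lra.
    - apply (lim_ge U _ _ _ Hl), filter_forall. intros n.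
      destruct (HD n) as [_ [_ [_ [_ ->]]]]; lra. }
  (* At [t' = 2] the limit would solve the linear equation and become negative. Hence the
     coefficient of the absorption stays positive. *)
  assert (Ht2 : t' < 2).
  { apply Rnot_le_lt; intros Hge. assert (Et : t' = 2) by lra. rewrite Et in Hsol.
    assert (E1 : absorption_coef 2 = 0).
    { unfold absorption_coef. rewrite Rmax_left ?Rmin_right; lra. }
    assert (E2 : start_radius 2 = 0).
    { unfold start_radius. rewrite Rmax_left; lra. }
    assert (E3 : start_value 0 2 = 1).
    { unfold start_value. rewrite Rmin_right ?Rmax_right; lra. }
    rewrite E1 E2 E3 in Hsol. destruct (Hlin g' p' Hsol) as [x [Hx Hgx]].
    specialize (Hnn x ltac:(lra)). lra. }
  exists t', g', p'. split; [lra|split; [exact Hsol|split; [exact Hnn|]]].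
  destruct (Rle_dec t' 0) as [Htneg|Htpos].
  (* Here the limit starts from 0. The barrier, uniform in [n], keeps it from vanishing identically
     and bounds the zeros [s n] below by [tau]. *)
  - destruct (lower_barrier q sg d c X T B) as [g0 [tau [k [Hg0 [Htau [Hk Hbar]]]]]];
      try lra; [apply shooting_bound_ge0|].
    assert (Hval : start_value 0 t' = 0).
    { unfold start_value. rewrite Rmin_left ?Rmax_left; lra. }
    assert (Hsmall : U (fun n => start_value (dl n) (t n) <= g0)).
    { assert (Hl := lim_start_value _ _ _ _ Hdll Htl). rewrite Hval in Hl.
      generalize (proj1 (lim_eps U _ _) Hl g0 Hg0). apply filter_imp => n Hn.
      apply Rabs_lt_between in Hn; lra. }
    (* For these [t n] the coefficient is exactly [c], the one for which the barrier was built. *)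
    assert (Ht1 : U (fun n => t n <= 1)).
    { generalize (proj1 (lim_eps U _ _) Htl 1 Rlt_0_1). apply filter_imp => n Hn.
      apply Rabs_lt_between in Hn; lra. }
    assert (Hlow : U (fun n => forall x, 0 < x <= tau -> k * Rpower x (2 / (1 - q)) <= g n x)).
    { apply: filter_imp (filter_and _ _ Hsmall Ht1) => n [H1 H2].
      destruct (HD n) as [Htn [Hsoln _]]. assert (Hdn := Hdl n).
      destruct (path_bounds (dl n) (t n)) as [Hr [Ha _]]; try lra.
      apply (Hbar (start_radius (t n)) (start_value (dl n) (t n)) _ (p n)); [exact Hr|lra|].
      assert (E : absorption_coef (t n) = c).
      { unfold absorption_coef. rewrite Rmax_right ?Rmin_left; lra. }
      by rewrite E in Hsoln. }
    assert (Hpos : forall x, 0 < x <= tau -> 0 < g' x).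
    { intros x Hx. apply (Rlt_le_trans _ (k * Rpower x (2 / (1 - q)))).
      - apply Rmult_lt_0_compat; [exact Hk|apply Rpower_gt0].
      - apply (lim_ge U (fun n => g n x)).
        + apply (Hlim (fun _ => x)); [lra| |apply lim_const].
          apply filter_forall; intros _; lra.
        + apply: filter_imp Hlow => n Hn. by apply Hn. }
    split; [exists tau; split; [exact Htau|exact Hpos]|].
    exists s'. split; [|exact Hzero]. split; [|lra].
    apply (Rlt_le_trans _ tau); [lra|]. apply (lim_ge U s); [exact Hsl|].
    apply: filter_imp Hlow => n Hn. destruct (HD n) as [Htn [Hsoln [_ [Hsn Hgn]]]].
    apply Rnot_lt_le; intros Hlt. destruct (Req_dec (s n) 0) as [Hs0|Hs0].
    + rewrite Hs0 (exact_solution_at_0 _ _ _ _ _ _ _ _ _ _ HTp Hsoln) in Hgn.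
      assert (Hdn := Hdl n). destruct (path_bounds (dl n) (t n)) as [_ [Ha _]]; lra.
    + specialize (Hn (s n) ltac:(lra)). rewrite Hgn in Hn.
      assert (0 < k * Rpower (s n) (2 / (1 - q)))
        by (apply Rmult_lt_0_compat; [exact Hk|apply Rpower_gt0]). lra.
  - assert (Ha : 0 < start_value 0 t').
    { unfold start_value. apply: Rlt_le_trans (Rmax_r _ _). apply Rmin_glb_lt; lra. }
    split; [exact (exact_solution_pos_near_start _ _ _ _ _ _ _ _ _ _ HTp Hsol Ha)|].
    exists s'. split; [|exact Hzero]. split; [|lra].
    destruct (Req_dec s' 0) as [Hs0|Hs0]; [|lra].
    rewrite Hs0 (exact_solution_at_0 _ _ _ _ _ _ _ _ _ _ HTp Hsol) in Hzero. lra.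
Qed.

End Shooting.

(** * Nonexistence *)

Lemma rpow_rpow x a b : 0 < a -> a * b = 1 -> 0 <= x -> rpow (rpow x a) b = x.
Proof.
  intros Ha Hab Hx. destruct (Req_dec x 0) as [->|Hx0].
  - rewrite (rpow_npos 0); [|lra]. rewrite rpow_npos; lra.
  - rewrite (rpow_pos x); [|lra]. rewrite rpow_pos; [|apply Rpower_gt0].
    rewrite Rpower_mult Hab Rpower_1; lra.
Qed.

(* A nonzero limit of [r^d v] at the origin would make [u] diverge at least
   logarithmically. *)
Lemma velocity_le_linear (d M G rho : R) (u v a : R -> R) :
  1 <= d -> 0 < rho <= 1 -> 0 <= M ->
  (forall r, 0 < r < rho -> is_derive u r (v r) /\ is_derive v r (a r - d / r * v r) /\
     Rabs (a r) <= M /\ - G <= u r) ->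
  forall r, 0 < r < rho -> v r <= M * r.
Proof.
  intros Hd Hrho HM H r0 Hr0. apply Rnot_lt_le; intros Hlt.
  set (h := fun r => Rpower (0 + r) d * v r).
  assert (Hh : forall r, 0 < r < rho -> is_derive h r (Rpower r d * a r)).
  { intros r Hr. destruct (H r Hr) as [_ [Hv _]].
    replace (Rpower r d * a r) with
      (Rpower (0 + r) d * ((a r - d / r * v r) + d / (0 + r) * v r)).
    - by apply is_derive_weighted; [lra|].
    - rewrite Rplus_0_l. ring. }
  set (R0 := Rpower r0 d). assert (HR0 : 0 < R0) by apply Rpower_gt0.
  set (e := R0 * (v r0 - M * r0)).
  assert (He : 0 < e) by (apply Rmult_lt_0_compat; lra).
  (* The derivative [r^d a] is at most [R0 * M] in size, so going back from [r0] the product [r^d v]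
     loses at most [R0 * M * r0]. *)
  assert (Hlow : forall r, 0 < r <= r0 -> e <= Rpower r d * v r).
  { intros r Hr.
    assert (Hhr : h r = Rpower r d * v r) by (unfold h; by rewrite Rplus_0_l).
    assert (Hh0 : h r0 = R0 * v r0) by (unfold h; by rewrite Rplus_0_l).
    rewrite -Hhr. destruct (Req_dec r r0) as [->|Hne].
    - rewrite Hh0. unfold e. assert (0 <= R0 * (M * r0)) by (apply Rmult_le_pos; nra). lra.
    - destruct (derive_between h (fun r => Rpower r d * a r) r r0) as [z [Hz Heq]];
        [lra|intros z Hz; apply Hh; lra|].
      destruct (H z ltac:(lra)) as [_ [_ [Ha _]]]. apply Rabs_le_between in Ha.
      assert (Hzd : 0 < Rpower z d <= R0).
      { split; [apply Rpower_gt0|apply Rle_Rpower_l; lra]. }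
      assert (Rpower z d * a z * (r0 - r) <= R0 * M * r0).
      { apply (Rle_trans _ (R0 * M * (r0 - r))).
        - apply Rmult_le_compat_r; [lra|]. nra.
        - apply Rmult_le_compat_l; nra. }
      unfold e. lra. }
  assert (Hmono : forall x y, 0 < x -> x <= y -> y < r0 ->
    e * ln y - u y <= e * ln x - u x).
  { apply (nonincreasing_of_derive (fun r => e * ln r - u r) (fun r => e * / r - v r)).
    intros r Hr. destruct (H r ltac:(lra)) as [Hu _]. split.
    - apply (is_derive_minus (fun r => e * ln r) u); [|exact Hu].
      apply (is_derive_scal ln r e). auto_derive; lra.
    - specialize (Hlow r ltac:(lra)).
      assert (Hrd : Rpower r d <= r).
      { rewrite -{2}(Rpower_1 r); [|lra].
        replace d with (1 + (d - 1)) by ring. rewrite Rpower_plus.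
        rewrite -{2}(Rmult_1_r (Rpower r 1)).
        apply Rmult_le_compat_l; [apply Rlt_le, Rpower_gt0|].
        apply (Rle_trans _ (Rpower r 0)); [|rewrite Rpower_O; lra].
        unfold Rpower. destruct (Req_dec d 1) as [->|Hd1]; [right; f_equal; ring|].
        apply Rlt_le, exp_increasing.
        assert (ln r < 0) by (rewrite -ln_1; apply ln_increasing; lra).
        nra. }
      assert (Hv : 0 < v r).
      { assert (Hrp := Rpower_gt0 r d). apply Rnot_le_lt; intros Hn. nra. }
      assert (e <= r * v r) by nra.
      assert (e * / r <= v r); [|lra].
      apply (Rmult_le_reg_r r); [lra|]. rewrite Rmult_assoc Rinv_l; lra. }
  (* [x] is taken so close to 0 that the logarithmic estimate forces [u x < - G]. *)
  set (y := r0 / 2). set (K := (e * ln y - u y - G) / e).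
  set (x := Rmin y (exp (K - 1))).
  assert (Hx : 0 < x) by (apply Rmin_glb_lt; [unfold y; lra|apply exp_pos]).
  assert (Hxy : x <= y) by apply Rmin_l.
  assert (Hlx : ln x <= K - 1).
  { rewrite -(ln_exp (K - 1)).
    destruct (Rle_lt_or_eq_dec x (exp (K - 1)) (Rmin_r _ _)) as [Hl| ->]; [|lra].
    apply Rlt_le, ln_increasing; easy. }
  specialize (Hmono x y Hx Hxy ltac:(unfold y; lra)).
  destruct (H x ltac:(unfold y in Hxy; lra)) as [_ [_ [_ Hux]]].
  assert (e * ln x <= e * (K - 1)) by (apply Rmult_le_compat_l; lra).
  assert (e * K = e * ln y - u y - G) by (unfold K; field; lra).
  lra.
Qed.

Section Nonexistence.

Variables (q sg d c : R).
Hypotheses (Hq : 0 < q < 1) (Hsg : 0 < sg) (Hd : 3 <= d) (Hc : 0 < c).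

(** Only continuity of [g] at the origin is given. Applied to [g] and to [- g], [velocity_le_linear]
    yields [p = O(r)], and then the energy is [r^(alpha-2)] times a bounded quantity. *)
Lemma pohozaev_lim_origin (g p : R -> R) g0 eta :
  0 < eta -> ode_on q sg d c g p 0 eta -> (forall r, 0 < r < eta -> 0 < g r) ->
  filterlim g (at_right 0) (locally g0) ->
  filterlim (fun r => pohozaev q sg d c r (g r) (p r)) (at_right 0) (locally 0).
Proof.
  intros Heta Hode Hpos Hg.
  destruct (proj1 (lim_eps (at_right 0) g g0) Hg 1 Rlt_0_1) as [rho1 Hrho1].
  set (rho := Rmin rho1 (Rmin eta 1)). assert (Hr1 := cond_pos rho1).
  assert (Hrho0 : 0 < rho) by (repeat apply Rmin_glb_lt; lra).
  assert (Hrho2 : rho <= rho1) by apply Rmin_l.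
  assert (Hrho3 : rho <= eta) by (apply: Rle_trans (Rmin_r _ _) _; apply Rmin_l).
  assert (Hrho4 : rho <= 1) by (apply: Rle_trans (Rmin_r _ _) _; apply Rmin_r).
  set (G := Rabs g0 + 1).
  assert (HG : forall r, 0 < r < rho -> 0 < g r <= G).
  { intros r Hr. split; [apply Hpos; lra|].
    assert (H : Rabs (g r - g0) < 1).
    { apply Hrho1; [|lra]. change (Rabs (r - 0) < rho1). rewrite Rminus_0_r Rabs_pos_eq; lra. }
    apply Rabs_lt_between in H. generalize (Rle_abs g0). unfold G; lra. }
  set (M := growth_rate sg c 1 * (1 + G)).
  assert (HM : forall r, 0 < r < rho -> Rabs (reaction q sg c r (g r)) <= M).
  { intros r Hr. specialize (HG r Hr).
    apply: Rle_trans (reaction_le q sg Hq Hsg c c r 1 (g r) _ _) _; try lra.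
    apply Rmult_le_compat_l; [|rewrite Rabs_pos_eq; lra].
    unfold growth_rate. generalize (rpow_ge0 1 sg); lra. }
  assert (HM0 : 0 <= M).
  { specialize (HM (rho / 2) ltac:(lra)).
    generalize (Rabs_pos (reaction q sg c (rho / 2) (g (rho / 2)))). lra. }
  assert (Hup : forall r, 0 < r < rho -> p r <= M * r).
  { apply (velocity_le_linear d M 0 rho g p (fun r => reaction q sg c r (g r))); try lra.
    intros r Hr. destruct (Hode r ltac:(lra)) as [H1 H2]. specialize (HG r Hr).
    split; [exact H1|split; [exact H2|split; [by apply HM|lra]]]. }
  assert (Hdown : forall r, 0 < r < rho -> - p r <= M * r).
  { apply (velocity_le_linear d M G rho (fun r => - g r) (fun r => - p r)
      (fun r => - reaction q sg c r (g r))); try lra.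
    intros r Hr. destruct (Hode r ltac:(lra)) as [H1 H2]. specialize (HG r Hr).
    split; [apply (is_derive_opp g), H1|split; [|split; [rewrite Rabs_Ropp; by apply HM|lra]]].
    replace (- reaction q sg c r (g r) - d / r * - p r)
      with (- acceleration q sg d c r (g r) (p r)) by (unfold acceleration; ring).
    apply (is_derive_opp p), H2. }
  assert (Hid := filterlim_at_right_id 0).
  assert (Hp : filterlim p (at_right 0) (locally 0)).
  { apply (lim_squeeze _ (fun r => M * r)).
    - apply: filter_imp (at_right_interval 0 rho Hrho0) => r Hr.
      rewrite Rminus_0_r. apply Rabs_le_between.
      specialize (Hup r Hr). specialize (Hdown r Hr). lra.
    - replace 0 with (M * 0) at 2 by ring. apply lim_mult; [apply lim_const|exact Hid]. }
  set (al := pohozaev_exponent q d).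
  assert (Hal : 2 < al) by (apply pohozaev_exponent_gt2; assumption).
  (* A factor [r^2] is moved into the bracket to clear its denominators; the remaining factor tends
     to 0 because [alpha > 2]. *)
  apply (filterlim_ext_loc (fun r => rpow r (al - 2) * (r * r * (p r * p r) / 2
    - c / (q + 1) * (r * r * (g r * rpow (g r) q)) + rpow r sg * (r * r * (g r * g r)) / 2
    + pohozaev_beta q d * g r * p r * r + pohozaev_kappa q d * (g r * g r)))).
  - apply: filter_imp (at_right_interval 0 rho Hrho0) => r Hr.
    unfold pohozaev, pohozaev_density. fold al.
    assert (E : Rpower r al = rpow r (al - 2) * (r * r)).
    { rewrite rpow_pos; [|lra]. rewrite -{3 4}(Rpower_1 r); [|lra].
      rewrite -!Rpower_plus. f_equal; ring. }
    rewrite E. field; lra.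
  - assert (Hlim0 : rpow 0 (al - 2) * (0 * 0 * (0 * 0) / 2
      - c / (q + 1) * (0 * 0 * (g0 * rpow g0 q)) + rpow 0 sg * (0 * 0 * (g0 * g0)) / 2
      + pohozaev_beta q d * g0 * 0 * 0 + pohozaev_kappa q d * (g0 * g0)) = 0).
    { rewrite (rpow_npos 0 (al - 2)); [ring|lra]. }
    rewrite -{2}Hlim0.
    assert (Hrp : forall b, 0 < b ->
      filterlim (fun r => rpow r b) (at_right 0) (locally (rpow 0 b))).
    { intros b Hb. exact (continuous_at_right (fun r => rpow r b) 0 (continuous_rpow b 0 Hb)). }
    assert (Hgq : filterlim (fun r => rpow (g r) q) (at_right 0) (locally (rpow g0 q))).
    { apply (lim_comp (fun y => rpow y q)); [apply continuous_rpow; lra|exact Hg]. }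
    apply lim_mult; [apply Hrp; lra|].
    apply lim_plus; [apply lim_plus; [apply lim_plus; [apply lim_minus|]|]|].
    + apply lim_div; [lra| |apply lim_const]. repeat apply lim_mult; assumption.
    + repeat apply lim_mult; try assumption; apply lim_const.
    + apply lim_div; [lra| |apply lim_const].
      apply lim_mult; [by apply Hrp|]. repeat apply lim_mult; assumption.
    + repeat apply lim_mult; try assumption; apply lim_const.
    + repeat apply lim_mult; try assumption; apply lim_const.
Qed.

(** Both terms of [pohozaev_rate] are nonpositive and the second is negative, so the energy strictly
    increases; a monotone function with equal limits at both ends would be constant. *)
Lemma no_interface_supercritical (g p : R -> R) xi0 eta :
  critical_sigma q d <= sg -> 0 <= xi0 < eta ->
  ode_on q sg d c g p xi0 eta -> (forall r, xi0 < r < eta -> 0 < g r) ->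
  filterlim (fun r => pohozaev q sg d c r (g r) (p r)) (at_right xi0) (locally 0) ->
  filterlim (fun r => pohozaev q sg d c r (g r) (p r)) (at_left eta) (locally 0) ->
  False.
Proof.
  intros Hcrit Hxi Hode Hpos H0 H1.
  set (F := fun r => pohozaev q sg d c r (g r) (p r)) in *.
  set (F' := fun r => Rpower r (pohozaev_exponent q d) / r * g r ^ 2
    * pohozaev_rate q sg d r).
  assert (Hder : forall r, xi0 < r < eta -> is_derive (fun r => - F r) r (F' r) /\ F' r < 0).
  { intros r Hr. destruct (Hode r Hr) as [Hg Hp]. split.
    - rewrite -(Ropp_involutive (F' r)). apply (is_derive_opp F).
      apply is_derive_pohozaev; try easy; try lra. by apply Hpos.
    - specialize (Hpos r Hr).
      assert (A : 0 < Rpower r (pohozaev_exponent q d) / r * g r ^ 2).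
      { apply Rmult_lt_0_compat; [apply Rdiv_lt_0_compat; [apply Rpower_gt0|lra]|nra]. }
      assert (Hrate : pohozaev_rate q sg d r < 0); [|unfold F'; nra].
      unfold pohozaev_rate.
      assert (Hka := pohozaev_kappa_pos q d Hq Hd).
      assert (Hal := pohozaev_exponent_gt2 q d Hq Hd).
      assert (B1 : pohozaev_kappa q d * (2 - pohozaev_exponent q d) / r ^ 2 < 0).
      { apply Rlt_div_l; nra. }
      generalize (rpow_ge0 r sg). nra. }
  assert (Hdec : forall x y, xi0 < x -> x <= y -> y < eta -> - F y <= - F x).
  { apply (nonincreasing_of_derive (fun r => - F r) F'). intros r Hr.
    destruct (Hder r Hr). split; [assumption|lra]. }
  assert (Hzero : forall x, xi0 < x < eta -> - F x = - 0).
  { intros x Hx. apply Rle_antisym.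
    - apply (nonincreasing_le_right_limit (fun r => - F r) xi0 eta); try assumption.
      by apply lim_opp.
    - apply (nonincreasing_ge_left_limit (fun r => - F r) xi0 eta); try assumption.
      by apply lim_opp. }
  set (x := (xi0 + eta) / 2).
  destruct (Hder x) as [A1 A2]; [unfold x; lra|].
  destruct (derive_neg_lower_right (fun r => - F r) x eta (F' x)) as [z [Hz Hlt]];
    [unfold x; lra|exact A1|exact A2|].
  unfold x in *. rewrite !Hzero in Hlt; lra.
Qed.

End Nonexistence.

Lemma nonneg_solution_ode N m sg f : 1 < m -> nonneg_solution N m sg f ->
  forall v, ode_on (/ m) sg (INR N - 1) (1 / (m - 1)) (fpow m f) (Derive (fpow m f)) 0 v.
Proof.
  intros Hm [Hnn [_ Heq]] v r Hr. destruct (Heq r ltac:(lra)) as [H1 [H2 H3]].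
  split; [by apply Derive_correct|].
  replace (acceleration _ _ _ _ _ _ _) with (Derive (Derive (fpow m f)) r);
    [by apply Derive_correct|].
  unfold acceleration, reaction. unfold fpow at 2.
  rewrite rpow_rpow; [|lra|field; lra|apply Hnn; lra]. lra.
Qed.

Lemma critical_sigma_eq N m : 1 < m -> critical_sigma (/ m) (INR N - 1) = sigma_c N m.
Proof. intros Hm. unfold critical_sigma, sigma_c. field. repeat split; lra. Qed.

Lemma inv_exponent m : 1 < m -> 0 < / m < 1.
Proof.
  intros Hm. split; [apply Rinv_0_lt_compat; lra|].
  rewrite -Rinv_1. apply Rinv_lt_contravar; lra.
Qed.

Lemma dimension_ge3 N : (4 <= N)%nat -> 3 <= INR N - 1.
Proof. intros H. apply le_INR in H. simpl in H. lra. Qed.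

Lemma no_interface (m : R) (N : nat) (sg : R) (f : R -> R) (eta : R) :
  1 < m -> (4 <= N)%nat -> sigma_c N m <= sg ->
  ~ good_profile_with_interface N m sg f eta.
Proof.
  intros Hm HN Hsg [[Hsol _] [[Heta [Hfe [Hde _]]] [xi0 [Hst [Hlt Hpos]]]]].
  assert (Hq := inv_exponent m Hm). assert (Hd := dimension_ge3 N HN).
  assert (Hode := nonneg_solution_ode N m sg f Hm Hsol eta).
  set (g := fpow m f) in *. set (p := Derive g) in *.
  assert (Hxi : 0 <= xi0) by (destruct Hst as [[-> _]|[H _]]; lra).
  assert (Hc : 0 < 1 / (m - 1)) by (apply Rdiv_lt_0_compat; lra).
  assert (Hsg0 : 0 < sg).
  { apply: Rlt_le_trans Hsg. unfold sigma_c. apply Rdiv_lt_0_compat; nra. }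
  assert (Hgpos : forall r, xi0 < r < eta -> 0 < g r).
  { intros r Hr. unfold g, fpow. rewrite rpow_pos; [apply Rpower_gt0|by apply Hpos]. }
  (* This gives the limit 0 of the energy at the interface and at a starting point of type P3; types
     P1 and P2 are settled together by [pohozaev_lim_origin]. *)
  assert (Hvanish : forall x, 0 < x -> f x = 0 -> is_derive g x 0 ->
    continuous g x /\ continuous p x /\
    pohozaev (/ m) sg (INR N - 1) (1 / (m - 1)) x (g x) (p x) = 0).
  { intros x Hx Hfx Hdx.
    destruct (nonneg_solution_ode N m sg f Hm Hsol (x + 1) x ltac:(lra)) as [D1 D2].
    fold g in D1, D2. fold p in D2.
    split; [eapply is_derive_continuous; exact D1|].
    split; [eapply is_derive_continuous; exact D2|].
    assert (E1 : g x = 0) by (unfold g, fpow; rewrite Hfx rpow_npos; lra).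
    assert (E2 : p x = 0) by (unfold p; by apply is_derive_unique).
    rewrite E1 E2 pohozaev_at_zero. field. }
  apply (no_interface_supercritical (/ m) sg (INR N - 1) (1 / (m - 1)) Hq Hd
    g p xi0 eta); try lra.
  - rewrite critical_sigma_eq; lra.
  - intros r Hr. apply Hode; lra.
  - exact Hgpos.
  - destruct Hst as [[-> _]|[Hx0 [Hf0 [Hd0 _]]]].
    + apply (pohozaev_lim_origin (/ m) sg (INR N - 1) (1 / (m - 1)) Hq Hsg0 Hd Hc
        g p (rpow (f 0) m) eta); try assumption.
      destruct Hsol as [_ [Hcont _]].
      apply (lim_comp (fun y => rpow y m)); [apply continuous_rpow; lra|exact Hcont].
    + destruct (Hvanish xi0 Hx0 Hf0 Hd0) as [C1 [C2 <-]].
      apply lim_pohozaev; try lra; try typeclasses eauto;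
        [apply filterlim_at_right_id|by apply continuous_at_right|by apply continuous_at_right].
  - destruct (Hvanish eta Heta Hfe Hde) as [C1 [C2 <-]].
    apply lim_pohozaev; try lra; try typeclasses eauto;
      [apply filterlim_at_left_id|by apply continuous_at_left|by apply continuous_at_left].
Qed.

(** * Existence *)

Lemma is_derive_0_iff (f : R -> R) x :
  is_derive f x 0 <->
  forall eps, 0 < eps -> locally x (fun y => Rabs (f y - f x) <= eps * Rabs (y - x)).
Proof.
  split.
  - intros [_ H] eps He. specialize (H x (fun P HP => HP) (mkposreal _ He)).
    apply: filter_imp H => y Hy.
    change (Rabs (f y - f x - (y - x) * 0) <= eps * Rabs (y - x)) in Hy.
    by rewrite Rmult_0_r Rminus_0_r in Hy.
  - intros H. split; [apply is_linear_scal_l|]. intros y Hy eps.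
    assert (E := is_filter_lim_locally_unique (V := R_NormedModule) x y Hy).
    rewrite -E. apply: filter_imp (H eps (cond_pos eps)) => t Ht.
    change (Rabs (f t - f x - (t - x) * 0) <= eps * Rabs (t - x)).
    by rewrite Rmult_0_r Rminus_0_r.
Qed.

(** A tool for junctions: comparison with one function of zero derivative on both sides avoids
    one-sided derivatives. *)
Lemma is_derive_0_dominated (f u : R -> R) x :
  is_derive u x 0 -> locally x (fun y => Rabs (f y - f x) <= Rabs (u y - u x)) ->
  is_derive f x 0.
Proof.
  intros Hu Hfu. apply is_derive_0_iff. intros eps He.
  apply: filter_imp (filter_and _ _ Hfu (proj1 (is_derive_0_iff u x) Hu eps He))
    => y [H1 H2]. lra.
Qed.

Lemma is_right_derive_of_is_derive f x l : is_derive f x l -> is_right_derive f x l.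
Proof.
  intros H. apply is_derive_Reals in H. apply lim_eps; [typeclasses eauto|].
  intros eps He. destruct (H eps He) as [[delta Hdelta] Hd]. simpl in Hd.
  exists (mkposreal delta Hdelta). intros y Hy Hxy. change (Rabs (y - x) < delta) in Hy.
  specialize (Hd (y - x) ltac:(lra) Hy). by rewrite Rplus_minus in Hd.
Qed.

Lemma locally_lt x y : x < y -> locally x (fun z => z < y).
Proof. intros H; by apply (open_lt y x). Qed.

Lemma locally_gt x y : y < x -> locally x (fun z => y < z).
Proof. intros H; by apply (open_gt y x). Qed.

(** * Extension of a shooting solution to the whole half-line *)

Section Gluing.

Variables (r0 a z : R) (g p : R -> R).

(** If [r0 > 0] the start value is 0 and this is extension by zero. If [r0 = 0] the constant [a] at
    negative arguments provides a two-sided derivative at the origin. *)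
Definition glued (r : R) : R :=
  if Rle_dec r r0 is left _ then a
  else if Rlt_dec r (r0 + z) is left _ then g (r - r0) else 0.

Definition glued_velocity (r : R) : R :=
  if Rle_dec r r0 is left _ then 0
  else if Rlt_dec r (r0 + z) is left _ then p (r - r0) else 0.

Lemma glued_left r : r <= r0 -> glued r = a /\ glued_velocity r = 0.
Proof. intros H; unfold glued, glued_velocity; destruct (Rle_dec r r0); [easy|lra]. Qed.

Lemma glued_inside r : r0 < r < r0 + z ->
  glued r = g (r - r0) /\ glued_velocity r = p (r - r0).
Proof.
  intros H; unfold glued, glued_velocity. destruct (Rle_dec r r0); [lra|].
  destruct (Rlt_dec r (r0 + z)); [easy|lra].
Qed.

Hypothesis Hz0 : 0 < z.

Lemma glued_right r : r0 + z <= r -> glued r = 0 /\ glued_velocity r = 0.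
Proof.
  intros H; unfold glued, glued_velocity. destruct (Rle_dec r r0); [lra|].
  destruct (Rlt_dec r (r0 + z)); [lra|easy].
Qed.

Hypotheses (Ha : 0 <= a) (Hpos : forall s, 0 < s < z -> 0 < g s).

Lemma glued_ge0 r : 0 <= glued r.
Proof.
  destruct (Rle_dec r r0) as [H|H]; [by rewrite (proj1 (glued_left r H))|].
  destruct (Rlt_dec r (r0 + z)) as [H1|H1].
  - rewrite (proj1 (glued_inside r ltac:(lra))). apply Rlt_le, Hpos; lra.
  - rewrite (proj1 (glued_right r ltac:(lra))); lra.
Qed.

Variables (q sg d c T B : R).
Hypotheses (Hq : 0 < q < 1) (Hsg : 0 < sg) (Hstart : 0 < r0 -> a = 0) (HzT : z < T)
  (Hsol : exact_solution q sg d c r0 a T B g p) (Hgz : g z = 0) (Hpz : p z = 0).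

Lemma acceleration_at_rest r : acceleration q sg d c r 0 0 = 0.
Proof. unfold acceleration, reaction. rewrite (rpow_npos 0 q); [ring|lra]. Qed.

Lemma is_derive_glued_start : is_derive glued r0 0.
Proof.
  apply (is_derive_0_dominated _ (fun r => B * (r - r0) ^ 2)).
  - auto_derive; [easy|ring].
  - generalize (locally_lt r0 (r0 + z) ltac:(lra)). apply filter_imp => y Hy.
    rewrite (proj1 (glued_left r0 (Rle_refl _))).
    replace (B * (y - r0) ^ 2 - B * (r0 - r0) ^ 2) with (B * (y - r0) ^ 2) by ring.
    destruct (Rle_dec y r0) as [H|H].
    + rewrite (proj1 (glued_left y H)) Rminus_diag Rabs_R0. apply Rabs_pos.
    + rewrite (proj1 (glued_inside y ltac:(lra))).
      destruct (proj1 Hsol (y - r0) ltac:(lra)) as [_ [_ H1]].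
      apply: Rle_trans H1 _. apply Rle_abs.
Qed.

(** The growth bounds give only [p = O(s)], while a second derivative equal to 0 at the junction
    needs [p = o(s)]. It holds because the acceleration tends to 0: the start value is 0 and the
    friction is regular at [r0 > 0]. *)
Lemma velocity_sublinear : 0 < r0 -> forall eps, 0 < eps ->
  exists e, 0 < e <= z /\ forall s, 0 < s < e -> Rabs (p s) <= eps * s.
Proof.
  intros Hr0p eps He.
  assert (HT : 0 < T) by lra.
  destruct (exact_solution_start_lim _ _ _ _ _ _ _ _ _ _ HT Hsol) as [Hg Hp].
  rewrite (Hstart Hr0p) in Hg.
  assert (Hacc : filterlim (fun s => acceleration q sg d c (r0 + s) (g s) (p s)) (at_right 0)
    (locally (acceleration q sg d c (r0 + 0) 0 0))).
  { unfold acceleration, reaction.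
    assert (Hr : filterlim (fun s => r0 + s) (at_right 0) (locally (r0 + 0))).
    { apply lim_plus; [apply lim_const|apply filterlim_at_right_id]. }
    apply lim_minus; [apply lim_minus; apply lim_mult|apply lim_mult].
    - apply lim_const.
    - apply (lim_comp (fun y => rpow y q)); [apply continuous_rpow; lra|exact Hg].
    - apply (lim_comp (fun y => rpow y sg)); [apply continuous_rpow; lra|exact Hr].
    - exact Hg.
    - apply lim_div; [lra|apply lim_const|exact Hr].
    - exact Hp. }
  rewrite acceleration_at_rest in Hacc.
  destruct (proj1 (lim_eps (at_right 0) _ 0) Hacc eps He) as [e0 He0].
  assert (Hep := cond_pos e0).
  set (e := Rmin e0 z). assert (He1 : e <= e0) by apply Rmin_l.
  assert (He2 : e <= z) by apply Rmin_r.
  assert (He3 : 0 < e) by (apply Rmin_glb_lt; lra).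
  exists e. split; [lra|].
  assert (Hb : forall s, 0 < s < e -> is_derive p s
      (acceleration q sg d c (r0 + s) (g s) (p s)) /\
    Rabs (acceleration q sg d c (r0 + s) (g s) (p s)) < eps).
  { intros s Hs. split; [apply Hsol; lra|].
    rewrite -(Rminus_0_r (acceleration _ _ _ _ _ _ _)). apply He0; [|lra].
    change (Rabs (s - 0) < e0). rewrite Rminus_0_r Rabs_pos_eq; lra. }
  assert (Hlin : filterlim (fun s => eps * s) (at_right 0) (locally (eps * 0))).
  { apply lim_mult; [apply lim_const|apply filterlim_at_right_id]. }
  intros s Hs. apply Rabs_le_between.
  assert (H1 : p s - eps * s <= 0 - eps * 0).
  { apply (nonincreasing_le_right_limit (fun s => p s - eps * s) 0 e); [|by apply lim_minus|lra].
    apply (nonincreasing_of_derive _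
      (fun s => acceleration q sg d c (r0 + s) (g s) (p s) - eps)).
    intros x Hx. destruct (Hb x Hx) as [D Hx2]. apply Rabs_lt_between in Hx2. split; [|lra].
    apply (is_derive_minus p (fun s => eps * s)); [exact D|]. auto_derive; [easy|ring]. }
  assert (H2 : - p s - eps * s <= - 0 - eps * 0).
  { apply (nonincreasing_le_right_limit (fun s => - p s - eps * s) 0 e);
      [|apply lim_minus; [by apply lim_opp|exact Hlin]|lra].
    apply (nonincreasing_of_derive _
      (fun s => - acceleration q sg d c (r0 + s) (g s) (p s) - eps)).
    intros x Hx. destruct (Hb x Hx) as [D Hx2]. apply Rabs_lt_between in Hx2. split; [|lra].
    apply (is_derive_minus (fun s => - p s) (fun s => eps * s)); [by apply (is_derive_opp p)|].
    auto_derive; [easy|ring]. }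
  lra.
Qed.

Lemma is_derive_glued_velocity_start : 0 < r0 -> is_derive glued_velocity r0 0.
Proof.
  intros Hr0p. apply is_derive_0_iff. intros eps He.
  destruct (velocity_sublinear Hr0p eps He) as [e [He1 He2]].
  generalize (locally_lt r0 (r0 + e) ltac:(lra)). apply filter_imp => y Hy.
  rewrite (proj2 (glued_left r0 (Rle_refl _))).
  destruct (Rle_dec y r0) as [H|H].
  - rewrite (proj2 (glued_left y H)) Rminus_diag Rabs_R0.
    apply Rmult_le_pos; [lra|apply Rabs_pos].
  - rewrite (proj2 (glued_inside y ltac:(lra))) Rminus_0_r.
    rewrite (Rabs_pos_eq (y - r0)); [|lra]. apply He2; lra.
Qed.

(** The solution [g] continues past [z], where value, velocity and hence acceleration vanish; the
    glued functions are dominated by this continuation. *)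
Lemma is_derive_glued_end : is_derive glued (r0 + z) 0 /\ is_derive glued_velocity (r0 + z) 0.
Proof.
  destruct (exact_solution_ode_on _ _ _ _ _ _ _ _ _ _ Hsol (r0 + z) ltac:(lra)) as [D1 D2].
  assert (E : r0 + z - r0 = z) by ring.
  rewrite E Hpz in D1. rewrite E Hgz Hpz acceleration_at_rest in D2.
  destruct (glued_right (r0 + z) (Rle_refl _)) as [E1 E2].
  split.
  - apply (is_derive_0_dominated _ _ _ D1).
    generalize (locally_gt (r0 + z) r0 ltac:(lra)). apply filter_imp => y Hy.
    rewrite E1 E Hgz. destruct (Rlt_dec y (r0 + z)) as [H|H].
    + rewrite (proj1 (glued_inside y ltac:(lra))). lra.
    + rewrite (proj1 (glued_right y ltac:(lra))) Rminus_diag Rabs_R0. apply Rabs_pos.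
  - apply (is_derive_0_dominated _ _ _ D2).
    generalize (locally_gt (r0 + z) r0 ltac:(lra)). apply filter_imp => y Hy.
    rewrite E2 E Hpz. destruct (Rlt_dec y (r0 + z)) as [H|H].
    + rewrite (proj2 (glued_inside y ltac:(lra))). lra.
    + rewrite (proj2 (glued_right y ltac:(lra))) Rminus_diag Rabs_R0. apply Rabs_pos.
Qed.

Lemma glued_ode : ode_on q sg d c glued glued_velocity 0 (r0 + z + 1) /\
  forall r, r0 + z < r -> is_derive glued r 0 /\ is_derive glued_velocity r 0.
Proof.
  assert (Hout : forall r, r0 + z < r -> is_derive glued r 0 /\ is_derive glued_velocity r 0).
  { intros r Hr.
    split; (apply (is_derive_ext_loc (fun _ => 0)); [|apply @is_derive_const]);
      generalize (locally_gt r (r0 + z) Hr); apply filter_imp => y Hy; symmetry;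
      apply (glued_right y); lra. }
  split; [|exact Hout]. intros r Hr.
  destruct (Rtotal_order r r0) as [H|[->|H]].
  - destruct (glued_left r ltac:(lra)) as [E1 E2].
    rewrite E2 E1 (Hstart ltac:(lra)) acceleration_at_rest.
    split; [apply (is_derive_ext_loc (fun _ => a))|apply (is_derive_ext_loc (fun _ => 0))];
      try apply @is_derive_const;
      generalize (locally_lt r r0 H); apply filter_imp => y Hy; symmetry;
      apply (glued_left y); lra.
  - destruct (glued_left r0 (Rle_refl _)) as [E1 E2].
    rewrite E2 E1 (Hstart ltac:(lra)) acceleration_at_rest.
    split; [apply is_derive_glued_start|apply is_derive_glued_velocity_start; lra].
  - destruct (Rtotal_order r (r0 + z)) as [H1|[->|H1]].
    + destruct (glued_inside r ltac:(lra)) as [-> ->].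
      destruct (exact_solution_ode_on _ _ _ _ _ _ _ _ _ _ Hsol r ltac:(lra)) as [D1 D2].
      assert (Hloc : locally r (fun y => r0 < y < r0 + z)).
      { generalize (filter_and _ _ (locally_gt r r0 H) (locally_lt r (r0 + z) H1)).
        by apply filter_imp. }
      split; (eapply is_derive_ext_loc; [|first [exact D1|exact D2]]);
        apply: filter_imp Hloc => y Hy; symmetry; apply (glued_inside y Hy).
    + destruct (glued_right (r0 + z) (Rle_refl _)) as [-> ->].
      rewrite acceleration_at_rest. apply is_derive_glued_end.
    + destruct (glued_right r ltac:(lra)) as [-> ->].
      rewrite acceleration_at_rest. by apply Hout.
Qed.

End Gluing.

(** A start at [r0 > 0] is of type P3; a start at the origin is of type P1 or P2 according to
    whether [a] is positive or zero. *)
Lemma glued_profile (m : R) (N : nat) (sg r0 a T B z : R) (g p : R -> R) :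
  1 < m -> (4 <= N)%nat -> 0 < sg -> 0 <= r0 -> 0 <= a -> (0 < r0 -> a = 0) -> 0 < z < T ->
  exact_solution (/ m) sg (INR N - 1) (1 / (m - 1)) r0 a T B g p ->
  g z = 0 -> p z = 0 -> (forall s, 0 < s < z -> 0 < g s) ->
  good_profile_with_interface N m sg (fun r => rpow (glued r0 a z g r) (/ m)) (r0 + z).
Proof.
  intros Hm HN Hsg Hr0 Ha Hstart Hz Hsol Hgz Hpz Hpos.
  assert (Hq := inv_exponent m Hm). assert (Hd := dimension_ge3 N HN).
  set (G := glued r0 a z g). set (P := glued_velocity r0 z p).
  set (f := fun r => rpow (G r) (/ m)).
  assert (HG : forall r, 0 <= G r) by (intros r; by apply (glued_ge0 r0 a z g p (proj1 Hz))).
  assert (Hf : forall r, fpow m f r = G r).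
  { intros r. unfold fpow, f. apply rpow_rpow; [lra|field; lra|apply HG]. }
  assert (Hode : forall r, 0 < r -> is_derive G r (P r) /\
    is_derive P r (acceleration (/ m) sg (INR N - 1) (1 / (m - 1)) r (G r) (P r))).
  { intros r Hr.
    destruct (glued_ode r0 a z g p (proj1 Hz) (/ m) sg (INR N - 1) (1 / (m - 1)) T B)
      as [H1 H2]; try assumption; try lra.
    destruct (Rlt_dec r (r0 + z + 1)) as [Hlt|Hlt]; [apply H1; lra|].
    destruct (glued_right r0 a z g p (proj1 Hz) r ltac:(lra)) as [E1 E2].
    fold G in E1. fold P in E2. rewrite E1 E2 acceleration_at_rest. apply H2; lra. }
  assert (Hder : forall r, 0 < r -> Derive (fpow m f) r = P r).
  { intros r Hr. rewrite (Derive_ext _ G); [|exact Hf].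
    apply is_derive_unique, Hode, Hr. }
  assert (Hder2 : forall r, 0 < r -> locally r (fun y => P y = Derive (fpow m f) y)).
  { intros r Hr. apply: filter_imp (locally_gt r 0 Hr) => y Hy. symmetry; by apply Hder. }
  assert (Hstart0 : is_derive G r0 0).
  { exact (is_derive_glued_start r0 a z g p (proj1 Hz) _ _ _ _ T B (proj2 Hz) Hsol). }
  assert (Hend : is_derive G (r0 + z) 0).
  { exact (proj1 (is_derive_glued_end r0 a z g p (proj1 Hz) _ _ _ _ T B (proj2 Hz) Hsol Hgz Hpz)). }
  assert (Hext : forall x, is_derive G x 0 -> is_derive (fpow m f) x 0).
  { intros x H. apply (is_derive_ext G); [intros t; by rewrite Hf|exact H]. }
  assert (HGr0 : G r0 = a) by (apply (glued_left r0 a z g p); lra).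
  assert (Hinside : forall r, r0 < r < r0 + z -> 0 < f r).
  { intros r Hr. unfold f, G. rewrite (proj1 (glued_inside r0 a z g p r Hr)).
    rewrite rpow_pos; [apply Rpower_gt0|apply Hpos; lra]. }
  assert (Hsolf : nonneg_solution N m sg f).
  { split; [intros; apply rpow_ge0|split].
    - unfold f. apply (lim_comp (fun y => rpow y (/ m))); [apply continuous_rpow; lra|].
      apply continuous_at_right. destruct (Rle_lt_or_eq_dec 0 r0 Hr0) as [Hlt| <-].
      + apply (continuous_ext_loc _ (fun _ => a)); [|apply continuous_const].
        apply: filter_imp (locally_lt 0 r0 Hlt) => y Hy. symmetry.
        apply (glued_left r0 a z g p); lra.
      + exact (is_derive_continuous _ _ _ Hstart0).
    - intros r Hr. destruct (Hode r Hr) as [D1 D2]. rewrite Hder // Hf.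
      assert (D3 : is_derive (Derive (fpow m f)) r
        (acceleration (/ m) sg (INR N - 1) (1 / (m - 1)) r (G r) (P r))).
      { apply (is_derive_ext_loc P); [by apply Hder2|exact D2]. }
      split; [|split].
      + apply (ex_derive_ext G); [intros t; by rewrite Hf|]. by eexists; exact D1.
      + by eexists; exact D3.
      + rewrite (is_derive_unique _ _ _ D3). unfold acceleration, reaction, f. ring. }
  assert (Hst : starts_at m f r0).
  { destruct (Rle_lt_or_eq_dec 0 r0 Hr0) as [Hlt|Heq].
    - right. split; [exact Hlt|split; [|split]].
      + unfold f. rewrite HGr0 (Hstart Hlt) rpow_npos; lra.
      + by apply Hext.
      + assert (Hr0z : r0 < r0 + z) by lra.
        apply: filter_imp (at_right_interval r0 (r0 + z) Hr0z) => y Hy. by apply Hinside.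
    - left. split; [by rewrite -Heq|]. rewrite -Heq in HGr0 Hstart0.
      destruct (Rle_lt_or_eq_dec 0 a Ha) as [Hap|Ha0].
      + left. split.
        * unfold f. rewrite HGr0 rpow_pos //. apply Rpower_gt0.
        * apply is_right_derive_of_is_derive.
          (* Chain rule: the root is differentiable at [a > 0], so [f] inherits the zero derivative
             of [G]. *)
          replace 0 with (0 * (/ m * Rpower a (/ m) / a)) at 2 by ring.
          apply (is_derive_ext_loc (fun r => Rpower (G r) (/ m))).
          { assert (HcG := is_derive_continuous _ _ _ Hstart0).
            generalize (proj1 (lim_eps (locally 0) G (G 0)) HcG a Hap). apply filter_imp.
            intros y Hy. rewrite HGr0 in Hy. apply Rabs_lt_between in Hy.
            unfold f. rewrite rpow_pos //; lra. }
          apply (is_derive_comp (fun y => Rpower y (/ m)) G); [|exact Hstart0].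
          rewrite HGr0. by apply is_derive_Rpower_base.
      + right. split.
        * unfold f. rewrite HGr0 -Ha0 rpow_npos; lra.
        * by apply is_right_derive_of_is_derive, Hext. }
  split; [split; [exact Hsolf|by exists r0]|split].
  - split; [lra|split; [|split]].
    + unfold f, G. rewrite (proj1 (glued_right r0 a z g p (proj1 Hz) (r0 + z) (Rle_refl _))).
      rewrite rpow_npos; lra.
    + by apply Hext.
    + assert (Hr0z : r0 < r0 + z) by lra.
      apply: filter_imp (at_left_interval r0 (r0 + z) Hr0z) => y Hy. by apply Hinside.
  - exists r0. split; [exact Hst|split; [lra|exact Hinside]].
Qed.

(** [T'] exceeds the extent that positive energy allows beyond radius [X + 1], so the first zero
    comes before [T']. There nonnegativity makes it an interior minimum, whence [p z = 0]. *)
Lemma first_zero_before_end (q sg d c X r0 a T B T' : R) (g p : R -> R) e s :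
  0 < q < 1 -> 0 < sg -> 3 <= d -> 0 < c ->
  (forall r, X <= r -> far q sg d c r) ->
  0 <= r0 <= X -> T' = X + 1 + max_extent q c + 1 -> T = T' + 1 ->
  exact_solution q sg d c r0 a T B g p ->
  (forall x, 0 <= x <= T' -> 0 <= g x) ->
  0 < e -> (forall x, 0 < x <= e -> 0 < g x) -> 0 < s <= T' -> g s = 0 ->
  exists z, 0 < z < T /\ g z = 0 /\ p z = 0 /\ forall x, 0 < x < z -> 0 < g x.
Proof.
  intros Hq Hsg Hd Hc Hfar Hr0 ET' ET Hsol Hnn He Hpe Hs Hgs.
  destruct (exact_solution_first_zero _ _ _ _ _ _ _ _ _ _ Hsol e s Hpe He)
    as [z [Hz [Hgz Hpos]]]; try lra.
  exists z. split; [lra|split; [exact Hgz|split; [|exact Hpos]]].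
  destruct (Rlt_dec z T') as [HzT|HzT].
  - destruct (proj2 Hsol z ltac:(lra)) as [D _].
    destruct (Rtotal_order (p z) 0) as [H|[H|H]]; [exfalso|exact H|exfalso].
    + destruct (derive_neg_lower_right g z T' (p z) HzT D H) as [x [Hx Hgx]].
      specialize (Hnn x ltac:(lra)); lra.
    + destruct (derive_pos_lower_left g 0 z (p z) ltac:(lra) D H) as [x [Hx Hgx]].
      specialize (Hnn x ltac:(lra)); lra.
  - exfalso.
    (* Now [z = T']. Beyond [X] the energy strictly decreases to a nonnegative limit at this zero,
       hence is positive before it. *)
    set (G := fun r => g (r - r0)). set (P := fun r => p (r - r0)).
    assert (Hode : ode_on q sg d c G P r0 (r0 + T)) by (eapply exact_solution_ode_on; exact Hsol).
    set (F := fun r => pohozaev q sg d c r (G r) (P r)).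
    set (F' := fun r => - (Rpower r (pohozaev_exponent q d) / r
      * G r ^ 2 * pohozaev_rate q sg d r)).
    assert (HX : 1 <= X) by (apply (Hfar X); lra).
    assert (Hext : 0 <= max_extent q c).
    { unfold max_extent. assert (0 <= sqrt (ratio_threshold q c) / slope_rate q c); [|lra].
      apply Rdiv_le_0_compat; [apply sqrt_pos|by apply slope_rate_pos]. }
    assert (HF : forall r, X < r < r0 + z -> is_derive F r (F' r) /\ F' r < 0).
    { intros r Hr. destruct (Hode r ltac:(lra)) as [H1 H2].
      assert (Hgr : 0 < G r) by (apply Hpos; lra).
      split; [apply is_derive_pohozaev; try easy; lra|].
      destruct (Hfar r ltac:(lra)) as [_ [_ [_ [_ [_ [Hrate _]]]]]].
      assert (0 < Rpower r (pohozaev_exponent q d) / r * G r ^ 2).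
      { apply Rmult_lt_0_compat; [|nra].
        apply Rdiv_lt_0_compat; [apply Rpower_gt0|lra]. }
      unfold F'. nra. }
    assert (Hdec : forall x y, X < x -> x <= y -> y < r0 + z -> F y <= F x).
    { apply (nonincreasing_of_derive F F'). intros r Hr. destruct (HF r Hr).
      split; [assumption|lra]. }
    destruct (exact_solution_continuous _ _ _ _ _ _ _ _ _ _ Hsol z ltac:(lra)) as [Cg Cp].
    assert (Hsh : filterlim (fun r => r - r0) (at_left (r0 + z)) (locally z)).
    { replace z with (r0 + z - r0) at 2 by ring.
      apply lim_minus; [apply filterlim_at_left_id|apply lim_const]. }
    assert (HFz : filterlim F (at_left (r0 + z)) (locally (pohozaev q sg d c (r0 + z) 0 (p z)))).
    { apply lim_pohozaev; try lra; try typeclasses eauto.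
      - apply filterlim_at_left_id.
      - rewrite -Hgz. by apply (lim_comp g).
      - by apply (lim_comp p). }
    assert (HFnn : forall r, X < r < r0 + z -> 0 <= F r).
    { intros r Hr. apply (Rle_trans _ (pohozaev q sg d c (r0 + z) 0 (p z))).
      - apply pohozaev_ge0_at_zero.
      - by apply (nonincreasing_ge_left_limit F X (r0 + z)). }
    assert (Hbound : r0 + z <= X + 1 + max_extent q c); [|lra].
    apply (positive_energy_extent q sg d c Hq Hsg Hd Hc G P X (X + 1) (r0 + z)); try lra.
    + intros r Hr. apply Hfar; lra.
    + intros r Hr. apply Hode; lra.
    + intros r Hr. split; [apply Hpos; lra|].
      destruct (HF r ltac:(lra)) as [D1 D2].
      destruct (derive_neg_lower_right F r (r0 + z) (F' r) ltac:(lra) D1 D2) as [x [Hx Hlt]].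
      specialize (HFnn x ltac:(lra)). fold (F r). lra.
Qed.

Lemma interface_exists (m : R) (N : nat) (sg : R) :
  1 < m -> (4 <= N)%nat -> 0 < sg < sigma_c N m ->
  exists (f : R -> R) (eta : R), good_profile_with_interface N m sg f eta.
Proof.
  intros Hm HN [Hsg Hcrit].
  assert (Hq := inv_exponent m Hm). assert (Hd := dimension_ge3 N HN).
  assert (Hc : 0 < 1 / (m - 1)) by (apply Rdiv_lt_0_compat; lra).
  set (q := / m) in *. set (d := INR N - 1) in *. set (c := 1 / (m - 1)) in *.
  destruct (eventually_far q sg d c Hq Hsg Hd Hc) as [X [HX Hfar]].
  { unfold q, d. rewrite critical_sigma_eq; lra. }
  assert (Hext : 11 <= max_extent q c).
  { unfold max_extent. assert (0 <= sqrt (ratio_threshold q c) / slope_rate q c); [|lra].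
    apply Rdiv_le_0_compat; [apply sqrt_pos|by apply slope_rate_pos]. }
  set (T' := X + 1 + max_extent q c + 1).
  destruct free_ultrafilter as [U [HU [Hultra Hfree]]].
  assert (HT' : 1 <= T') by (unfold T'; lra).
  destruct (shooting_limit Hultra Hfree q sg d c X T' Hq Hsg Hd Hc HX HT')
    as [t [g [p [Ht [Hsol [Hnn [[e [He Hpe]] [s [Hs Hgs]]]]]]]]].
  - destruct (power_dominates_linear q (rpow X sg) c) as [y0 [Hy0 Hdom]]; try lra.
    { rewrite rpow_pos; [apply Rpower_gt0|lra]. }
    (* Below [y0] the start value lies under the equilibrium of the reaction at radius [X], as
       negative energy requires. *)
    exists (Rmin y0 1).
    split; [split; [apply Rmin_glb_lt; lra|apply Rmin_r]|].
    intros dl Hdl g p Hsol. apply (exact_solution_pos_of_far q sg d c X dl (T' + 1)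
      (euler_bound sg c (X + (T' + 1)) 1 (T' + 1)) g p); try assumption; try lra.
    apply Hdom. assert (H := Rmin_l y0 1). lra.
  - intros g p Hsol.
    apply (linear_solution_negative q sg d X T' (T' + 1)
      (euler_bound sg c (X + (T' + 1)) 1 (T' + 1)) g p); try lra; try assumption.
    + unfold T'; lra.
    + intros r Hr. destruct (Hfar r Hr) as [Hr1 [Hrs [H3 _]]].
      assert (H1 : (1 - q) / (q + 3) * rpow r sg <= rpow r sg).
      { rewrite -{2}(Rmult_1_l (rpow r sg)). apply Rmult_le_compat_r; [lra|].
        apply Rle_div_l; lra. }
      assert (H2 : d ^ 2 / (2 * r ^ 2) <= d ^ 2 / 2); [|lra].
      apply Rle_div_l; [nra|].
      replace (d ^ 2 / 2 * (2 * r ^ 2)) with (d ^ 2 * r ^ 2) by field.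
      rewrite -{1}(Rmult_1_r (d ^ 2)). apply Rmult_le_compat_l; nra.
  - set (c' := absorption_coef c t) in *.
    assert (Hc' : 0 < c').
    { apply Rmult_lt_0_compat; [exact Hc|]. apply Rmin_glb_lt; [lra|].
      apply: Rlt_le_trans (Rmax_r _ _). lra. }
    (* Rescaling by [A] restores the coefficient [c] and leaves zeros and signs unchanged. *)
    set (A := Rpower (c / c') (/ (1 - q))).
    assert (HA : 0 < A) by apply Rpower_gt0.
    apply (exact_solution_scale _ _ _ _ _ _ _ _ _ _ A HA) in Hsol.
    replace (c' * Rpower A (1 - q)) with c in Hsol.
    2:{ unfold A. rewrite Rpower_root_mult; [field; lra| |lra].
        by apply Rdiv_lt_0_compat. }
    destruct (path_bounds c X Hc HX 0 t) as [Hr0 [Ha _]]; try lra.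
    destruct (first_zero_before_end q sg d c X (start_radius t) (A * start_value 0 t)
      (T' + 1) _ T' _ _ e s Hq Hsg Hd Hc Hfar Hr0 eq_refl eq_refl Hsol)
      as [z [Hz [Hgz [Hpz Hpos]]]];
      try lra.
    { intros x Hx. specialize (Hnn x Hx). nra. }
    { intros x Hx. specialize (Hpe x Hx). nra. }
    { rewrite Hgs. ring. }
    exists (fun r => rpow (glued (start_radius t) (A * start_value 0 t) z
      (fun s => A * g s) r) (/ m)), (start_radius t + z).
    eapply glued_profile; try exact Hsol; try assumption; try lra.
    + apply Rmult_le_pos; lra.
    + unfold start_radius, start_value. intros Hr.
      assert (Htneg : t < 0).
      { apply Rnot_le_lt; intros Hge. rewrite Rmax_left in Hr; lra. }
      rewrite Rmin_left ?Rmax_left; lra.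
Qed.

Theorem theorem1p2 (m : R) (N : nat) (hm : 1 < m) (hN : (4 <= N)%nat) :
  (forall sigma : R, 0 < sigma < sigma_c N m ->
     exists (f : R -> R) (eta : R),
       good_profile_with_interface N m sigma f eta) /\
  (forall sigma : R, sigma_c N m <= sigma <= 2 * (INR N - 3) ->
     ~ exists (f : R -> R) (eta : R),
         good_profile_with_interface N m sigma f eta).
Proof.
  split.
  - intros sigma Hs. by apply interface_exists.
  - intros sigma Hs [f [eta Hf]].
    by apply (no_interface m N sigma f eta hm hN (proj1 Hs)).
Qed.
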